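(* Let $n \geq 3$ and let $G$ be a connected Lie group locally isomorphic to $O(1,n)$. Suppose that $G$ acts on a connected manifold $M$ preserving a Lorentz metric. Then all noncompact stabilizers have a Lie algebra isomorphic to either $\mathfrak{o}(1,n)$, $\mathfrak{o}(1,n-1)$, or $\mathfrak{o}(n-1) \ltimes \mathbf{R}^{n-1}$.
   Context: Two Lie groups are locally isomorphic if their Lie algebras are isomorphic. In $\mathfrak{o}(n-1) \ltimes \mathbf{R}^{n-1}$, $\mathfrak{o}(n-1)$ acts on $\mathbf{R}^{n-1}$ by the standard representation. Stabilizers are those of points of $M$. *)

(* Defs.v *)
From HB Require Import structures.
From mathcomp Require Import all_boot all_order all_algebra.
From mathcomp Require Import all_classical all_reals all_analysis.

Set Implicit Arguments.
Unset Strict Implicit.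
Unset Printing Implicit Defensive.

Import Order.TTheory GRing.Theory Num.Theory.
Import numFieldNormedType.Exports.

Local Open Scope classical_set_scope.
Local Open Scope ring_scope.

(* Being C^k on an open set U (U is open in every use below). *)
Fixpoint Ck (R : realType) (V W : normedModType R) (k : nat) (U : set V)
    (f : V -> W) : Prop :=
  if k is k'.+1 then
    (forall x, U x -> differentiable f x) /\
    (forall v, Ck k' U (fun x => 'd f x v))
  else forall x, U x -> {for x, continuous f}.

Definition smooth_on (R : realType) (V W : normedModType R) (U : set V)
    (f : V -> W) : Prop :=
  forall k, Ck k U f.

(* [cmap] is meaningful on [cdom] only, and [cinv] on its image only. *)
Record chart (R : realType) (m : nat) (T : topologicalType) := Chart {
  cdom : set T ;
  cmap : T -> 'rV[R]_m ;
  cinv : 'rV[R]_m -> T ;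
  open_cdom : open cdom ;
  open_cimg : open (cmap @` cdom) ;
  cmapK : forall x, cdom x -> cinv (cmap x) = x ;
  cmap_cont : forall x, cdom x -> {for x, continuous cmap} ;
  cinv_cont : forall y, (cmap @` cdom) y -> {for y, continuous cinv}
}.

Definition cimg (R : realType) (m : nat) (T : topologicalType)
  (c : chart R m T) : set 'rV[R]_m := cmap c @` cdom c.

(* A map f read in the charts c (source) and d (target). *)
Definition read (R : realType) (m n : nat) (S T : topologicalType)
    (c : chart R m S) (d : chart R n T) (f : S -> T) : 'rV[R]_m -> 'rV[R]_n :=
  fun y => cmap d (f (cinv c y)).

Definition read_dom (R : realType) (m n : nat) (S T : topologicalType)
    (c : chart R m S) (d : chart R n T) (f : S -> T) : set 'rV[R]_m :=
  cmap c @` (cdom c `&` f @^-1` cdom d).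

(* The atlas of a manifold is presented as a family of charts indexed by the
   points, [chart_at x] being a chart around x (the charts need not be
   distinct).  This provides a preferred identification of the tangent space at
   x with R^m, so that tangent vectors at x are plain elements of 'rV[R]_m,
   namely their coordinates in [chart_at x]. *)
HB.mixin Record isManifold (R : realType) (m : nat) T of Topological T := {
  chart_at : T -> chart R m T ;
  chart_atP : forall x, cdom (chart_at x) x ;
  chart_compat : forall x y,
    smooth_on (read_dom (chart_at x) (chart_at y) id)
              (read (chart_at x) (chart_at y) id) ;
  manifold_hausdorff : hausdorff_space T ;
  manifold_second_countable : @second_countable T
}.

#[short(type="manifoldType")]
HB.structure Definition Manifold (R : realType) (m : nat) :=
  {T of Topological T & isManifold R m T}.

Definition smooth (R : realType) (m n : nat) (M : manifoldType R m)
    (N : manifoldType R n) (f : M -> N) : Prop :=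
  continuous f /\
  forall x y, smooth_on (read_dom (chart_at x) (chart_at y) f)
                        (read (chart_at x) (chart_at y) f).

(* Smoothness of a map on the product manifold M x N. *)
Definition smooth2 (R : realType) (m n p : nat) (M : manifoldType R m)
    (N : manifoldType R n) (P : manifoldType R p) (f : M -> N -> P) : Prop :=
  continuous (fun q : M * N => f q.1 q.2) /\
  forall x y z,
    smooth_on
      [set q : 'rV[R]_m * 'rV[R]_n |
        [/\ cimg (chart_at x) q.1, cimg (chart_at y) q.2 &
            cdom (chart_at z) (f (cinv (chart_at x) q.1)
                                 (cinv (chart_at y) q.2))]]
      (fun q => cmap (chart_at z) (f (cinv (chart_at x) q.1)
                                     (cinv (chart_at y) q.2))).

Definition smooth_curve (R : realType) (m : nat) (M : manifoldType R m)
    (gamma : R -> M) : Prop :=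
  continuous gamma /\
  forall x, smooth_on (gamma @^-1` cdom (chart_at x))
                      (cmap (chart_at x) \o gamma : R^o -> 'rV[R]_m).

(* The tangent map T_x M -> T_(f x) N. *)
Definition tangent (R : realType) (m n : nat) (M : manifoldType R m)
    (N : manifoldType R n) (f : M -> N) (x : M) : 'rV[R]_m -> 'rV[R]_n :=
  'd (read (chart_at x) (chart_at (f x)) f) (cmap (chart_at x) x).

(* [to_coord c x] sends a vector of T_x M to its coordinates in the chart c,
   and [of_coord c x] goes back; both are meaningful when x is in [cdom c]. *)
Definition to_coord (R : realType) (m : nat) (M : manifoldType R m)
    (c : chart R m M) (x : M) : 'rV[R]_m -> 'rV[R]_m :=
  'd (read (chart_at x) c id) (cmap (chart_at x) x).

Definition of_coord (R : realType) (m : nat) (M : manifoldType R m)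
    (c : chart R m M) (x : M) : 'rV[R]_m -> 'rV[R]_m :=
  'd (read c (chart_at x) id) (cmap c x).

(* The bracket of two vector fields at x, [X, Y] = dY(X) - dX(Y) in local
   coordinates. *)
Definition vf_read (R : realType) (m : nat) (M : manifoldType R m)
    (c : chart R m M) (X : M -> 'rV[R]_m) : 'rV[R]_m -> 'rV[R]_m :=
  fun y => to_coord c (cinv c y) (X (cinv c y)).

Definition vf_bracket (R : realType) (m : nat) (M : manifoldType R m)
    (X Y : M -> 'rV[R]_m) (x : M) : 'rV[R]_m :=
  let c := chart_at x in
  'd (vf_read c Y) (cmap c x) (X x) - 'd (vf_read c X) (cmap c x) (Y x).

HB.mixin Record isLieGroup (R : realType) (d : nat) G
    of Manifold R d G & Group G := {
  smooth_mulg : smooth2 (fun x y : G => (x * y)%g) ;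
  smooth_invg : smooth (fun x : G => (x^-1)%g)
}.

#[short(type="lieGroupType")]
HB.structure Definition LieGroup (R : realType) (d : nat) :=
  {G of Manifold R d G & Group G & isLieGroup R d G}.

(* The Lie algebra of G is T_1 G = 'rV[R]_d with the bracket of left-invariant
   vector fields. *)
Definition left_field (R : realType) (d : nat) (G : lieGroupType R d)
    (u : 'rV[R]_d) : G -> 'rV[R]_d :=
  fun g => tangent (fun h : G => (g * h)%g) 1%g u.

Definition lie_bracket (R : realType) (d : nat) (G : lieGroupType R d)
    (u v : 'rV[R]_d) : 'rV[R]_d :=
  vf_bracket (@left_field R d G u) (@left_field R d G v) 1%g.

(* The Lie algebra of a closed subgroup H, as a subset of T_1 G: the initial
   velocities of the one-parameter subgroups contained in H. *)
Definition lie_subgroup (R : realType) (d : nat) (G : lieGroupType R d)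
    (H : set G) : set 'rV[R]_d :=
  [set u | exists gamma : R -> G,
    [/\ smooth_curve gamma,
        forall s t, gamma (s + t) = (gamma s * gamma t)%g,
        forall t, H (gamma t) &
        'd (cmap (chart_at (1%g : G)) \o gamma : R^o -> 'rV[R]_d) 0 1 = u]].

(* The same for a closed group of invertible matrices, inside 'M[R]_k with the
   commutator bracket. *)
Definition lie_mxgroup (R : realType) (k : nat) (H : set 'M[R]_k) :
    set 'M[R]_k :=
  [set A | exists gamma : R^o -> 'M[R]_k,
    [/\ smooth_on setT gamma,
        forall s t, gamma (s + t) = gamma s *m gamma t,
        forall t, H (gamma t) &
        'd gamma 0 1 = A]].

Definition commx (R : realType) (k : nat) (A B : 'M[R]_k) : 'M[R]_k :=
  A *m B - B *m A.

Definition lie_subalgebra (R : realType) (V : lmodType R) (b : V -> V -> V)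
    (A : set V) : Prop :=
  [/\ A 0,
      forall (a : R) u v, A u -> A v -> A (a *: u + v) &
      forall u v, A u -> A v -> A (b u v)].

(* Isomorphism of the Lie algebras (A, bV) and (B, bW), given as subalgebras of
   V and W; f matters on A only. *)
Definition lie_isomorphic (R : realType) (V W : lmodType R)
    (bV : V -> V -> V) (A : set V) (bW : W -> W -> W) (B : set W) : Prop :=
  [/\ lie_subalgebra bV A, lie_subalgebra bW B &
    exists f : V -> W,
      [/\ set_bij A B f,
          forall (a : R) u v, A u -> A v -> f (a *: u + v) = a *: f u + f v &
          forall u v, A u -> A v -> f (bV u v) = bW (f u) (f v)]].

Definition sig_mx (R : realType) (p q : nat) : 'M[R]_(p + q) :=
  block_mx (- 1%:M) 0 0 1%:M.

(* O(p, q), for the form with p entries -1 followed by q entries +1. *)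
Definition orth_group (R : realType) (p q : nat) : set 'M[R]_(p + q) :=
  [set A | A^T *m sig_mx R p q *m A = sig_mx R p q].

(* The Lie algebras o(p, q) and o(k), with the commutator as bracket. *)
Definition orth_alg (R : realType) (p q : nat) : set 'M[R]_(p + q) :=
  [set A | A^T *m sig_mx R p q + sig_mx R p q *m A = 0].

Definition skew_alg (R : realType) (k : nat) : set 'M[R]_k :=
  [set A | A^T + A = 0].

Arguments orth_group : clear implicits.
Arguments orth_alg : clear implicits.
Arguments skew_alg : clear implicits.

(* The Lie algebra o(k) |x R^k, on the pairs (A, u) with A in o(k). *)
Definition euc_alg (R : realType) (k : nat) : set ('M[R]_k * 'cV[R]_k) :=
  [set x | skew_alg R k x.1].

Arguments euc_alg : clear implicits.

Definition euc_bracket (R : realType) (k : nat) (x y : 'M[R]_k * 'cV[R]_k) :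
    'M[R]_k * 'cV[R]_k :=
  (commx x.1 y.1, x.1 *m y.2 - y.1 *m x.2).

Definition locally_isomorphic_mxgroup (R : realType) (d k : nat)
    (G : lieGroupType R d) (H : set 'M[R]_k) : Prop :=
  lie_isomorphic (@lie_bracket R d G) setT (@commx R k) (lie_mxgroup H).

Definition form (R : realType) (m : nat) (A : 'M[R]_m) (u v : 'rV[R]_m) : R :=
  (u *m A *m v^T) 0 0.

(* Signature (-, +, ..., +): the rows of P form a basis in which the matrix of
   the form is diagonal, with one entry -1 and the others 1. *)
Definition lorentz_form (R : realType) (m : nat) (A : 'M[R]_m) : Prop :=
  [/\ (0 < m)%N, A^T = A &
    exists2 P : 'M[R]_m, P \in unitmx &
      P *m A *m P^T =
      diag_mx (\row_(i < m) if (i : nat) == 0%N then -1 else 1)].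

(* [g x] is the Gram matrix of the metric on T_x M. *)
Definition lorentz_metric (R : realType) (m : nat) (M : manifoldType R m)
    (g : M -> 'M[R]_m) : Prop :=
  (forall x, lorentz_form (g x)) /\
  (forall (z : M) (u v : 'rV[R]_m), let c := chart_at z in
    smooth_on (cimg c)
      (fun y => form (g (cinv c y)) (of_coord c (cinv c y) u)
                                    (of_coord c (cinv c y) v) : R^o)).

Definition preserves_metric (R : realType) (m : nat) (M : manifoldType R m)
    (g : M -> 'M[R]_m) (f : M -> M) : Prop :=
  forall x u v, form (g (f x)) (tangent f x u) (tangent f x v) = form (g x) u v.

Definition smooth_action (R : realType) (d m : nat) (G : lieGroupType R d)
    (M : manifoldType R m) (act : G -> M -> M) : Prop :=
  [/\ smooth2 act,
      forall x, act 1%g x = x &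
      forall a b x, act (a * b)%g x = act a (act b x)].

Definition stabilizer (G M : Type) (act : G -> M -> M) (x : M) : set G :=
  [set a | act a x = x].

(* Main.v *)
(* Pulling the metric back by the orbit map of the point x gives a quadratic form q on the
   Lie algebra of G whose radical contains h, the Lie algebra of the stabilizer H; q is
   Ad(H)-invariant, and since the metric is Lorentz every plane which is totally isotropic
   for q meets h.

   If H is not compact, the Cartan decomposition G = exp(k) exp(p) yields elements
   e_i exp(r_i X_i) of H with r_i -> oo and X_i -> X, where X is a unit boost with null
   eigenvectors l and l'; here exp(k) is compact because n >= 3 makes exp(4 pi E) trivial for
   every generator E of the rotations of a plane.  The vectors l ^ w with w orthogonal to l
   and l' are contracted, hence span an isotropic space which is orthogonal to X = l' ^ l.
   So h contains a hyperplane of them, and computing in o(1,n) shows that h is either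
   everything, or the stabilizer of a spacelike vector, or the stabilizer of l.

   The decomposition G = exp(k) exp(p) and the structure of one-parameter subgroups are
   obtained without differential equations: expG u is an ultrafilter limit of the powers
   g_i^floor(t/eps_i) of points g_i converging to 1 in the direction u, and a closed subset
   that can be moved in all directions at each of its points is everything. *)
From HB Require Import structures.
Require Import Defs.
From mathcomp Require Import all_boot all_order all_algebra.
From mathcomp Require Import all_classical all_reals all_analysis.
From mathcomp Require Import ring lra.
Import numFieldNormedType.Exports.
Import Order.TTheory GRing.Theory Num.Theory.
Set Implicit Arguments.
Unset Strict Implicit.
Unset Printing Implicit Defensive.
Local Open Scope classical_set_scope.
Local Open Scope ring_scope.

(** * Calculus in normed spaces *)

(** [G] is known only through its Lie algebra, so its elements are not matrices and estimates on
    them are made on [Ad], which is computed by matrices. This bounds the factor in exp(p). But [Ad]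
    does not see the centre, and the factor in exp(k) is bounded by choosing short logarithms.

    That exp(k) exp(p) can be moved in all directions is not obvious: exp on k may have critical
    points, so varying u in exp(u) exp(X) can miss directions. A linear form killing all available
    velocities is shown to vanish: conjugating exp(u) makes the vector that represents it on k
    invariant under Ad(exp u), and along an invariant direction exp(u) has a commuting logarithm,
    which can be varied.

    The classification never counts dimensions: each new element of h comes from an isotropic plane
    for q, isotropic by contraction, by a common weight under a boost, or by a bracket with an
    element of h. The three cases are: h contains all l ^ w and the boost l' ^ l, or only a
    hyperplane of the l ^ w, or all of them without the boost. *)

Section LocalCalculus.
Context {R : realType}.
Implicit Types U V W : normedModType R.

Lemma is_diff_near V W (f g : V -> W) (x : V) (df : V -> W) :
  (\forall y \near x, f y = g y) -> is_diff x f df -> is_diff x g df.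
Proof.
move=> fg [df1 df2].
have [fc fE] := (diff_locallyP x f).1 df1.
have gE : g \o shift x = cst (g x) + 'd f x +o_ (0 : V) id.
  have gfx : g x = f x by rewrite (nbhs_singleton fg).
  apply/eqaddoP => e e0; move/eqaddoP : fE => /(_ e e0).
  have : \forall y \near (0 : V), f (y + x) = g (y + x).
    have sc : shift x y @[y --> (0 : V)] --> x.
      rewrite /shift /= -[X in _ --> X]add0r; apply: cvgD; [exact: cvg_id|exact: cvg_cst].
    exact: (sc _ fg).
  apply: filterS2 => y /= E.
  by rewrite /cst /shift !fctE /= -E gfx.
have E := diff_unique fc gE.
split; last by rewrite E.
by apply/diff_locallyP; rewrite E.
Qed.

Lemma is_diff_compose U V W (f df : U -> V) (g dg : V -> W) (x : U) :
  is_diff x f df -> is_diff (f x) g dg ->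
  is_diff x (fun y => g (f y)) (fun y => dg (df y)).
Proof. by move=> h1 h2; exact: (is_diff_comp (f := f) (g := g)). Qed.

Lemma is_diff_ext V W (f df dg : V -> W) (x : V) :
  df =1 dg -> is_diff x f df -> is_diff x f dg.
Proof. by move=> /funext ->. Qed.

Lemma is_diff_const V W (a : W) (x : V) : is_diff x (fun _ => a) (fun _ => 0).
Proof. by have := is_diff_cst a x. Qed.

Lemma is_diff_ident V (x : V) : is_diff x (fun y => y) (fun y => y).
Proof. by have := is_diff_id x. Qed.

Lemma is_diff_curve V W (f df : V -> W) (c : R -> V) (dc : V) (t : R) :
  is_derive t (1 : R) c dc -> is_diff (c t) f df ->
  is_derive t (1 : R) (fun s => f (c s)) (df dc).
Proof.
move=> [c1 c2] [f1 f2].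
have dct : differentiable (c : R^o -> V) t by apply/derivable1_diffP.
have dfc : differentiable ((f \o c) : R^o -> W) t by exact: differentiable_comp.
split; first exact/derivable1_diffP.
by rewrite (deriveE _ dfc) (diff_comp dct f1) /= -(deriveE _ dct) c2 f2.
Qed.

Lemma is_derive_diffE V (c : R^o -> V) (t : R) (dc : V) :
  is_derive t (1 : R) c dc <-> differentiable c t /\ 'd c t 1 = dc.
Proof.
split=> [[c1 c2]|[c1 c2]].
  have dct : differentiable (c : R^o -> V) t by apply/derivable1_diffP.
  by split=> //; rewrite -(deriveE _ dct).
by split; [apply/derivable1_diffP|rewrite (deriveE _ c1)].
Qed.

Lemma is_derive_line V (x v : V) (t : R) :
  is_derive t (1 : R) (fun s => x + s *: v) v.
Proof.
have h : is_diff (t : R^o) (fun s : R^o => x + s *: v) (fun s : R^o => 0 + s *: v).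
  by apply: is_diffD.
by case: h => h1 h2; apply/is_derive_diffE; rewrite h2 add0r scale1r.
Qed.

Lemma MVT_line V (f : V -> R) (df : V -> V -> R) (x v : V) :
  (forall t : R, 0 <= t <= 1 -> is_diff (x + t *: v) f (df (x + t *: v))) ->
  exists2 t, 0 < t < 1 & f (x + v) - f x = df (x + t *: v) v.
Proof.
move=> h.
have D (t : R) : 0 <= t <= 1 ->
    is_derive t (1 : R) (fun s => f (x + s *: v)) (df (x + t *: v) v).
  move=> t01; exact: (is_diff_curve (is_derive_line x v t) (h t t01)).
have [||t] := @MVT R (fun s => f (x + s *: v)) (fun t => df (x + t *: v) v) 0 1
  ltr01.
- by move=> t; rewrite in_itv /= => /andP[t0 t1]; apply: D; rewrite !ltW.
- apply: derivable_within_continuous => t; rewrite in_itv /= => t01.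
  by case: (D t t01).
rewrite in_itv /= => t01; rewrite scale1r scale0r addr0 subr0 mulr1 => E.
by exists t.
Qed.

Lemma is_diff_rV_coord V n (f df : V -> 'rV[R]_n) (x : V) (i : 'I_n) :
  is_diff x f df -> is_diff x (fun y => f y 0 i) (fun y => df y 0 i).
Proof.
move=> h; apply: (is_diff_compose h (g := fun v : 'rV[R]_n => v 0 i)
  (dg := fun v : 'rV[R]_n => v 0 i)).
have cl : linear (fun v : 'rV[R]_n => v 0 i : R^o).
  by move=> a u w; rewrite !mxE.
pose dlM := GRing.isLinear.Build _ _ _ _ _ cl.
pose dL : {linear 'rV[R]_n -> R^o} := HB.pack (fun v : 'rV[R]_n => v 0 i : R^o) dlM.
split; first exact: differentiable_coord.
have := @diff_lin R _ _ dL (f x); apply.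
exact: coord_continuous.
Qed.

Lemma rV_norm_le n (v : 'rV[R]_n) (e : R) :
  0 <= e -> (forall i, `|v 0 i| <= e) -> `|v| <= e.
Proof.
move=> e0 h; rewrite [leLHS]/Num.Def.normr /= mx_normrE; apply: bigmax_le => //= -[i j] _.
by rewrite /= ord1.
Qed.

Lemma rV_coord_norm n (v : 'rV[R]_n) i : `|v 0 i| <= `|v|.
Proof.
by rewrite [leRHS]/Num.Def.normr /= mx_normrE; apply: (le_bigmax _ _ (0, i)).
Qed.

(** The norm on rows is the maximum of the coordinates, so the mean value theorem applies to each
    coordinate separately, with its own intermediate point, and no constant is lost. *)
Lemma mean_value_rV V n (f : V -> 'rV[R]_n) (x v : V) (C : R) : 0 <= C ->
  (forall t : R, 0 <= t <= 1 -> differentiable f (x + t *: v)) ->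
  (forall t : R, 0 <= t <= 1 -> `|'d f (x + t *: v) v| <= C) ->
  `|f (x + v) - f x| <= C.
Proof.
move=> C0 df dfC; apply: rV_norm_le => // i.
have [|t /andP[t0 t1] E] := @MVT_line V (fun y => f y 0 i)
    (fun y w => 'd f y w 0 i) x v.
  by move=> t t01; apply: is_diff_rV_coord; split=> //; exact: df.
rewrite !mxE E; apply: le_trans (rV_coord_norm _ _) _; apply: dfC.
by rewrite !ltW.
Qed.

Lemma is_diff_sum V W n (f df : 'I_n -> V -> W) (x : V) :
  (forall i, is_diff x (f i) (df i)) ->
  is_diff x (fun y => \sum_(i < n) f i y) (fun y => \sum_(i < n) df i y).
Proof.
elim: n f df => [|n IH] f df h.
  rewrite (_ : (fun y => _) = cst 0); last by apply/funext => y; rewrite big_ord0.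
  rewrite (_ : (fun y => \sum_(i < 0) df i y) = 0).
    exact: is_diff_cst.
  by apply/funext => y; rewrite big_ord0.
rewrite (_ : (fun y => _) =
  (fun y => \sum_(i < n) f (widen_ord (leqnSn n) i) y) + f ord_max).
  rewrite (_ : (fun y => \sum_(i < n.+1) df i y) =
    (fun y => \sum_(i < n) df (widen_ord (leqnSn n) i) y) + df ord_max).
    have h1 := IH _ _ (fun i => h (widen_ord (leqnSn n) i)); have h2 := h ord_max.
    exact: is_diffD h1 h2.
  by apply/funext => y; rewrite big_ord_recr.
by apply/funext => y; rewrite big_ord_recr.
Qed.

Lemma is_diff_scale V W (k dk : V -> R) (f df : V -> W) (x : V) :
  is_diff x (k : V -> R^o) dk -> is_diff x f df ->
  is_diff x (fun y => k y *: f y) (fun v => dk v *: f x + k x *: df v).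
Proof.
move=> hk hf.
have bl : bilinear_for ( *:%R) ( *:%R) (fun (a : R^o) (w : W) => a *: w).
  split=> [w|a] b u v /=.
    by rewrite scalerDl scalerA.
  by rewrite scalerDr !scalerA mulrC.
pose bM := bilinear_isBilinear.Build R R^o W W _ _ _ bl.
pose bL : {bilinear R^o -> W -> W} := HB.pack (fun (a : R^o) (w : W) => a *: w) bM.
have cb : continuous (fun p : R^o * W => bL p.1 p.2).
  exact: scale_continuous.
have hb : is_diff ((k x, f x) : R^o * W) (fun p => bL p.1 p.2)
    (fun q => bL (k x) q.2 + bL q.1 (f x)).
  by split; [exact: differentiable_bilin|rewrite diff_bilin].
have hp := is_diff_compose (is_diff_pair (U := V) (V' := R^o) hk hf) hb.
by apply: is_diff_ext hp => v /=; rewrite addrC.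
Qed.

Lemma row_deltaE n (v : 'rV[R]_n) : v = \sum_(j < n) v 0 j *: delta_mx 0 j.
Proof. exact: row_sum_delta. Qed.

Lemma cvg_big_sum (T I : Type) (F : set_system T) {FF : Filter F} W (r : seq I)
    (f : I -> T -> W) (a : I -> W) :
  (forall i, f i x @[x --> F] --> a i) ->
  \sum_(i <- r) f i x @[x --> F] --> \sum_(i <- r) a i.
Proof.
move=> h; elim: r => [|i r IH].
  by rewrite big_nil; under eq_cvg do rewrite big_nil; exact: cvg_cst.
by rewrite big_cons; under eq_cvg do rewrite big_cons; exact: cvgD.
Qed.

Lemma linear_rV_continuous n W (f : {linear 'rV[R]_n -> W}) : continuous f.
Proof.
have -> : (f : _ -> _) = fun v => \sum_(j < n) v 0 j *: f (delta_mx 0 j).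
  by apply/funext => v; rewrite {1}(row_deltaE v) linear_sum; under eq_bigr do rewrite linearZ.
move=> v; apply: (@cvg_big_sum _ _ (nbhs v) (nbhs_filter v)) => j.
by apply: (@cvgZr_tmp _ _ _ (nbhs v) (nbhs_filter v)); exact: coord_continuous.
Qed.

Lemma is_diff_linear_rV n W (f : 'rV[R]_n -> W) (x : 'rV[R]_n) :
  linear f -> is_diff x f f.
Proof.
move=> lf.
pose dlM := GRing.isLinear.Build _ _ _ _ _ lf.
pose dL : {linear 'rV[R]_n -> W} := HB.pack f dlM.
have c := @linear_rV_continuous n W dL.
by split; [exact: (linear_differentiable (f := dL))|exact: (diff_lin (f := dL))].
Qed.

Lemma is_diff_linear V W (f : {linear V -> W}) (x : V) :
  continuous f -> is_diff x f f.
Proof.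
by move=> c; split; [exact: linear_differentiable|exact: diff_lin].
Qed.

End LocalCalculus.

(** * C^k maps, strict differentiability and symmetry of second derivatives *)

Section CkCalculus.
Context {R : realType}.
Implicit Types U V W : normedModType R.

Lemma is_diffE V W (f df : V -> W) (x : V) :
  is_diff x f df -> differentiable f x /\ 'd f x = df :> (V -> W).
Proof. by case. Qed.

Lemma is_diff_self V W (f : V -> W) (x : V) :
  differentiable f x -> is_diff x f ('d f x).
Proof. by []. Qed.

(** Openness of [D] turns equality on [D] into equality near each point, on which the derivatives
    depend. *)
Lemma Ck_eq V W k (D : set V) (f g : V -> W) :
  open D -> (forall x, D x -> f x = g x) -> Ck k D f -> Ck k D g.
Proof.
move=> oD; elim: k f g => [|k IH] f g fg /=.
  move=> fc x Dx; have fgx : \forall y \near x, f y = g y.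
    by apply: filterS fg _; exact: open_nbhs_nbhs.
  have h : f y @[y --> x] --> f x := fc x Dx.
  by rewrite (fg _ Dx) in h; apply: cvg_trans h; exact: near_eq_cvg.
move=> [fd fk].
have E x : D x -> is_diff x g ('d f x).
  move=> Dx; apply: (is_diff_near (f := f)); last exact/is_diff_self/fd.
  by apply: filterS fg _; exact: open_nbhs_nbhs.
split=> [x Dx|v]; first by case: (E x Dx).
apply: (IH (fun x => 'd f x v)) (fk v) => x Dx.
by case/is_diffE: (E x Dx) => _ ->.
Qed.

Lemma Ck_continuous V W k (D : set V) (f : V -> W) :
  Ck k D f -> forall x, D x -> {for x, continuous f}.
Proof.
case: k => [//|k] /= [fd _] x Dx; exact/differentiable_continuous/fd.
Qed.

Lemma Ck_pred V W k (D : set V) (f : V -> W) : Ck k.+1 D f -> Ck k D f.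
Proof.
elim: k f => [|k IH] f h; first exact: Ck_continuous h.
by case: h => h1 h2; split=> // v; apply: IH.
Qed.

Lemma Ck_cst V W k (D : set V) (a : W) : open D -> Ck k D (fun _ => a).
Proof.
move=> oD; elim: k a => [|k IH] a /=; first by move=> x _; exact: cst_continuous.
split=> [x _|v]; first exact: differentiable_cst.
apply: Ck_eq oD _ (IH 0) => x _.
by rewrite (diff_cst a x).
Qed.

Lemma Ck_add V W k (D : set V) (f g : V -> W) :
  open D -> Ck k D f -> Ck k D g -> Ck k D (fun x => f x + g x).
Proof.
move=> oD; elim: k f g => [|k IH] f g /=.
  by move=> fc gc x Dx; apply: cvgD; [exact: fc|exact: gc].
move=> [fd fk] [gd gk]; split=> [x Dx|v].
  by apply: differentiableD; [exact: fd|exact: gd].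
apply: Ck_eq oD _ (IH _ _ (fk v) (gk v)) => x Dx.
have : is_diff x (fun x => f x + g x) (fun v => 'd f x v + 'd g x v).
  exact: (is_diffD (is_diff_self (fd x Dx)) (is_diff_self (gd x Dx))).
by case/is_diffE => _ ->.
Qed.

Lemma Ck_sum V W k (D : set V) n (f : 'I_n -> V -> W) :
  open D -> (forall i, Ck k D (f i)) -> Ck k D (fun x => \sum_(i < n) f i x).
Proof.
move=> oD; elim: n f => [|n IH] f h.
  by apply: Ck_eq oD _ (Ck_cst k 0 oD) => x _; rewrite big_ord0.
have := Ck_add oD (IH _ (fun i => h (widen_ord (leqnSn n) i))) (h ord_max).
by apply: Ck_eq oD _ => x _; rewrite big_ord_recr.
Qed.

Lemma Ck_scale V W k (D : set V) (a : V -> R^o) (f : V -> W) :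
  open D -> Ck k D a -> Ck k D f -> Ck k D (fun x => a x *: f x).
Proof.
move=> oD; elim: k a f => [|k IH] a f.
  by move=> ac fc x Dx; apply: (cvgZ (ac x Dx) (fc x Dx)).
move=> ha hf; have [ad ak] := ha; have [fd fk] := hf.
have E x : D x -> is_diff x (fun x => a x *: f x)
    (fun v => 'd a x v *: f x + a x *: 'd f x v).
  by move=> Dx; apply: is_diff_scale; apply: is_diff_self; [exact: ad|exact: fd].
split=> [x Dx|v]; first by case: (E x Dx).
have h := Ck_add oD (IH _ _ (ak v) (Ck_pred hf)) (IH _ _ (Ck_pred ha) (fk v)).
by apply: Ck_eq oD _ h => x Dx; case/is_diffE: (E x Dx) => _ ->.
Qed.

Lemma Ck_coord V n k (D : set V) (f : V -> 'rV[R]_n) i :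
  open D -> Ck k D f -> Ck k D (fun x => f x 0 i : R^o).
Proof.
move=> oD; elim: k f => [|k IH] f /=.
  move=> fc x Dx; apply: (continuous_comp (g := fun v : 'rV[R]_n => v 0 i)).
    exact: fc.
  exact: coord_continuous.
move=> [fd fk].
have E x : D x -> is_diff x (fun x => f x 0 i : R^o) (fun v => 'd f x v 0 i).
  by move=> Dx; apply: is_diff_rV_coord; apply: is_diff_self; exact: fd.
split=> [x Dx|v]; first by case: (E x Dx).
by apply: Ck_eq oD _ (IH _ (fk v)) => x Dx; case/is_diffE: (E x Dx) => _ ->.
Qed.

Lemma smooth_on_diff V W (D : set V) (f : V -> W) (x : V) :
  smooth_on D f -> D x -> differentiable f x.
Proof. by move=> /(_ 1%N) [h _]; exact: h. Qed.

Lemma smooth_on_dir V W (D : set V) (f : V -> W) (v : V) :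
  smooth_on D f -> smooth_on D (fun x => 'd f x v).
Proof. by move=> h k; have [_ hk] := h k.+1; exact: hk. Qed.

Lemma linear_pair_sum m n W (f : {linear ('rV[R]_m * 'rV[R]_n)%type -> W}) v :
  f (v, 0) = \sum_(j < m) v 0 j *: f (delta_mx 0 j, 0).
Proof.
pose g (w : 'rV[R]_m) := f (w, 0).
have lg : linear g.
  move=> a x y; rewrite /g -linearP; congr (f _).
  by apply: injective_projections; rewrite /= ?scaler0 ?addr0.
pose dlM := GRing.isLinear.Build _ _ _ _ _ lg.
pose dL : {linear 'rV[R]_m -> W} := HB.pack g dlM.
rewrite -[LHS]/(dL v) {1}(row_deltaE v) linear_sum.
by under eq_bigr do rewrite linearZ.
Qed.

Lemma linear_pair_sumr m n W (f : {linear ('rV[R]_m * 'rV[R]_n)%type -> W}) v :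
  f (0, v) = \sum_(j < n) v 0 j *: f (0, delta_mx 0 j).
Proof.
pose g (w : 'rV[R]_n) := f (0, w).
have lg : linear g.
  move=> a x y; rewrite /g -linearP; congr (f _).
  by apply: injective_projections; rewrite /= ?scaler0 ?addr0.
pose dlM := GRing.isLinear.Build _ _ _ _ _ lg.
pose dL : {linear 'rV[R]_n -> W} := HB.pack g dlM.
rewrite -[LHS]/(dL v) {1}(row_deltaE v) linear_sum.
by under eq_bigr do rewrite linearZ.
Qed.

(** The chain rule expresses the derivative through partial derivatives of [g], which are smooth
    again, and through ['d c]. This raises the regularity of a curve that solves a differential
    equation with smooth right-hand side. *)
Lemma Ck_comp_curve m n W k (D : set ('rV[R]_m * 'rV[R]_n))
    (g : 'rV[R]_m * 'rV[R]_n -> W) (T : set R^o) (c : R^o -> 'rV[R]_m) p :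
  open T -> smooth_on D g -> Ck k T c -> (forall t, T t -> D (c t, p)) ->
  Ck k T (fun t => g (c t, p)).
Proof.
move=> oT; elim: k g => [|k IH] g sg ck TD.
  move=> t Tt; apply: (continuous_comp (f := fun t => (c t, p)) (g := g)).
    have h : c s @[s --> t] --> c t := ck t Tt.
    have h' : p @[_ --> t] --> p by exact: cvg_cst.
    exact: (cvg_pair h h').
  exact/differentiable_continuous/(smooth_on_diff sg)/TD.
have [cd cdk] := ck.
have E t : T t -> is_diff t (fun t => g (c t, p))
    (fun v => \sum_(j < m) 'd c t v 0 j *: 'd g (c t, p) (delta_mx 0 j, 0)).
  move=> Tt; have h1 : is_diff t (fun t => (c t, p)) (fun v => ('d c t v, 0)).
    exact: is_diff_pair (is_diff_self (cd t Tt)) (is_diff_const p (t : R^o)).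
  have h2 := is_diff_self (smooth_on_diff sg (TD t Tt)).
  apply: is_diff_ext (is_diff_compose h1 h2) => v.
  exact: linear_pair_sum.
split=> [t Tt|v]; first by case: (E t Tt).
have : Ck k T (fun t => \sum_(j < m) 'd c t v 0 j *: 'd g (c t, p) (delta_mx 0 j, 0)).
  apply: Ck_sum => // j; apply: Ck_scale => //.
    exact: Ck_coord (cdk v).
  by apply: (IH (fun q => 'd g q (delta_mx 0 j, 0))) => //; [exact: smooth_on_dir|exact: Ck_pred].
by apply: Ck_eq oT _ => t Tt; case/is_diffE: (E t Tt) => _ ->.
Qed.

Lemma norm_pair_lt V W (x : V * W) e : `|x| < e = (`|x.1| < e) && (`|x.2| < e).
Proof. by rewrite prod_normE gt_max. Qed.

(** The error is proportional to [|y - y0|] alone although [x] moves too: the mean value theorem is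
    used in the second variable only, on [f] minus its linear part at the base point, whose
    derivative is small by continuity of the partial derivatives. *)
Lemma strict_partial_diff m n p (D : set ('rV[R]_m * 'rV[R]_n))
    (f : 'rV[R]_m * 'rV[R]_n -> 'rV[R]_p) (x0 : 'rV[R]_m) (y0 : 'rV[R]_n) :
  smooth_on D f -> nbhs (x0, y0) D -> forall e : R, 0 < e ->
  exists2 r : R, 0 < r & forall x y, `|x - x0| < r -> `|y - y0| < r -> D (x, y) /\
    `|f (x, y) - f (x, y0) - 'd f (x0, y0) (0, y - y0)| <= e * `|y - y0|.
Proof.
move=> sf D0 e e0.
(* Each of the [n] coordinate directions contributes at most [e' * |y - y0|]; the denominator [n.+1]
   also covers [n = 0]. *)
pose e' := e / n.+1%:R.
have e'0 : 0 < e' by rewrite divr_gt0 // ltr0n.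
have D00 : D (x0, y0) by exact: nbhs_singleton D0.
have nb : \forall q \near (x0, y0), D q /\ forall j : 'I_n,
    `|'d f q (0, delta_mx 0 j) - 'd f (x0, y0) (0, delta_mx 0 j)| <= e'.
  apply: filterI => //.
  have H := @filter_forall ('rV[R]_m * 'rV[R]_n)%type 'I_n (fun j q =>
    `|'d f q (0, delta_mx 0 j) - 'd f (x0, y0) (0, delta_mx 0 j)| <= e') (nbhs (x0, y0)) _.
  apply: H => j.
  have cj := Ck_continuous (smooth_on_dir (0, delta_mx 0 j) sf 0) D00.
  have h := (cvgrPdist_le _ _).1 cj _ e'0.
  by near=> q; rewrite distrC; near: q; exact: h.
have [r /= r0 rb] := (nbhs_ballP _ _).1 nb.
exists r => // x y xr yr.
have qr (z : 'rV[R]_n) : `|z - y0| < r -> D (x, z) /\ forall j : 'I_n,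
    `|'d f (x, z) (0, delta_mx 0 j) - 'd f (x0, y0) (0, delta_mx 0 j)| <= e'.
  move=> zr; apply: rb; rewrite -ball_normE /=.
  by rewrite distrC norm_pair_lt /= xr zr.
split; first exact: (qr y yr).1.
have tr t : 0 <= t <= 1 -> `|(y0 + t *: (y - y0)) - y0| < r.
  move=> /andP[t0 t1]; rewrite addrAC subrr add0r normrZ ger0_norm //.
  by apply: le_lt_trans yr; rewrite ler_piMl.
pose h z := f (x, z) - 'd f (x0, y0) (0, z).
have dh z : D (x, z) -> is_diff z h
   (fun v => 'd f (x, z) (0, v) - 'd f (x0, y0) (0, v)).
  move=> Dz; have h1 : is_diff z (fun z => (x, z)) (fun v => (0, v)).
    exact: is_diff_pair (is_diff_const _ _) (is_diff_ident _).
  have h2 := is_diff_compose h1 (is_diff_self (smooth_on_diff sf Dz)).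
  have h3 : is_diff z (fun z => 'd f (x0, y0) (0, z)) (fun v => 'd f (x0, y0) (0, v)).
    apply: is_diff_linear_rV => a u v; rewrite -linearP; congr ('d f _ _).
    by apply: injective_projections; rewrite /= ?scaler0 ?addr0.
  exact: is_diffB h2 h3.
have := @mean_value_rV R _ p h y0 (y - y0) (e * `|y - y0|).
rewrite (addrC y0) subrK => H.
have -> : f (x, y) - f (x, y0) - 'd f (x0, y0) (0, y - y0) = h y - h y0.
  rewrite /h (_ : (0, y - y0) = (0, y) - (0, y0)); last first.
    by apply: injective_projections; rewrite /= ?subr0.
  by rewrite linearB /= !opprB addrACA [RHS]addrACA [X in _ + X]addrC.
apply: H => [|t t01|t t01]; first by rewrite mulr_ge0 // ltW.
- by case: (dh _ (qr _ (tr t t01)).1).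
have [Dz hz] := qr _ (tr t t01).
case/is_diffE: (dh _ Dz) => _ ->.
set z := y0 + _ in hz *; set v := y - y0.
have -> : 'd f (x, z) (0, v) - 'd f (x0, y0) (0, v) =
   \sum_(j < n) v 0 j *: ('d f (x, z) (0, delta_mx 0 j) - 'd f (x0, y0) (0, delta_mx 0 j)).
  have E1 := linear_pair_sumr ('d f (x, z)) v.
  have E2 := linear_pair_sumr ('d f (x0, y0)) v.
  apply: etrans (congr2 (fun a b => a - b) E1 E2) _.
  apply: etrans (esym (sumrB _ _ _ _)) _.
  by apply: eq_bigr => j _; apply: esym; exact: scalerBr.
apply: (@le_trans _ _ (\sum_(j < n) `|v| * e')).
  apply: le_trans (ler_norm_sum _ _ _) _; apply: ler_sum => j _.
  rewrite normrZ; apply: ler_pM => //.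
  exact: rV_coord_norm.
rewrite sumr_const card_ord -mulrnAr mulrC ler_wpM2r // /e' -mulr_natr.
by rewrite mulrAC ler_pdivrMr ?ltr0n // ler_wpM2l ?ltW // ltr_nat.
Unshelve. all: by end_near. Qed.

Definition second_difference V (f : V -> R) (x a b : V) (s : R) : R :=
  f (x + s *: a + s *: b) - f (x + s *: a) - (f (x + s *: b) - f x).

(** The mean value theorem along [a], applied to [f (y + s *: b) - f y], turns the second difference
    into an increment of the derivative in the direction [a]; differentiability of the latter at the
    single point [x] then suffices. *)
Lemma second_difference_estimate V (f : V -> R) (x a b : V) (Da : V -> R) :
  (\forall y \near x, differentiable (f : V -> R^o) y) ->
  is_diff x (fun y => 'd (f : V -> R^o) y a : R^o) Da ->
  forall e : R, 0 < e -> \forall s \near 0^'+,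
    `|second_difference f x a b s - s ^+ 2 * Da b| <= s ^+ 2 * e.
Proof.
move=> fd dF e e0.
pose F y : R^o := 'd (f : V -> R^o) y a.
have [F1 F2] := is_diffE dF.
have [Fc FE] := (diff_locallyP x F).1 F1.
(* [s * N] exceeds s (2|a| + |b|), which bounds the sum of the two displacements from [x] at which
   [F] is evaluated; the 1 keeps [N] positive. *)
pose N := 2 * `|a| + `|b| + 1.
have N0 : 0 < N by rewrite /N; have := normr_ge0 a; have := normr_ge0 b; lra.
have e1 : 0 < e / N by rewrite divr_gt0.
have /nbhs_ballP [r /= r0 rb] : \forall y \near (0 : V),
    `|F (y + x) - (F x + Da y)| <= e / N * `|y|.
  move/eqaddoP : FE => /(_ _ e1); apply: filterS => y.
  by rewrite /= !fctE /shift /cst /= F2.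
have [r' /= r'0 rb'] := (nbhs_ballP _ _).1 fd.
have hb (y : V) : `|y| < r -> `|F (x + y) - (F x + Da y)| <= e / N * `|y|.
  by move=> yr; rewrite [x + y]addrC; apply: rb; rewrite -ball_normE /= sub0r normrN.
have hb' (y : V) : `|y| < r' -> differentiable (f : V -> R^o) (x + y).
  by move=> yr; apply: rb'; rewrite -ball_normE /= opprD addNKr normrN.
have Dl : Da = 'd F x by rewrite F2.
near=> s.
have s0 : 0 < s by near: s; exact: nbhs_right_gt.
have sr : s * N < r.
  by rewrite -ltr_pdivlMr //; near: s; apply: nbhs_right_lt; rewrite divr_gt0.
have sr' : s * N < r'.
  by rewrite -ltr_pdivlMr //; near: s; apply: nbhs_right_lt; rewrite divr_gt0.
have nrm t u : 0 <= t <= 1 -> 0 <= u <= 1 ->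
    `|t *: (s *: a) + u *: (s *: b)| <= s * (`|a| + `|b|).
  move=> /andP[t0 t1] /andP[u0 u1].
  apply: le_trans (ler_normD _ _) _; rewrite !normrZ !ger0_norm ?(ltW s0) //.
  rewrite mulrDr lerD //; [have h := mulr_ge0 (ltW s0) (normr_ge0 a)|have h := mulr_ge0 (ltW s0) (normr_ge0 b)];
    by rewrite ler_piMl.
have ltN : s * (`|a| + `|b|) < s * N.
  by rewrite ltr_pM2l // /N; have := normr_ge0 a; lra.
pose g y := f (y + s *: b) - f y.
have [t /andP[t0 t1]|t /andP[t0 t1] E] := @MVT_line R V g
   (fun y v => 'd (f : V -> R^o) (y + s *: b) v - 'd (f : V -> R^o) y v) x (s *: a).
  have h1 : differentiable (f : V -> R^o) (x + t *: (s *: a) + s *: b).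
    rewrite -addrA; apply: hb'; rewrite -[s *: b]scale1r.
    by apply: le_lt_trans (nrm _ _ _ _) (lt_trans ltN sr'); rewrite ?t0 ?t1 ?ler01 ?lexx.
  have h2 : differentiable (f : V -> R^o) (x + t *: (s *: a)).
    apply: hb'; rewrite -[t *: _]addr0 -[X in _ + X](scale0r (s *: b)).
    by apply: le_lt_trans (nrm _ _ _ _) (lt_trans ltN sr'); rewrite ?t0 ?t1 ?ler01 ?lexx.
  apply: (is_diffB (f := fun y => f (y + s *: b) : R^o) (g := f : V -> R^o)); last exact: is_diff_self.
  apply: (is_diff_compose (f := fun y => y + s *: b) (df := fun v => v)); last exact: is_diff_self.
  have hid : is_diff (x + t *: (s *: a)) (fun y : V => y + s *: b) (fun v => v + 0).
    by apply: is_diffD.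
  by apply: is_diff_ext hid => v; rewrite addr0.
have -> : second_difference f x a b s =
   s * (F (x + (t *: (s *: a) + s *: b)) - F (x + t *: (s *: a))).
  have -> : second_difference f x a b s = g (x + s *: a) - g x by rewrite /g.
  have Z (L : {linear V -> R^o}) : L (s *: a) = s * L a by rewrite linearZ.
  by rewrite E !Z -mulrBr -addrA.
have k1 : `|t *: (s *: a) + s *: b| <= s * (`|a| + `|b|).
  by have := nrm t 1; rewrite scale1r; apply; rewrite ?ler01 ?lexx // !ltW.
have k2 : `|t *: (s *: a)| <= s * `|a|.
  rewrite !normrZ !gtr0_norm //; have h := mulr_ge0 (ltW s0) (normr_ge0 a).
  by rewrite ler_piMl // ltW.
have /hb h1 := le_lt_trans k1 (lt_trans ltN sr).
have /hb h2 : `|t *: (s *: a)| < r.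
  apply: le_lt_trans k2 (lt_trans _ sr); rewrite ltr_pM2l // /N.
  by have := normr_ge0 a; have := normr_ge0 b; lra.
have Dab : Da (t *: (s *: a) + s *: b) = Da (t *: (s *: a)) + s * Da b.
  by rewrite Dl linearD; congr (_ + _); rewrite linearZ.
rewrite Dab in h1.
set A := F _ in h1 *; set B := F (x + _) in h2 *.
have -> : s * (A - B) - s ^+ 2 * Da b =
  s * ((A - (F x + (Da (t *: (s *: a)) + s * Da b))) - (B - (F x + Da (t *: (s *: a))))).
  by ring.
rewrite normrM gtr0_norm // expr2 -mulrA ler_pM2l //.
apply: le_trans (ler_normB _ _) _; apply: le_trans (lerD h1 h2) _.
have eN : 0 <= e / N by exact: ltW.
apply: le_trans (lerD (ler_wpM2l eN k1) (ler_wpM2l eN k2)) _.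
have -> : s * e = e / N * (s * N) by field; rewrite gt_eqF.
rewrite -mulrDr ler_wpM2l // -mulrDr ler_pM2l // /N; lra.
Unshelve. all: by end_near. Qed.

(** The second difference is symmetric in [a] and [b], and divided by the square of [s] it tends to
    either mixed derivative. The argument is made in each coordinate. *)
Lemma schwarz V n (f : V -> 'rV[R]_n) (x a b : V) :
  (\forall y \near x, differentiable f y) ->
  differentiable (fun y => 'd f y a) x -> differentiable (fun y => 'd f y b) x ->
  'd (fun y => 'd f y a) x b = 'd (fun y => 'd f y b) x a.
Proof.
move=> fd da db; apply/rowP => i.
pose g y : R^o := f y 0 i.
have gd y : differentiable f y -> is_diff y g (fun v => 'd f y v 0 i).
  by move=> h; apply: is_diff_rV_coord; exact: is_diff_self.
have nd : \forall y \near x, differentiable (g : V -> R^o) y.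
  by apply: filterS fd => y /gd [].
have half c : differentiable (fun y => 'd f y c) x ->
    is_diff x (fun y => 'd g y c : R^o) (fun v => 'd (fun y => 'd f y c) x v 0 i).
  move=> dc; apply: (is_diff_near (f := fun y => 'd f y c 0 i : R^o)).
    by apply: filterS fd => y /gd /is_diffE[_ ->].
  by apply: is_diff_rV_coord; exact: is_diff_self.
have est c c' hc := @second_difference_estimate V g x c c' _ nd (half c hc).
apply/eqP; rewrite -subr_eq0 -normr_le0; apply/ler_addgt0Pr => e e0; rewrite add0r.
have e2 : 0 < e / 2 by rewrite divr_gt0.
have [s] : exists s : R, 0 < s /\
   (`|second_difference g x a b s - s ^+ 2 * 'd (fun y => 'd f y a) x b 0 i| <= s ^+ 2 * (e / 2) /\
   `|second_difference g x b a s - s ^+ 2 * 'd (fun y => 'd f y b) x a 0 i| <= s ^+ 2 * (e / 2)).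
  apply: (@filter_ex _ (0^'+ : set_system R)); near=> s.
  split; first by near: s; exact: nbhs_right_gt.
  split; near: s; [exact: est|exact: est].
have -> : second_difference g x b a s = second_difference g x a b s.
  by rewrite /second_difference [x + s *: b + _]addrAC; ring.
move=> [s0 [h1 h2]].
set A := 'd (fun y => 'd f y a) x b 0 i in h1 *.
set B := 'd (fun y => 'd f y b) x a 0 i in h2 *.
set S := second_difference _ _ _ _ _ in h1 h2.
rewrite -(ler_pM2l (exprn_gt0 2 s0)) -{1}(gtr0_norm (exprn_gt0 2 s0)) -normrM.
have -> : s ^+ 2 * (A - B) = (S - s ^+ 2 * B) - (S - s ^+ 2 * A) by ring.
apply: le_trans (ler_normB _ _) _; apply: le_trans (lerD h2 h1) _.
by rewrite -mulrDr -splitr.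
Unshelve. all: by end_near. Qed.

End CkCalculus.

(** * Maps between manifolds *)

Section ManifoldCalculus.
Context {R : realType}.
Implicit Types V W : normedModType R.

(* [vdiff f x df]: the map [f] into a manifold is differentiable at [x] with
   tangent map [df], read in the preferred chart at [f x]. *)
Definition vdiff V m (M : manifoldType R m) (f : V -> M) (x : V)
    (df : V -> 'rV[R]_m) : Prop :=
  f y @[y --> x] --> f x /\
  is_diff x (fun y => cmap (chart_at (f x)) (f y)) df.

Definition mdiff m n (M : manifoldType R m) (N : manifoldType R n) (F : M -> N)
    (p : M) (dF : 'rV[R]_m -> 'rV[R]_n) : Prop :=
  F y @[y --> p] --> F p /\
  is_diff (cmap (chart_at p) p) (read (chart_at p) (chart_at (F p)) F) dF.

Lemma mdiff_tangent m n (M : manifoldType R m) (N : manifoldType R n)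
    (F : M -> N) (p : M) dF : mdiff F p dF -> tangent F p = dF.
Proof. by move=> [_ /is_diffE[_ <-]]. Qed.

Lemma cdom_nbhs m (M : manifoldType R m) (z p : M) :
  cdom (chart_at z) p -> nbhs p (cdom (chart_at z)).
Proof. by move=> h; apply: open_nbhs_nbhs; split=> //; exact: open_cdom. Qed.

Lemma chart_nbhs m (M : manifoldType R m) (p : M) :
  nbhs p (cdom (chart_at p)).
Proof. exact/cdom_nbhs/chart_atP. Qed.

Lemma cimg_nbhs m (M : manifoldType R m) (z p : M) :
  cdom (chart_at z) p -> nbhs (cmap (chart_at z) p) (cimg (chart_at z)).
Proof.
move=> h; apply: open_nbhs_nbhs; split; first exact: open_cimg.
by exists p.
Qed.

Lemma cinv_cvg m (M : manifoldType R m) (z p : M) :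
  cdom (chart_at z) p ->
  cinv (chart_at z) y @[y --> cmap (chart_at z) p] --> p.
Proof.
move=> h; have := @cinv_cont _ _ _ (chart_at z) (cmap (chart_at z) p).
by rewrite /prop_for /continuous_at cmapK //; apply; exists p.
Qed.

Lemma cmap_cvg m (M : manifoldType R m) (z p : M) :
  cdom (chart_at z) p ->
  cmap (chart_at z) y @[y --> p] --> cmap (chart_at z) p.
Proof. exact: cmap_cont. Qed.

Lemma cinvK m (M : manifoldType R m) (z : M) (y : 'rV[R]_m) :
  cimg (chart_at z) y ->
  cmap (chart_at z) (cinv (chart_at z) y) = y.
Proof. by move=> [p zp <-]; rewrite cmapK. Qed.

Lemma cinv_cdom m (M : manifoldType R m) (z : M) (y : 'rV[R]_m) :
  cimg (chart_at z) y -> cdom (chart_at z) (cinv (chart_at z) y).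
Proof. by move=> [p zp <-]; rewrite cmapK. Qed.

Lemma smooth_mdiff m n (M : manifoldType R m) (N : manifoldType R n)
    (F : M -> N) (p : M) : smooth F -> mdiff F p (tangent F p).
Proof.
move=> [Fc Fs]; split; first exact: Fc.
apply: is_diff_self; apply: smooth_on_diff (Fs p (F p)) _.
by exists p => //; split; exact: chart_atP.
Qed.

Lemma vdiff_comp V m n (M : manifoldType R m) (N : manifoldType R n)
    (f : V -> M) (F : M -> N) (x : V) df dF :
  vdiff f x df -> mdiff F (f x) dF ->
  vdiff (fun y => F (f y)) x (fun v => dF (df v)).
Proof.
move=> [fc fd] [Fc Fd]; split; first exact: (cvg_comp _ _ fc Fc).
apply: is_diff_near (is_diff_compose fd Fd).
have : \forall y \near x, cdom (chart_at (f x)) (f y) by exact: fc (chart_nbhs _).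
by apply: filterS => y fy; rewrite /read cmapK.
Qed.

Lemma mdiff_vdiff m n (M : manifoldType R m) (N : manifoldType R n)
    (F : M -> N) (p : M) dF : mdiff F p dF ->
  vdiff (fun y => F (cinv (chart_at p) y)) (cmap (chart_at p) p) dF.
Proof.
have cp := chart_atP p.
move=> [Fc Fd]; rewrite /vdiff cmapK //; split=> //.
exact: cvg_comp (cinv_cvg cp) Fc.
Qed.

Lemma mdiff_comp m n k (M : manifoldType R m) (N : manifoldType R n)
    (P : manifoldType R k) (F : M -> N) (H : N -> P) (p : M) dF dH :
  mdiff F p dF -> mdiff H (F p) dH ->
  mdiff (fun y => H (F y)) p (fun v => dH (dF v)).
Proof.
move=> hF hH; have cp := chart_atP p.
split; first exact: cvg_comp hF.1 hH.1.
have hH' : mdiff H (F (cinv (chart_at p) (cmap (chart_at p) p))) dH by rewrite cmapK.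
have [_] := vdiff_comp (mdiff_vdiff hF) hH'.
by rewrite cmapK.
Qed.

Lemma mdiff_id m (M : manifoldType R m) (p : M) : mdiff (fun y => y) p (fun v => v).
Proof.
split; first exact: cvg_id.
apply: is_diff_near (is_diff_ident _).
have := cimg_nbhs (chart_atP p).
by apply: filterS => y /cinvK; rewrite /read => ->.
Qed.

Lemma vdiff_cst V n (N : manifoldType R n) (q : N) (x : V) :
  vdiff (fun _ => q) x (fun _ => 0).
Proof.
split; first exact: cvg_cst.
exact: is_diff_const.
Qed.

Lemma mdiff_near m n (M : manifoldType R m) (N : manifoldType R n)
    (F H : M -> N) (p : M) dF :
  F =1 H -> mdiff F p dF -> mdiff H p dF.
Proof. by move=> /funext ->. Qed.

Lemma mdiff_uniq m n (M : manifoldType R m) (N : manifoldType R n)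
    (F : M -> N) (p : M) dF dF' : mdiff F p dF -> mdiff F p dF' -> dF = dF'.
Proof. by move=> /mdiff_tangent <- /mdiff_tangent <-. Qed.

Lemma vdiff_near V m (M : manifoldType R m) (f g : V -> M) (x : V) df :
  (\forall y \near x, f y = g y) -> vdiff f x df -> vdiff g x df.
Proof.
move=> fg [fc fd]; have E := nbhs_singleton fg.
split; rewrite -E.
  by apply: cvg_trans fc; exact: near_eq_cvg.
by apply: is_diff_near fd; apply: filterS fg => y ->.
Qed.

Lemma is_diff_uniq V W (f df dg : V -> W) (x : V) :
  is_diff x f df -> is_diff x f dg -> df = dg.
Proof. by move=> /is_diffE[_ <-] /is_diffE[_ <-]. Qed.

Lemma to_coordP m (M : manifoldType R m) (z p : M) :
  cdom (chart_at z) p ->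
  is_diff (cmap (chart_at p) p) (read (chart_at p) (chart_at z) id)
    (to_coord (chart_at z) p).
Proof.
move=> zp; apply: is_diff_self; apply: smooth_on_diff (chart_compat p z) _.
by exists p => //; split=> //; exact: chart_atP.
Qed.

Lemma of_coordP m (M : manifoldType R m) (z p : M) :
  cdom (chart_at z) p ->
  is_diff (cmap (chart_at z) p) (read (chart_at z) (chart_at p) id)
    (of_coord (chart_at z) p).
Proof.
move=> zp; apply: is_diff_self; apply: smooth_on_diff (chart_compat z p) _.
by exists p => //; split=> //; exact: chart_atP.
Qed.

Lemma vdiff_chart V m (M : manifoldType R m) (f : V -> M) (x : V) df (z : M) :
  vdiff f x df -> cdom (chart_at z) (f x) ->
  is_diff x (fun y => cmap (chart_at z) (f y))
    (fun v => to_coord (chart_at z) (f x) (df v)).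
Proof.
move=> [fc fd] zf.
apply: is_diff_near (is_diff_compose fd (to_coordP zf)).
have : \forall y \near x, cdom (chart_at (f x)) (f y) by exact: fc (chart_nbhs _).
by apply: filterS => y fy; rewrite /read cmapK.
Qed.

Section Bivariate.
Context (m n k : nat) (M : manifoldType R m) (N : manifoldType R n)
  (P : manifoldType R k) (F : M -> N -> P) (sF : smooth2 F).

Definition read2 (x : M) (y : N) (z : P) (q : 'rV[R]_m * 'rV[R]_n) : 'rV[R]_k :=
  cmap (chart_at z) (F (cinv (chart_at x) q.1) (cinv (chart_at y) q.2)).

Definition dom2 (x : M) (y : N) (z : P) : set ('rV[R]_m * 'rV[R]_n) :=
  [set q | [/\ cimg (chart_at x) q.1, cimg (chart_at y) q.2 &
            cdom (chart_at z) (F (cinv (chart_at x) q.1)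
                                 (cinv (chart_at y) q.2))]].

Lemma read2_smooth x y z : smooth_on (dom2 x y z) (read2 x y z).
Proof. exact: sF.2. Qed.

Lemma dom2_point x y z a b : cdom (chart_at x) a -> cdom (chart_at y) b ->
  cdom (chart_at z) (F a b) ->
  dom2 x y z (cmap (chart_at x) a, cmap (chart_at y) b).
Proof.
by move=> xa yb zab; split; rewrite /= ?cmapK //; [exists a|exists b].
Qed.

Lemma smooth2_cvgl a b : F y b @[y --> a] --> F a b.
Proof.
exact: (cvg_comp (fun y => (y, b)) (fun q => F q.1 q.2)
  (cvg_pair cvg_id (cvg_cst b)) (sF.1 (a, b))).
Qed.

Lemma smooth2_cvgr a b : F a y @[y --> b] --> F a b.
Proof.
exact: (cvg_comp (fun y => (a, y)) (fun q => F q.1 q.2)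
  (cvg_pair (cvg_cst a) cvg_id) (sF.1 (a, b))).
Qed.

Lemma smooth2_diff0 a b : differentiable (read2 a b (F a b))
  (cmap (chart_at a) a, cmap (chart_at b) b).
Proof.
apply: smooth_on_diff (@read2_smooth a b (F a b)) _.
by apply: dom2_point; exact: chart_atP.
Qed.

Lemma smooth2_mdiffl a b : mdiff (F^~ b) a (tangent (F^~ b) a).
Proof.
suff [df h] : exists df, mdiff (F^~ b) a df by rewrite (mdiff_tangent h).
eexists; split; first exact: smooth2_cvgl.
have h := is_diff_pair (is_diff_ident (cmap (chart_at a) a))
  (is_diff_const (cmap (chart_at b) b) (cmap (chart_at a) a)).
have := is_diff_compose h (is_diff_self (smooth2_diff0 a b)).
rewrite /read2 /read /=; rewrite cmapK; first exact.
exact: chart_atP.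
Qed.

Lemma smooth2_mdiffr a b : mdiff (F a) b (tangent (F a) b).
Proof.
suff [df h] : exists df, mdiff (F a) b df by rewrite (mdiff_tangent h).
eexists; split; first exact: smooth2_cvgr.
have h := is_diff_pair (is_diff_const (cmap (chart_at a) a) (cmap (chart_at b) b))
  (is_diff_ident (cmap (chart_at b) b)).
have := is_diff_compose h (is_diff_self (smooth2_diff0 a b)).
rewrite /read2 /read /=; rewrite cmapK; first exact.
exact: chart_atP.
Qed.

Lemma smooth2_diff a b : is_diff (cmap (chart_at a) a, cmap (chart_at b) b)
  (read2 a b (F a b))
  (fun q => tangent (F^~ b) a q.1 + tangent (F a) b q.2).
Proof.
apply: is_diff_ext (is_diff_self (smooth2_diff0 a b)) => -[u v] /=.
have hl := is_diff_pair (is_diff_ident (cmap (chart_at a) a))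
  (is_diff_const (cmap (chart_at b) b) (cmap (chart_at a) a)).
have hr := is_diff_pair (is_diff_const (cmap (chart_at a) a) (cmap (chart_at b) b))
  (is_diff_ident (cmap (chart_at b) b)).
have := is_diff_compose hl (is_diff_self (smooth2_diff0 a b)).
have := is_diff_compose hr (is_diff_self (smooth2_diff0 a b)).
rewrite /read2 /= cmapK; last exact: chart_atP.
move=> h1; rewrite cmapK; last exact: chart_atP.
move=> h2.
rewrite (_ : (u, v) = (u, 0) + (0, v)); last first.
  by apply: injective_projections; rewrite /= ?addr0 ?add0r.
rewrite linearD; congr (_ + _).
  by have := is_diff_uniq h2 (smooth2_mdiffl a b).2 => /(congr1 (fun f => f u)).
by have := is_diff_uniq h1 (smooth2_mdiffr a b).2 => /(congr1 (fun f => f v)).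
Qed.

Lemma smooth2_vdiff V (f : V -> M) (g : V -> N) (x : V) df dg :
  vdiff f x df -> vdiff g x dg ->
  vdiff (fun y => F (f y) (g y)) x
   (fun v => tangent (F^~ (g x)) (f x) (df v) + tangent (F (f x)) (g x) (dg v)).
Proof.
move=> [fc fd] [gc gd]; split.
  exact: (cvg_comp (fun y => (f y, g y)) (fun q => F q.1 q.2)
    (cvg_pair fc gc) (sF.1 (f x, g x))).
have h := is_diff_compose (is_diff_pair fd gd) (smooth2_diff (f x) (g x)).
apply: is_diff_near h; rewrite /read2 /=.
have h1 : \forall y \near x, cdom (chart_at (f x)) (f y) by exact: fc (chart_nbhs _).
have h2 : \forall y \near x, cdom (chart_at (g x)) (g y) by exact: gc (chart_nbhs _).
by apply: filterS2 h1 h2 => y fy gy; rewrite !cmapK.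
Qed.

End Bivariate.

Lemma tangent_linear m n (M : manifoldType R m) (N : manifoldType R n)
  (F : M -> N) (p : M) : linear (tangent F p).
Proof. by move=> a u v; rewrite /tangent linearP. Qed.

Lemma tangent0 m n (M : manifoldType R m) (N : manifoldType R n)
  (F : M -> N) (p : M) : tangent F p 0 = 0.
Proof. exact: (linear0 ('d _ _)). Qed.

Lemma tangentZ m n (M : manifoldType R m) (N : manifoldType R n)
  (F : M -> N) (p : M) a v : tangent F p (a *: v) = a *: tangent F p v.
Proof. exact: (linearZ_LR ('d _ _)). Qed.

Lemma tangentD m n (M : manifoldType R m) (N : manifoldType R n)
  (F : M -> N) (p : M) u v : tangent F p (u + v) = tangent F p u + tangent F p v.
Proof. exact: (linearD ('d _ _)). Qed.

End ManifoldCalculus.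

Section ConstantMaps.
Context {R : realType}.

Lemma connected_clopen (T : topologicalType) (A : set T) :
  connected [set: T] -> A !=set0 -> open A -> closed A -> A = setT.
Proof.
by move=> cT A0 oA cA; apply: cT => //; exists A; rewrite ?setTI.
Qed.

Lemma vdiff_pre (V W : normedModType R) m (M : manifoldType R m) (f : W -> M)
    (phi : V -> W) (x : V) df dphi :
  is_diff x phi dphi -> vdiff f (phi x) df ->
  vdiff (fun y => f (phi y)) x (fun v => df (dphi v)).
Proof.
move=> hp [fc fd]; split; last exact: is_diff_compose hp fd.
exact: (cvg_comp _ _ (differentiable_continuous (is_diffE hp).1) fc).
Qed.

Lemma vdiff_ext (V : normedModType R) m (M : manifoldType R m) (f : V -> M)
    (x : V) df dg : df =1 dg -> vdiff f x df -> vdiff f x dg.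
Proof. by move=> /funext ->. Qed.

(** In the chart at [c t0] the mean value theorem shows that [c] is locally constant. The set where
    it takes a given value is then open, and closed because [M] is Hausdorff, hence all of the
    connected line. *)
Lemma vdiff_zero_cst m (M : manifoldType R m) (c : R -> M) :
  (forall t, vdiff (c : R^o -> M) t (fun _ => 0)) -> forall s t, c s = c t.
Proof.
move=> hc.
have loc (t0 : R) : \forall t \near t0, c t = c t0.
  have /nbhs_ballP [r /= r0 rb] : \forall t \near (t0 : R^o), cdom (chart_at (c t0)) (c t).
    exact: (hc t0).1 (chart_nbhs _).
  apply/nbhs_ballP; exists r => //= t tr.
  have D (s : R) : 0 <= s <= 1 -> is_diff (t0 + s *: (t - t0) : R^o)
      (fun y : R^o => cmap (chart_at (c t0)) (c y)) (fun _ => 0).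
    move=> /andP[s0 s1].
    have hs : cdom (chart_at (c t0)) (c (t0 + s *: (t - t0))).
      apply: rb; rewrite -ball_normE /= opprD addNKr normrN normrM ger0_norm //.
      by move: tr; rewrite -ball_normE /= distrC; apply: le_lt_trans; rewrite ler_piMl.
    apply: is_diff_ext (vdiff_chart (hc _) hs) => v.
    by rewrite /to_coord linear0.
  have := @mean_value_rV R R^o m (fun y : R^o => cmap (chart_at (c t0)) (c y)) t0 (t - t0) 0 (lexx _).
  rewrite (addrC t0) subrK => h.
  have : cmap (chart_at (c t0)) (c t) = cmap (chart_at (c t0)) (c t0).
    apply/eqP; rewrite -subr_eq0 -normr_le0; apply: h => s s01.
      by case: (D s s01).
    by case/is_diffE: (D s s01) => _ ->; rewrite normr0.
  move=> /(congr1 (cinv (chart_at (c t0)))).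
  rewrite !cmapK //; first exact: chart_atP.
  exact: rb.
move=> s t0.
have cR : connected [set: R] by apply/connected_intervalP.
have : [set s | c s = c t0] = setT.
  apply: connected_clopen => //; first by exists t0.
  - rewrite openE => y /= <-; rewrite /interior.
    exact: loc y.
  - have cc : continuous (c : R -> M) by move=> y; exact: (hc y).1.
    have c1 : closed [set c t0].
      apply: accessible_closed_set1; apply: hausdorff_accessible.
      exact: manifold_hausdorff.
    have := (continuous_closedP c).1 cc _ c1.
    by congr closed.
by move=> /(congr1 (fun A => A s)) /= ->.
Qed.

End ConstantMaps.

(** * Lie groups *)

Section LieGroupCalculus.
Context {R : realType} {d : nat} {G : lieGroupType R d}.
Implicit Types (g h k : G) (u : 'rV[R]_d) (V : normedModType R).

Lemma mulg_mdiffr g h : mdiff (fun k : G => (g * k)%g) h (tangent (fun k : G => (g * k)%g) h).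
Proof. exact: (smooth2_mdiffr smooth_mulg). Qed.

Lemma mulg_mdiffl g h : mdiff (fun k : G => (k * g)%g) h (tangent (fun k : G => (k * g)%g) h).
Proof. exact: (smooth2_mdiffl smooth_mulg). Qed.

Lemma tangent_mul1g h : tangent (fun k : G => (1 * k)%g) h = id.
Proof.
by apply: mdiff_tangent; apply: mdiff_near (mdiff_id h) => y; rewrite mul1g.
Qed.

Lemma tangent_mulg1 h : tangent (fun k : G => (k * 1)%g) h = id.
Proof.
by apply: mdiff_tangent; apply: mdiff_near (mdiff_id h) => y; rewrite mulg1.
Qed.

Lemma vdiff_mul V (f g : V -> G) (x : V) df dg :
  vdiff f x df -> vdiff g x dg ->
  vdiff (fun y => (f y * g y)%g) x
   (fun v => tangent (fun h => h * g x)%g (f x) (df v) +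
             tangent (fun h => f x * h)%g (g x) (dg v)).
Proof. exact: (smooth2_vdiff smooth_mulg). Qed.

Lemma vdiff_mul1 V (f g : V -> G) (x : V) df dg :
  f x = 1%g -> g x = 1%g -> vdiff f x df -> vdiff g x dg ->
  vdiff (fun y => (f y * g y)%g) x (fun v => df v + dg v).
Proof.
move=> f1 g1 hf hg; have := vdiff_mul hf hg.
by rewrite f1 g1 tangent_mul1g tangent_mulg1.
Qed.

Lemma inv_mdiff g : mdiff (fun k : G => (k^-1)%g) g (tangent (fun k : G => (k^-1)%g) g).
Proof. exact: smooth_mdiff smooth_invg. Qed.

(** Differentiate the identity [y * y^-1 = 1] at 1, in the chart at 1. *)
Lemma tangent_inv1 u : tangent (fun k : G => (k^-1)%g) 1%g u = - u.
Proof.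
pose f := fun y : 'rV[R]_d => cinv (chart_at (1%g : G)) y.
pose e := cmap (chart_at (1%g : G)) 1%g.
have f1 : f e = 1%g by rewrite /f cmapK //; exact: chart_atP.
have hf : vdiff f e (fun v => v) by exact: (mdiff_vdiff (mdiff_id _)).
have hi : mdiff (fun k : G => (k^-1)%g) (f e) (tangent (fun k : G => (k^-1)%g) 1%g).
  by rewrite f1; exact: inv_mdiff.
have := vdiff_mul1 f1 _ hf (vdiff_comp hf hi).
rewrite f1 invg1 => /(_ erefl) h.
have h' : vdiff (fun y => (f y * (f y)^-1)%g) e (fun _ => 0).
  have := vdiff_cst (1%g : G) e; apply: vdiff_near.
  by near=> y; rewrite mulgV.
have [_ h1] := h; have [_ h2] := h'.
have := is_diff_uniq h1 h2 => /(congr1 (fun F => F u)) /eqP.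
by rewrite addrC addr_eq0 => /eqP.
Unshelve. all: by end_near. Qed.

Definition Ad g : 'rV[R]_d -> 'rV[R]_d := tangent (fun h : G => (g * h * g^-1)%g) 1%g.

Lemma conj_mdiff g h :
  mdiff (fun k : G => (g * k * g^-1)%g) h (tangent (fun k : G => (g * k * g^-1)%g) h).
Proof.
have h1 := mdiff_comp (mulg_mdiffr g h) (mulg_mdiffl (g^-1)%g (g * h)%g).
by have E := mdiff_tangent h1; rewrite -E in h1.
Qed.

Lemma Ad_mdiff g : mdiff (fun k : G => (g * k * g^-1)%g) 1%g (Ad g).
Proof. exact: conj_mdiff. Qed.

Lemma Ad_linear g : linear (Ad g).
Proof. exact: tangent_linear. Qed.

HB.instance Definition _ g := GRing.isLinear.Build R 'rV[R]_d 'rV[R]_d _ (Ad g)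
  (Ad_linear g).

Lemma AdM g h u : Ad (g * h)%g u = Ad g (Ad h u).
Proof.
have hg : mdiff (fun k : G => (g * k * g^-1)%g) (h * 1 * h^-1)%g (Ad g).
  by rewrite mulg1 mulgV; exact: Ad_mdiff.
have := mdiff_comp (Ad_mdiff h) hg => H.
have H' : mdiff (fun k : G => (g * h * k * (g * h)^-1)%g) 1%g (fun u => Ad g (Ad h u)).
  by apply: mdiff_near H => k; rewrite invgM !mulgA.
by rewrite /Ad (mdiff_tangent H').
Qed.

Lemma Ad1 u : Ad (1%g : G) u = u.
Proof.
have H' : mdiff (fun k : G => (1 * k * 1^-1)%g) 1%g (fun u => u).
  by apply: mdiff_near (mdiff_id _) => k; rewrite mul1g invg1 mulg1.
by rewrite /Ad (mdiff_tangent H').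
Qed.

Lemma AdVK g u : Ad g (Ad (g^-1)%g u) = u.
Proof. by rewrite -AdM mulgV Ad1. Qed.

(** Only the velocity at 0 is prescribed: the homomorphism property carries differentiability to all
    times, see [onep_vdiff]. *)
Definition onep (gamma : R -> G) u : Prop :=
  (forall s t, gamma (s + t) = (gamma s * gamma t)%g) /\
  vdiff (gamma : R^o -> G) 0 (fun s => s *: u).

Lemma onep0 gamma u : onep gamma u -> gamma 0 = 1%g.
Proof.
move=> [h _]; have := h 0 0; rewrite addr0 => /(congr1 (fun x => (gamma 0)^-1 * x)%g).
by rewrite mulVg mulKg.
Qed.

Lemma onepN gamma u t : onep gamma u -> gamma (- t) = (gamma t)^-1%g.
Proof.
move=> h; have [hm _] := h; apply: (mulgI (gamma t)).
by rewrite -hm subrr mulgV (onep0 h).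
Qed.

Lemma is_diff_shift (V : normedModType R) (x t : V) : is_diff x (fun y => y - t) (fun v => v).
Proof.
have := is_diffD (is_diff_ident x) (is_diff_const (- t) x).
by apply: is_diff_ext => v /=; rewrite addr0.
Qed.

(* A curve that near each point is a translate, on both sides, of a curve
   which is critical at the identity. *)
Lemma translate_vdiff0 (c : R -> G) (t : R) (a b : G) (f : R -> G) :
  f 0 = 1%g -> vdiff (f : R^o -> G) 0 (fun _ => 0) ->
  (forall s, c s = (a * f (s - t) * b)%g) -> vdiff (c : R^o -> G) t (fun _ => 0).
Proof.
move=> f1 hf cE.
have hf' : vdiff (fun s : R^o => f (s - t)) (t : R^o) (fun _ => 0).
  have hf0 : vdiff (f : R^o -> G) (t - t : R^o) (fun _ => 0) by rewrite subrr.
  exact: (vdiff_pre (@is_diff_shift R^o t t) hf0).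
have h1 := vdiff_comp hf' (mulg_mdiffr a _).
have h2 := vdiff_comp h1 (mulg_mdiffl b _).
have -> : c = fun s => (a * f (s - t) * b)%g by apply/funext => s; exact: cE.
apply: vdiff_ext h2 => v /=.
by rewrite !tangent0.
Qed.

Lemma onep_vdiff gamma u t : onep gamma u ->
  vdiff (gamma : R^o -> G) t (fun s => s *: @left_field R d G u (gamma t)).
Proof.
move=> h; have [hm hd] := h.
have hf' : vdiff (fun s : R^o => gamma (s - t)) (t : R^o) (fun s => s *: u).
  have hf0 : vdiff (gamma : R^o -> G) (t - t : R^o) (fun s => s *: u) by rewrite subrr.
  exact: (vdiff_pre (@is_diff_shift R^o t t) hf0).
have h1 := vdiff_comp hf' (mulg_mdiffr (gamma t) _).
rewrite subrr (onep0 h) in h1.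
have -> : gamma = fun s => (gamma t * gamma (s - t))%g.
  by apply/funext => s; rewrite -hm addrC subrK.
rewrite -hm addrC subrK.
apply: vdiff_ext h1 => s; rewrite /left_field.
exact: tangentZ.
Qed.

Lemma onep_rev gamma u : onep gamma u -> vdiff (fun t : R^o => gamma (- t)) 0 (fun s => s *: - u).
Proof.
move=> h; have [hm hd] := h.
have hd' : is_diff (0 : R^o) (fun s : R^o => - s) (fun s => - s).
  exact: is_diffN (is_diff_ident (0 : R^o)).
have := vdiff_pre hd' (f := gamma : R^o -> G) (df := fun s => s *: u).
rewrite oppr0 => /(_ hd); apply: vdiff_ext => s.
by rewrite scalerN scaleNr.
Qed.

(** The product [f t = gamma t * gamma' (- t)] is critical at 0, and around any [t] it is a
    two-sided translate of its germ at 0, so its velocity vanishes everywhere. *)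
Lemma onep_uniq gamma gamma' u : onep gamma u -> onep gamma' u -> gamma = gamma'.
Proof.
move=> h h'; have [hm hd] := h; have [hm' hd'] := h'.
pose f t := (gamma t * gamma' (- t))%g.
have f0 : f 0 = 1%g by rewrite /f oppr0 (onep0 h) (onep0 h') mulg1.
have df : vdiff (f : R^o -> G) 0 (fun _ => 0).
  have H := vdiff_mul1 (f := gamma : R^o -> G) (g := fun t : R^o => gamma' (- t)) (x := 0)
     (onep0 h) _ hd (onep_rev h').
  rewrite oppr0 (onep0 h') in H; apply: vdiff_ext (H erefl) => s.
  by rewrite scalerN subrr.
have fc : forall s t, f s = f t.
  apply: vdiff_zero_cst => t.
  apply: (translate_vdiff0 (a := gamma t) (b := gamma' (- t)) f0 df) => s.
  rewrite /f !mulgA -hm -mulgA -hm'; congr (gamma _ * gamma' _)%g; ring.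
apply/funext => t; have := fc t 0; rewrite f0 /f (onepN _ h') => /eqP.
by rewrite mulg_eq1 invgK => /eqP.
Qed.

End LieGroupCalculus.

(** * The exponential map *)

Section EpsilonDelta.
Context {R : realType}.
Implicit Types V W : normedModType R.

Lemma is_diff_eps V W (f df : V -> W) (x : V) : is_diff x f df ->
  forall e : R, 0 < e -> exists2 r : R, 0 < r &
  forall y, `|y| < r -> `|f (x + y) - f x - df y| <= e * `|y|.
Proof.
move=> /is_diffE[F1 F2] e e0.
have [Fc FE] := (diff_locallyP x f).1 F1.
have /nbhs_ballP [r /= r0 rb] : \forall y \near (0 : V),
    `|f (y + x) - (f x + df y)| <= e * `|y|.
  move/eqaddoP : FE => /(_ _ e0); apply: filterS => y.
  by rewrite /= !fctE /shift /cst /= F2.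
exists r => // y yr; rewrite -addrA -opprD [x + y]addrC; apply: rb.
by rewrite -ball_normE /= sub0r normrN.
Qed.

Lemma eps_is_diff V W (f : V -> W) (df : {linear V -> W}) (x : V) :
  continuous df ->
  (forall e : R, 0 < e -> exists2 r : R, 0 < r &
    forall y, `|y| < r -> `|f (x + y) - f x - df y| <= e * `|y|) ->
  is_diff x f df.
Proof.
move=> dc h.
have E : f \o shift x = cst (f x) + df +o_ (0 : V) id.
  apply/eqaddoP => e e0; have [r r0 rb] := h e e0.
  apply/nbhs_ballP; exists r => //= y; rewrite -ball_normE /= sub0r normrN => yr.
  have := rb y yr.
  by rewrite -addrA -opprD [x + y]addrC.
have D := diff_unique dc E.
split; last exact: D.
by apply/diff_locallyP; rewrite D.
Qed.

Lemma eps_is_diff_curve W (f : R -> W) (u : W) :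
  (forall e : R, 0 < e -> exists2 r : R, 0 < r &
    forall t, `|t| < r -> `|f t - f 0 - t *: u| <= e * `|t|) ->
  is_diff (0 : R^o) (f : R^o -> W) (fun t : R^o => t *: u).
Proof.
move=> h.
have lin : linear (fun t : R^o => t *: u).
  by move=> a s t; rewrite scalerDl scalerA.
pose dlM := GRing.isLinear.Build _ _ _ _ _ lin.
pose dL : {linear R^o -> W} := HB.pack (fun t : R^o => t *: u) dlM.
apply: (@eps_is_diff _ _ _ dL).
  by move=> t; apply: (@cvgZr_tmp _ _ _ (nbhs t) (nbhs_filter t)); exact: cvg_id.
move=> e e0; have [r r0 rb] := h e e0; exists r => // t tr.
by rewrite add0r; exact: rb.
Qed.

Lemma ultra_fmap (T U : Type) (f : T -> U) (D : set_system T) :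
  UltraFilter D -> UltraFilter (f x @[x --> D]).
Proof.
move=> UD; apply: Build_UltraFilter => H PH DH.
apply/seteqP; split=> // A HA; apply: contrapT => nA.
have [//|DC] := in_ultra_setVsetC (f @^-1` A) UD.
have HC : H (~` A) by exact: DH.
have [x [Ax nAx]] : (A `&` ~` A) !=set0 by apply: (@filter_ex _ H _); exact: filterI.
exact: nAx.
Qed.

(** If the preimage of a neighbourhood is not in [F], then [F] restricted to its complement is
    proper, and an ultrafilter refining it contradicts the hypothesis. Limits of curves are built
    along ultrafilters; this brings the result back to ordinary filters. *)
Lemma cvg_ultra (T : Type) (U : topologicalType) (F : set_system T) {FF : ProperFilter F}
    (f : T -> U) (l : U) :
  (forall D, UltraFilter D -> F `<=` D -> f x @[x --> D] --> l) ->
  f x @[x --> F] --> l.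
Proof.
move=> h A /= Al; apply: contrapT => nF.
pose B := f @^-1` A.
have pw : ProperFilter (within (~` B) F).
  apply: Build_ProperFilter_ex.
  move=> C wC; apply: contrapT => nC; apply: nF.
  move: wC; rewrite /within /=; apply: filterS => x hx.
  by apply: contrapT => nBx; apply: nC; exists x; apply: hx.
have [D [UD FD]] := ultraFilterLemma pw.
have DB : D B by apply: (h D UD) => // C FC; apply: FD; apply: filterS FC.
have DnB : D (~` B) by apply: FD; rewrite /within /=; near=> x.
have [x [Bx nBx]] : (B `&` ~` B) !=set0 by apply: (@filter_ex _ D _); exact: filterI.
exact: nBx.
Unshelve. all: by end_near. Qed.

End EpsilonDelta.

Section ChartAtIdentity.
Context {R : realType} {d : nat} {G : lieGroupType R d}.
Implicit Types (g h k : G) (u : 'rV[R]_d).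

Local Notation c1 := (chart_at (1%g : G)).
Local Notation e0 := (cmap c1 (1%g : G)).

(** Chart coordinates centred at the identity, not the inverse of [expG]; [expG_lg] shows that the
    two agree to first order. *)
Definition lg g : 'rV[R]_d := cmap c1 g - e0.

Lemma lg1 : lg 1%g = 0. Proof. exact: subrr. Qed.

Lemma mulg_cvg (T : Type) (F : set_system T) {FF : Filter F} (f g : T -> G) (a b : G) :
  f x @[x --> F] --> a -> g x @[x --> F] --> b ->
  (f x * g x)%g @[x --> F] --> (a * b)%g.
Proof.
move=> fa gb; exact: (cvg_comp (fun x => (f x, g x)) (fun q => q.1 * q.2)%g
  (cvg_pair fa gb) ((smooth_mulg (s := G)).1 (a, b))).
Qed.

Lemma invg_cvg (T : Type) (F : set_system T) (f : T -> G) (a : G) :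
  f x @[x --> F] --> a -> (f x)^-1%g @[x --> F] --> (a^-1)%g.
Proof.
move=> fa; exact: (cvg_comp f (fun x : G => x^-1%g) fa ((smooth_invg (s := G)).1 a)).
Qed.

Lemma dom2_nbhs1 : nbhs (e0, e0) (dom2 (fun g h : G => (g * h)%g) 1%g 1%g 1%g).
Proof.
have c1i : cdom c1 (1%g : G) by exact: chart_atP.
have i1 : \forall q \near ((e0, e0) : 'rV[R]_d * 'rV[R]_d), cimg c1 q.1.
  by have := @cvg_fst _ _ (nbhs e0) (nbhs e0) _ _ (cimg_nbhs c1i); apply.
have i2 : \forall q \near ((e0, e0) : 'rV[R]_d * 'rV[R]_d), cimg c1 q.2.
  by have := @cvg_snd _ _ (nbhs e0) (nbhs e0) _ _ (cimg_nbhs c1i); apply.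
have i3 : \forall q \near ((e0, e0) : 'rV[R]_d * 'rV[R]_d),
    cdom c1 (cinv c1 q.1 * cinv c1 q.2)%g.
  have f1 : cinv c1 q.1 @[q --> (e0, e0)] --> (1%g : G).
    exact: cvg_comp (@cvg_fst _ _ (nbhs e0) (nbhs e0) _) (cinv_cvg c1i).
  have f2 : cinv c1 q.2 @[q --> (e0, e0)] --> (1%g : G).
    exact: cvg_comp (@cvg_snd _ _ (nbhs e0) (nbhs e0) _) (cinv_cvg c1i).
  have := mulg_cvg f1 f2; rewrite mulg1; apply.
  exact: chart_nbhs.
by apply: filterS3 i1 i2 i3 => q a b c; split.
Qed.

(** The error involves [h] only. Therefore, when [g] is multiplied by itself [n] times, the errors
    add up to at most [e] times [n * |lg g|]. *)
Lemma mulg_strict (e : R) : 0 < e -> exists2 r : R, 0 < r &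
  forall g h, cdom c1 g -> cdom c1 h -> `|lg g| < r -> `|lg h| < r ->
  cdom c1 (g * h)%g /\ `|lg (g * h)%g - lg g - lg h| <= e * `|lg h|.
Proof.
have c1i : cdom c1 (1%g : G) by exact: chart_atP.
move=> e_gt0.
have [r r0 rb] := strict_partial_diff (@read2_smooth _ _ _ _ _ _ _ _ (smooth_mulg (s := G)) 1%g 1%g 1%g)
  dom2_nbhs1 e_gt0.
exists r => // g h dg dh gr hr.
have [[_ _ D] E] := rb _ _ gr hr.
move: D E; rewrite /read2 /= !cmapK // mulg1.
have := smooth2_diff (smooth_mulg (s := G)) 1%g 1%g.
rewrite mulg1 => /is_diffE[_ ->] /= D.
rewrite tangent0 add0r tangent_mul1g /lg => H; split=> //.
have -> : cmap c1 (g * h)%g - e0 - (cmap c1 g - e0) - (cmap c1 h - e0) =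
   cmap c1 (g * h)%g - cmap c1 g - (cmap c1 h - e0) by rewrite opprB addrA subrK.
 exact: H.
Qed.

End ChartAtIdentity.

Section OneParameter.
Context {R : realType} {d : nat} {G : lieGroupType R d}.
Implicit Types (g h k : G) (u : 'rV[R]_d).

Local Notation c1 := (chart_at (1%g : G)).
Local Notation e0 := (cmap c1 (1%g : G)).

Lemma cdom1 : cdom c1 (1%g : G). Proof. exact: chart_atP. Qed.

Lemma invg_strict (e : R) : 0 < e -> exists2 r : R, 0 < r &
  forall g, cdom c1 g -> `|lg g| < r ->
  cdom c1 (g^-1)%g /\ `|lg (g^-1)%g + lg g| <= e * `|lg g|.
Proof.
move=> e_gt0; have [ic id] := @inv_mdiff _ _ G 1%g.
rewrite invg1 in ic id.
have [r r0 rb] := is_diff_eps id e_gt0.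
have /nbhs_ballP [r' /= r'0 rb'] : \forall y \near e0, cdom c1 (cinv c1 y)^-1%g.
  have h : (cinv c1 y)^-1%g @[y --> e0] --> (1%g : G).
    by rewrite -[X in _ --> X]invg1; apply: invg_cvg; exact: cinv_cvg cdom1.
  exact: h (chart_nbhs _).
exists (Order.min r r'); first by rewrite lt_min r0.
move=> g dg; rewrite lt_min => /andP[gr gr'].
have gE : cmap c1 g = e0 + lg g by rewrite /lg addrC subrK.
split.
  have := rb' (e0 + lg g); rewrite -gE cmapK //; apply.
  by rewrite -ball_normE /= distrC.
have := rb _ gr; rewrite -gE /read !cmapK //; last exact: cdom1.
by rewrite invg1 tangent_inv1 opprK.
Qed.

Lemma lg_cvg (T : Type) (F : set_system T) {FF : Filter F} (f : T -> G) g :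
  cdom c1 g -> f x @[x --> F] --> g -> lg (f x) @[x --> F] --> lg g.
Proof.
move=> dg fg; apply: cvgB; last exact: cvg_cst.
exact: (cvg_comp _ _ fg (cmap_cvg dg)).
Qed.

Lemma expg_strict (e : R) : 0 < e -> exists2 r : R, 0 < r &
  forall g n, cdom c1 g -> n%:R * `|lg g| < r ->
  cdom c1 (g ^+ n)%g /\ `|lg (g ^+ n)%g - n%:R *: lg g| <= e * (n%:R * `|lg g|).
Proof.
move=> e_gt0.
(* With [e' <= 1] the induction keeps [|lg (g ^+ i)|] within twice [i * |lg g|], hence below [r]
   when [i * |lg g|] is below [r / 2]. *)
pose e' := Order.min e 1.
have e'0 : 0 < e' by rewrite lt_min e_gt0 ltr01.
have e'1 : e' <= 1 by rewrite ge_min lexx orbT.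
have e'e : e' <= e by rewrite ge_min lexx.
have [r r0 rb] := @mulg_strict R d G _ e'0.
exists (r / 2); first by rewrite divr_gt0.
move=> g n dg ngr.
suff H i : (i <= n)%N -> cdom c1 (g ^+ i)%g /\
    `|lg (g ^+ i)%g - i%:R *: lg g| <= e' * (i%:R * `|lg g|).
  have [D E] := H n (leqnn n); split=> //.
  by apply: le_trans E _; rewrite ler_wpM2r // mulr_ge0.
elim: i => [_|i IH lin].
  by rewrite expg0 lg1 scale0r subrr normr0 !mul0r mulr0; split=> //; exact: cdom1.
have [D E] := IH (ltnW lin).
have ig : i%:R * `|lg g| < r / 2.
  by apply: le_lt_trans ngr; rewrite ler_wpM2r // ler_nat ltnW.
have gr : `|lg g| < r.
  apply: lt_trans (_ : _ < r / 2) _; last by rewrite ltr_pdivrMr // ltr_pMr // ltr1n.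
  apply: le_lt_trans ngr; rewrite ler_peMl // (ler_nat _ 1).
  exact: leq_trans lin.
have gir : `|lg (g ^+ i)%g| < r.
  rewrite -[lg _](subrK (i%:R *: lg g)).
  apply: le_lt_trans (ler_normD _ _) _.
  have : e' * (i%:R * `|lg g|) <= i%:R * `|lg g|.
    by rewrite ler_piMl // mulr_ge0.
  move=> h; rewrite [r]splitr; apply: ler_ltD; last by rewrite normrZ normr_nat.
  by apply: le_trans E (le_trans h (ltW ig)).
have [D' E'] := rb _ _ D dg gir gr.
rewrite expgSr; split=> //.
have -> : lg (g ^+ i * g)%g - i.+1%:R *: lg g =
   (lg (g ^+ i * g)%g - lg (g ^+ i)%g - lg g) + (lg (g ^+ i)%g - i%:R *: lg g).
  by apply/rowP => j; rewrite !mxE -natr1; ring.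
apply: le_trans (ler_normD _ _) _; apply: le_trans (lerD E' E) _.
by rewrite -mulrDr -natr1 mulrDl mul1r addrC.
Qed.

Lemma lg_inj_cvg (T : Type) (F : set_system T) {FF : Filter F} (f : T -> G) :
  (\forall x \near F, cdom c1 (f x)) -> lg (f x) @[x --> F] --> (0 : 'rV[R]_d) ->
  f x @[x --> F] --> (1%g : G).
Proof.
move=> fd fl.
have h : cmap c1 (f x) @[x --> F] --> e0.
  have : lg (f x) + e0 @[x --> F] --> 0 + e0 by exact: cvgD fl (cvg_cst e0).
  rewrite add0r (_ : (fun x => lg (f x) + e0) = (fun x => cmap c1 (f x))) //.
  by apply/funext => x; rewrite /lg subrK.
have := cvg_comp _ _ h (cinv_cvg cdom1); apply: cvg_trans; apply: near_eq_cvg.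
by apply: filterS fd => x dx; rewrite /= cmapK.
Qed.

(** * Ultrafilter limits of approximate one-parameter subgroups *)

Section Limit.
Context (I : Type) (D : set_system I) (UD : UltraFilter D) (c : I -> R -> G) (u : 'rV[R]_d).
Hypothesis c_add : forall s t, 0 <= s -> 0 <= t ->
  ((c i (s + t))^-1 * (c i s * c i t))%g @[i --> D] --> (1%g : G).
Hypothesis c_lg : forall e : R, 0 < e -> exists2 r : R, 0 < r &
  forall t, 0 <= t < r -> \forall i \near D, cdom c1 (c i t) /\
     `|lg (c i t) - t *: u| <= e * t.

(** For small [t] the points [c i t] stay in a closed ball of the chart at 1; it is compact, so they
    converge along the ultrafilter [D]. *)
Lemma limit_small : exists2 r : R, 0 < r & forall t, 0 <= t < r ->
  exists2 l : G, cdom c1 l & c i t @[i --> D] --> l.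
Proof.
have /nbhs_ballP [r /= r0 rb] := cimg_nbhs cdom1.
have [r1 r10 rb1] := c_lg ltr01.
pose N := `|u| + 1.
have N0 : 0 < N by rewrite /N; have := normr_ge0 u; lra.
pose r2 := Order.min r1 (r / 2 / N).
have r20 : 0 < r2 by rewrite lt_min r10 !divr_gt0.
exists r2 => // t /andP[t0]; rewrite lt_min => /andP[tr1 tr].
pose B := closed_ball e0 (r / 2).
have BE : B = [set y | `|e0 - y| <= r / 2].
  by rewrite /B closed_ballE // divr_gt0.
have cB : compact B.
  apply: bounded_closed_compact; last exact: closed_ball_closed.
  exists (`|e0| + r / 2); split; first exact: num_real.
  move=> M hM y; rewrite BE /= => yB; apply: le_trans (ltW hM).
  rewrite -(subrK e0 y) addrC; apply: le_trans (ler_normD _ _) _.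
  by rewrite lerD2l distrC.
have Bi y : B y -> cimg c1 y.
  rewrite BE => yB; apply: rb; rewrite -ball_normE /=.
  by apply: le_lt_trans yB _; rewrite ltr_pdivrMr // ltr_pMr // ltr1n.
have h1 := rb1 t; rewrite t0 tr1 in h1; have {}h1 := h1 isT.
have hB : \forall i \near D, B (cmap c1 (c i t)).
  apply: filterS h1 => i [di hi]; rewrite BE /= distrC -/(lg _).
  rewrite -[lg _](subrK (t *: u)); apply: le_trans (ler_normD _ _) _.
  rewrite normrZ ger0_norm //; apply: le_trans (lerD hi (lexx _)) _.
  have -> : 1 * t + t * `|u| = t * N by rewrite /N; ring.
  by rewrite -ler_pdivlMr // ltW.
rewrite compact_ultra in cB.
have [y [By yl]] := cB _ (ultra_fmap (fun i => cmap c1 (c i t)) UD) hB.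
have Iy := Bi y By; have [l dl lE] := Iy.
exists l => //.
have h : cmap c1 (c i t) @[i --> D] --> cmap c1 l by rewrite lE.
have := cvg_comp _ _ h (cinv_cvg dl); apply: cvg_trans; apply: near_eq_cvg.
by apply: filterS h1 => i [di _]; rewrite /= cmapK.
Qed.

Lemma limit_add s t a b : 0 <= s -> 0 <= t ->
  c i s @[i --> D] --> a -> c i t @[i --> D] --> b ->
  c i (s + t) @[i --> D] --> (a * b)%g.
Proof.
move=> s0 t0 sa tb.
have : (c i s * c i t * ((c i (s + t))^-1 * (c i s * c i t))^-1)%g @[i --> D] -->
    (a * b * 1^-1)%g.
  by exact: mulg_cvg (mulg_cvg sa tb) (invg_cvg (c_add s0 t0)).
rewrite invg1 mulg1.
rewrite (_ : (fun i => _) = fun i => c i (s + t)) //.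
by apply/funext => i; rewrite invgM invgK mulVKg.
Qed.

(** A large [t] is cut into [n.+1] equal pieces short enough for [limit_small]; asymptotic
    additivity multiplies their limits. *)
Lemma limit_exists t : 0 <= t -> exists l : G, c i t @[i --> D] --> l.
Proof.
move=> t0; have [r r0 h] := limit_small.
have [n tn] : exists n, t / n.+1%:R < r.
  have [n _ hn] := (near_infty_natSinv_lt (PosNum (divr_gt0 r0 (ltr_wpDl t0 ltr01)))).
  exists n; have := hn n (leqnn n); rewrite /= => hh.
  apply: le_lt_trans (_ : _ <= (t + 1) * n.+1%:R^-1) _.
    by rewrite ler_wpM2r // lerDl.
  by rewrite mulrC -ltr_pdivlMr // ltr_wpDl.
pose s := t / n.+1%:R.
have s0 : 0 <= s by rewrite divr_ge0.
have [l _ sl] := h s (introT andP (conj s0 tn)).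
suff H m : exists l : G, c i (m.+1%:R * s) @[i --> D] --> l.
  by have [l' hl'] := H n; exists l'; move: hl'; rewrite /s mulrC divfK.
elim: m => [|m [l' IH]]; first by exists l; rewrite mul1r.
exists (l' * l)%g; rewrite -natr1 mulrDl mul1r; apply: limit_add => //.
by rewrite mulr_ge0.
Qed.

Let gp (t : R) : G := if pselect (0 <= t) is left t0 then
  projT1 (cid (limit_exists t0)) else 1%g.

Let gpE t : 0 <= t -> c i t @[i --> D] --> gp t.
Proof.
move=> t0; rewrite /gp; case: pselect => // t0'.
exact: projT2 (cid (limit_exists t0')).
Qed.

Let lim_uniq t l : 0 <= t -> c i t @[i --> D] --> l -> gp t = l.
Proof.
move=> t0 h; apply: cvg_unique (gpE t0) h.
exact: manifold_hausdorff.
Qed.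

Let gpD s t : 0 <= s -> 0 <= t -> gp (s + t) = (gp s * gp t)%g.
Proof.
move=> s0 t0; apply: lim_uniq; first by rewrite addr_ge0.
by apply: limit_add => //; exact: gpE.
Qed.

Let gp0 : gp 0 = 1%g.
Proof.
have := gpD (lexx 0) (lexx 0); rewrite addr0 => /(congr1 (fun x => (gp 0)^-1 * x)%g).
by rewrite mulVg mulKg.
Qed.

Let gpC s t : 0 <= s -> 0 <= t -> (gp s * gp t = gp t * gp s)%g.
Proof. by move=> s0 t0; rewrite -!gpD // addrC. Qed.

(** Extension to negative times. [gamB] writes every value as a quotient of values at nonnegative
    times, which reduces the group law to commutation of the [gp]. *)
Let gam (t : R) : G := if 0 <= t then gp t else (gp (- t))^-1%g.

Let gamB a b : 0 <= a -> 0 <= b -> gam (a - b) = (gp a * (gp b)^-1)%g.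
Proof.
move=> a0 b0; rewrite /gam; case: (lerP 0 (a - b)) => h.
  by rewrite -[gp a](_ : gp (a - b) * gp b = _)%g ?mulgK // -gpD // subrK.
have h' : 0 <= b - a by rewrite subr_ge0 ltW // -subr_lt0.
by rewrite opprB -[gp b](_ : gp (b - a) * gp a = _)%g ?invgM ?mulVKg // -gpD // subrK.
Qed.

Let gamD s t : gam (s + t) = (gam s * gam t)%g.
Proof.
have dec x : exists a b, [/\ 0 <= a, 0 <= b & x = a - b :> R].
  exists `|x|, (`|x| - x); split=> //; first by rewrite subr_ge0 ler_norm.
  by rewrite opprB addrC subrK.
have [a [b [a0 b0 ->]]] := dec s; have [a' [b' [a0' b0' ->]]] := dec t.
have -> : a - b + (a' - b') = (a + a') - (b + b') by ring.
rewrite !gamB ?addr_ge0 // (gpD a0 a0') (gpD b0 b0') (gpC b0 b0') invgM.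
rewrite -!mulgA; congr (_ * _)%g; rewrite !mulgA; congr (_ * _)%g.
apply: (mulIg (gp b)); rewrite -!mulgA mulVg mulg1.
by apply: (mulgI (gp b)); rewrite mulVKg gpC.
Qed.

Let gp_lg (e : R) : 0 < e -> exists2 r : R, 0 < r & forall t, 0 <= t < r ->
  cdom c1 (gp t) /\ `|lg (gp t) - t *: u| <= e * t.
Proof.
move=> e_gt0; have [r r0 h] := limit_small; have [r' r'0 h'] := c_lg e_gt0.
exists (Order.min r r'); first by rewrite lt_min r0.
move=> t /andP[t0]; rewrite lt_min => /andP[tr tr'].
have [l dl hl] := h t (introT andP (conj t0 tr)).
have gl : gp t = l by exact: lim_uniq.
rewrite gl; split=> //.
have H := h' t (introT andP (conj t0 tr')).
have ct : `|lg (c i t) - t *: u| @[i --> D] --> `|lg l - t *: u|.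
  by apply: cvg_norm; apply: cvgB; [exact: lg_cvg dl hl|exact: cvg_cst].
apply: (cvgr_to_le ct).
by apply: filterS H => i [].
Qed.

Let gam_lg (e : R) : 0 < e -> exists2 r : R, 0 < r & forall t, `|t| < r ->
  cdom c1 (gam t) /\ `|lg (gam t) - t *: u| <= e * `|t|.
Proof.
move=> e_gt0.
pose N := `|u| + 2 + e.
have N0 : 0 < N by rewrite /N; have := normr_ge0 u; lra.
have e2 : 0 < e / 2 by rewrite divr_gt0.
have [r r0 h] := gp_lg e2.
have e3 : 0 < e / 2 / N by rewrite divr_gt0.
have [r' r'0 h'] := invg_strict e3.
exists (Order.min r (r' / N)); first by rewrite lt_min r0 divr_gt0.
move=> t; rewrite lt_min => /andP[tr tr'].
rewrite /gam; case: lerP => [t0|t0].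
  rewrite ger0_norm // in tr *.
  have [D1 E1] := h t (introT andP (conj t0 tr)); split=> //.
  by apply: le_trans E1 _; rewrite ler_wpM2r // ler_pdivrMr // ler_peMr // ?ler1n // ltW.
rewrite ltr0_norm // in tr tr' *.
have nt0 : 0 <= - t by rewrite oppr_ge0 ltW.
have [D1 E1] := h _ (introT andP (conj nt0 tr)).
have lgN : `|lg (gp (- t))| <= N * - t.
  rewrite -[lg _](subrK (- t *: u)); apply: le_trans (ler_normD _ _) _.
  apply: le_trans (lerD E1 (lexx _)) _.
  rewrite normrZ ger0_norm // [_ * `|u|]mulrC -mulrDl ler_wpM2r // /N.
  by have := normr_ge0 u; lra.
have [|D2 E2] := h' _ D1.
  by apply: le_lt_trans lgN _; rewrite mulrC -ltr_pdivlMr.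
split=> //.
have -> : lg (gp (- t))^-1%g - t *: u =
  (lg (gp (- t))^-1%g + lg (gp (- t))) - (lg (gp (- t)) - (- t) *: u).
  by rewrite opprB addrCA addrK addrC scaleNr.
apply: le_trans (ler_normB _ _) _; apply: le_trans (lerD E2 E1) _.
apply: le_trans (lerD (ler_wpM2l (ltW e3) lgN) (lexx _)) _.
rewrite mulrA divfK ?gt_eqF // -mulrDl -splitr.
exact: lexx.
Qed.

(** Used twice: with powers of points tending to 1, for the existence of one-parameter subgroups,
    and with the curves [expG (t *: v)] as [v] tends to [u], for the continuity of [expG]. *)
Lemma limit_onep : exists2 gamma, onep gamma u &
  forall t, 0 <= t -> c i t @[i --> D] --> gamma t.
Proof.
exists gam; last by move=> t t0; rewrite /gam t0; exact: gpE.
have gam0 : gam 0 = 1%g by rewrite /gam lexx gp0.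
have dl : is_diff (0 : R^o) (fun t : R^o => lg (gam t)) (fun t : R^o => t *: u).
  apply: eps_is_diff_curve => e e_gt0; have [r r0 h] := gam_lg e_gt0.
  by exists r => // t tr; have [_] := h t tr; rewrite gam0 lg1 subr0.
have cl := differentiable_continuous (is_diffE dl).1.
have ev : \forall t \near (0 : R^o), cdom c1 (gam t).
  have [r r0 h] := gam_lg ltr01.
  apply/nbhs_ballP; exists r => //= t; rewrite -ball_normE /= sub0r normrN => tr.
  by case: (h t tr).
split=> //; split.
  rewrite gam0; apply: lg_inj_cvg => //.
  have := cl; rewrite /prop_for /continuous_at gam0 lg1; exact.
rewrite gam0.
have := is_diffD dl (is_diff_const e0 (0 : R^o)).
have -> : ((fun t : R^o => lg (gam t)) + (fun _ : R^o => e0)) = (fun y : R^o => cmap c1 (gam y)).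
  by apply/funext => t; rewrite fctE /lg subrK.
by apply: is_diff_ext => t; rewrite fctE addr0.
Qed.

End Limit.

End OneParameter.

Section Exponential.
Context {R : realType} {d : nat} {G : lieGroupType R d}.
Implicit Types (g h k : G) (u : 'rV[R]_d).

Local Notation c1 := (chart_at (1%g : G)).
Local Notation e0 := (cmap c1 (1%g : G)).

Lemma truncn_add (x y : R) : 0 <= x -> 0 <= y ->
  (Num.truncn (x + y) = Num.truncn x + Num.truncn y)%N \/
  (Num.truncn (x + y) = (Num.truncn x + Num.truncn y).+1)%N.
Proof.
move=> x0 y0; have xy0 := addr_ge0 x0 y0.
have /andP[x1 x2] := truncn_itv x0; have /andP[y1 y2] := truncn_itv y0.
have /andP[z1 z2] := truncn_itv xy0.
have h1 : (Num.truncn x + Num.truncn y < (Num.truncn (x + y)).+1)%N.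
  by rewrite -(ltr_nat R) natrD; apply: le_lt_trans z2; rewrite lerD.
have h2 : (Num.truncn (x + y) < (Num.truncn x + Num.truncn y).+2)%N.
  rewrite -(ltr_nat R); apply: le_lt_trans z1 _.
  by rewrite -addn2 natrD natrD; move: x2 y2; rewrite -!natr1; lra.
rewrite ltnS leq_eqVlt ltnS in h2; case/orP: h2 => [/eqP|h2]; first by right.
by left; apply/eqP; rewrite eqn_leq h2.
Qed.

Lemma onep_exists u : exists gamma : R -> G, onep gamma u.
Proof.
have [D [UD FD]] := @ultraFilterLemma nat \oo _.
pose g i : G := cinv c1 (e0 + i.+1%:R^-1 *: u).
have hlim : e0 + i.+1%:R^-1 *: u @[i --> \oo] --> e0.
  rewrite -[X in _ --> X]addr0; apply: cvgD; first exact: cvg_cst.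
  rewrite -[X in _ --> X](scale0r u); apply: cvgZr_tmp.
  exact: cvg_harmonic.
have gd : \forall i \near D, cdom c1 (g i) /\ lg (g i) = i.+1%:R^-1 *: u.
  have ci : \forall i \near \oo, cimg c1 (e0 + i.+1%:R^-1 *: u).
    exact: hlim (cimg_nbhs cdom1).
  apply: FD; near=> i; have cj : cimg c1 (e0 + i.+1%:R^-1 *: u) by near: i.
  rewrite /g /lg; split; first exact: cinv_cdom cj.
  by rewrite cinvK // addrAC subrr add0r.
have gl : g i @[i --> D] --> (1%g : G).
  have : g i @[i --> \oo] --> (1%g : G) by exact: cvg_comp hlim (cinv_cvg cdom1).
  by apply: cvg_trans => A /= ?; exact: FD.
(* About [t * i.+1] steps of size [1 / i.+1] in the direction [u]. Truncation makes this additive up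
   to at most one extra factor [g i], which tends to 1. *)
pose c i (t : R) := (g i ^+ Num.truncn (t * i.+1%:R))%g.
have [|e e_gt0|gamma hg _] := @limit_onep R d G nat D UD c u; last by exists gamma.
- move=> s t s0 t0 A A1.
  have A2 : \forall i \near D, A (g i)^-1%g.
    by have := invg_cvg gl; rewrite invg1; apply.
  apply: filterS A2 => i Ai; rewrite /= /c mulrDl.
  have [||->|->] := @truncn_add (s * i.+1%:R) (t * i.+1%:R); rewrite ?mulr_ge0 //.
    by rewrite expgnDr mulVg; exact: nbhs_singleton.
  by rewrite expgSr expgnDr invgM -mulgA mulVg mulg1.
pose N := `|u| + 1.
have N0 : 0 < N by rewrite /N; have := normr_ge0 u; lra.
have e2 : 0 < e / 2 / N by rewrite !divr_gt0.
have [r r0 rb] := @expg_strict R d G _ e2.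
exists (r / N); first by rewrite divr_gt0.
move=> t /andP[t0 tr].
have [->|tn0] := eqVneq t 0.
  apply: filterE => i; rewrite /c mul0r truncn0 expg0 lg1 scale0r subrr normr0 mulr0.
  by split=> //; exact: cdom1.
have tp : 0 < t by rewrite lt_def tn0.
have et : 0 < e * t / 2 / N by rewrite !divr_gt0 // mulr_gt0.
have small : \forall i \near D, i.+1%:R^-1 < e * t / 2 / N.
  exact: FD (near_infty_natSinv_lt (PosNum et)).
apply: filterS2 gd small => i [di li] si.
have i0 : 0 < i.+1%:R :> R by rewrite ltr0n.
have ti0 : 0 <= t * i.+1%:R by rewrite mulr_ge0.
have /andP[n1 n2] := truncn_itv ti0.
set n := Num.truncn _ in n1 n2.
have nl : n%:R * `|lg (g i)| <= t * `|u|.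
  rewrite li normrZ gtr0_norm ?invr_gt0 // mulrA ler_wpM2r //.
  by rewrite ler_pdivrMr.
have uN : `|u| <= N by rewrite /N lerDl.
have [|D1 E1] := rb (g i) n di.
  apply: le_lt_trans nl _; apply: le_lt_trans (ler_wpM2l t0 uN) _.
  by rewrite -ltr_pdivlMr.
rewrite /c -/n; split=> //.
have -> : lg (g i ^+ n)%g - t *: u = (lg (g i ^+ n)%g - n%:R *: lg (g i)) +
   (n%:R / i.+1%:R - t) *: u.
  by rewrite li scalerA scalerBl addrA subrK.
apply: le_trans (ler_normD _ _) _.
have b1 : e / 2 / N * (n%:R * `|lg (g i)|) <= e * t / 2.
  apply: le_trans (ler_wpM2l (ltW e2) (le_trans nl (ler_wpM2l t0 uN))) _.
  by rewrite (_ : e / 2 / N * (t * N) = e * t / 2) //; field; rewrite gt_eqF.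
have b2 : `|(n%:R / i.+1%:R - t) *: u| <= e * t / 2.
  rewrite normrZ; apply: le_trans (_ : e * t / 2 / N * N <= _); last by rewrite divfK // gt_eqF.
  apply: ler_pM => //; apply: le_trans (ltW si).
  have -> : n%:R / i.+1%:R - t = (n%:R - t * i.+1%:R) * i.+1%:R^-1.
    by rewrite mulrBl mulfK // gt_eqF.
  rewrite normrM [X in _ * X]gtr0_norm ?invr_gt0 // ler_piMl ?invr_ge0 //.
  rewrite distrC ger0_norm ?subr_ge0 // lerBlDr addrC natr1; exact: ltW.
by apply: le_trans (lerD (le_trans E1 b1) b2) _; rewrite -splitr.
Unshelve. all: by end_near. Qed.

Definition expG u : G := projT1 (cid (onep_exists u)) 1.

Lemma onep_scale gamma u (a : R) : onep gamma u ->
  onep (fun t => gamma (a * t)) (a *: u : 'rV[R]_d) (G := G).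
Proof.
move=> [h1 h2]; split; first by move=> s t; rewrite mulrDr h1.
have hd : is_diff (0 : R^o) (fun s : R^o => a * s) (fun s => a * s).
  exact: is_diffZ (is_diff_ident (0 : R^o)).
have := vdiff_pre hd (f := gamma : R^o -> G) (df := fun s => s *: u).
rewrite mulr0 => /(_ h2); apply: vdiff_ext => s.
by rewrite !scalerA mulrC.
Qed.

Lemma onepE gamma u t : onep gamma u -> gamma t = expG (t *: u).
Proof.
move=> h; rewrite /expG; case: cid => gamma' h' /=.
have := onep_uniq (onep_scale t h) h' => /(congr1 (fun f => f 1)).
by rewrite mulr1.
Qed.

Lemma onep_exp u : onep (fun t => expG (t *: u)) u.
Proof.
have [gamma h] := onep_exists u.
by have -> : (fun t => expG (t *: u)) = gamma by apply/funext => t; rewrite -(onepE t h).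
Qed.

Lemma expGD s t u : expG ((s + t) *: u) = (expG (s *: u) * expG (t *: u))%g.
Proof. by have [h _] := onep_exp u; rewrite h. Qed.

Lemma expG0 : expG 0 = 1%g.
Proof. by have := onep0 (onep_exp 0); rewrite scaler0. Qed.

Lemma expGN u : expG (- u) = (expG u)^-1%g.
Proof. by have := onepN 1 (onep_exp u); rewrite scaleN1r scale1r. Qed.

Lemma expGn n u : expG (n%:R *: u) = (expG u ^+ n)%g.
Proof.
elim: n => [|n IH]; first by rewrite scale0r expG0.
by rewrite -natr1 expGD IH scale1r expgSr.
Qed.

Lemma vdiff_expZ u t : vdiff (fun s : R^o => expG (s *: u)) t
  (fun s => s *: @left_field R d G u (expG (t *: u))).
Proof. exact: onep_vdiff (onep_exp u). Qed.

Lemma expG_conj g u : (g * expG u * g^-1)%g = expG (Ad g u).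
Proof.
rewrite -{1}[u]scale1r -[Ad g u]scale1r.
have h : onep (fun t => g * expG (t *: u) * g^-1)%g (Ad g u).
  have [h1 h2] := onep_exp u; split.
    by move=> s t; rewrite h1 !mulgA mulgVK.
  have e01 : expG ((0 : R) *: u) = 1%g by rewrite scale0r expG0.
  have hc : mdiff (fun k : G => (g * k * g^-1)%g) (expG ((0 : R) *: u)) (Ad g).
    by rewrite e01; exact: Ad_mdiff.
  have := vdiff_comp h2 hc; apply: vdiff_ext => s.
  exact: tangentZ.
exact: onepE h.
Qed.

(** The point is uniformity in the direction of [u]. [expG u] is the [n]-th power of the exponential
    of [u / n]; for [n] large depending on [u] the latter has [lg] close to [u / n], while the error
    made by taking the power is bounded in [expg_strict] independently of [n] and of the
    direction. *)
Lemma expG_lg (e : R) : 0 < e -> exists2 r : R, 0 < r &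
  forall u, `|u| < r -> cdom c1 (expG u) /\ `|lg (expG u) - u| <= e * `|u|.
Proof.
move=> e_gt0; have [r r0 rb] := @expg_strict R d G _ e_gt0.
exists r => // u ur.
have [_ h2] := onep_exp u; have [hc hd] := h2.
have e01 : expG ((0 : R) *: u) = 1%g by rewrite scale0r expG0.
rewrite e01 in hc hd.
have H (eta : R) : 0 < eta -> exists n : nat,
    cdom c1 (expG (n.+1%:R^-1 *: u)) /\ `|n.+1%:R *: lg (expG (n.+1%:R^-1 *: u)) - u| <= eta.
  move=> eta0.
  have [rho rho0 hrho] := is_diff_eps hd eta0.
  have /nbhs_ballP [rho' /= rho'0 hrho'] : \forall t \near (0 : R^o), cdom c1 (expG (t *: u)).
    exact: hc (chart_nbhs _).
  have m0 : 0 < Order.min rho rho' by rewrite lt_min rho0.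
  have [n _ hn] := near_infty_natSinv_lt (PosNum m0).
  exists n; have /= := hn n (leqnn n); rewrite lt_min => /andP[n1 n2].
  have i0 : 0 < n.+1%:R^-1 :> R by rewrite invr_gt0 ltr0n.
  split; first by apply: hrho'; rewrite -ball_normE /= sub0r normrN gtr0_norm.
  have := hrho n.+1%:R^-1; rewrite gtr0_norm // => /(_ n1).
  rewrite add0r scale0r expG0 -/(lg _) => E.
  have -> : n.+1%:R *: lg (expG (n.+1%:R^-1 *: u)) - u =
    n.+1%:R *: (lg (expG (n.+1%:R^-1 *: u)) - n.+1%:R^-1 *: u).
    by rewrite [RHS]scalerBr scalerA mulfV ?scale1r // pnatr_eq0.
  rewrite normrZ normr_nat -ler_pdivlMl ?ltr0n //.
  by rewrite mulrC.
have K n : cdom c1 (expG (n.+1%:R^-1 *: u)) ->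
    n.+1%:R * `|lg (expG (n.+1%:R^-1 *: u))| < r ->
    cdom c1 (expG u) /\ `|lg (expG u) - n.+1%:R *: lg (expG (n.+1%:R^-1 *: u))|
       <= e * (n.+1%:R * `|lg (expG (n.+1%:R^-1 *: u))|).
  move=> dn hn; have := rb _ _ dn hn.
  by rewrite -expGn scalerA mulfV ?scale1r // pnatr_eq0.
have K' (eta : R) : 0 < eta -> eta < r - `|u| ->
   cdom c1 (expG u) /\ `|lg (expG u) - u| <= e * (`|u| + eta) + eta.
  move=> eta0 etar; have [n [dn hn]] := H _ eta0.
  have nb : n.+1%:R * `|lg (expG (n.+1%:R^-1 *: u))| <= `|u| + eta.
    rewrite -{1}(normr_nat R n.+1) -normrZ -[_ *: _](subrK u) addrC.
    by apply: le_trans (ler_normD _ _) _; rewrite lerD2l.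
  have [|D E] := K n dn; first by apply: le_lt_trans nb _; lra.
  split=> //; rewrite -(subrK (n.+1%:R *: lg (expG (n.+1%:R^-1 *: u))) (lg _)) -addrA.
  apply: le_trans (ler_normD _ _) _; apply: lerD => //.
  by apply: le_trans E _; rewrite ler_wpM2l // ltW.
have ru : 0 < r - `|u| by rewrite subr_gt0.
split.
  have [||//] := K' ((r - `|u|) / 2); first by rewrite divr_gt0.
  by rewrite ltr_pdivrMr // ltr_pMr // ltr1n.
apply/ler_addgt0Pr => eta eta0.
(* Keeps [|u| + eta'] below [r] and makes the surplus [(1 + e) * eta'] at most [eta]. *)
pose eta' := Order.min ((r - `|u|) / 2) (eta / (1 + e)).
have e1 : 0 < 1 + e by lra.
have p1 : 0 < (r - `|u|) / 2 by rewrite divr_gt0.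
have p2 : 0 < eta / (1 + e) by rewrite divr_gt0.
have [||_ h] := K' eta'; first by rewrite lt_min p1.
  by rewrite gt_min; apply/orP; left; rewrite ltr_pdivrMr // ltr_pMr // ltr1n.
apply: le_trans h _; rewrite mulrDr -addrA lerD2l.
have -> : e * eta' + eta' = eta' * (1 + e) by ring.
by rewrite -ler_pdivlMr // ge_min lexx orbT.
Qed.

(** Along an ultrafilter tending to [u], the curves [expG (t *: v)] converge to a one-parameter
    subgroup with velocity [u], and uniqueness identifies it. *)
Lemma expG_cvg u : expG v @[v --> u] --> expG u.
Proof.
apply: (@cvg_ultra _ _ (nbhs u) (nbhs_pfilter u)) => D UD FD.
have [|e e_gt0|gamma hg lim] := @limit_onep R d G 'rV[R]_d D UD
  (fun (v : 'rV[R]_d) t => expG (t *: v)) u.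
- move=> s t _ _.
  rewrite (_ : (fun v => _) = fun _ => 1%g); first exact: cvg_cst.
  by apply/funext => v; rewrite expGD mulVg.
- pose N := `|u| + 1.
  have N0 : 0 < N by rewrite /N; have := normr_ge0 u; lra.
  have e2 : 0 < e / 2 / N by rewrite !divr_gt0.
  have [r r0 rb] := expG_lg e2.
  exists (r / N); first by rewrite divr_gt0.
  move=> t /andP[t0 tr].
  have near1 : \forall v \near D, `|u - v| < Order.min 1 (e / 2).
    apply: FD; apply/nbhs_ballP; exists (Order.min 1 (e / 2)) => /=.
      by rewrite lt_min ltr01 divr_gt0.
    by move=> v; rewrite -ball_normE.
  apply: filterS near1 => v; rewrite lt_min => /andP[v1 v2].
  have vN : `|v| <= N.
    rewrite /N -(subrK u v) addrC; apply: le_trans (ler_normD _ _) _.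
    by rewrite lerD2l distrC ltW.
  have [|D1 E1] := rb (t *: v).
    rewrite normrZ ger0_norm //; apply: le_lt_trans (ler_wpM2l t0 vN) _.
    by rewrite -ltr_pdivlMr.
  split=> //.
  have -> : lg (expG (t *: v)) - t *: u = (lg (expG (t *: v)) - t *: v) + t *: (v - u).
    by rewrite scalerBr addrA subrK.
  apply: le_trans (ler_normD _ _) _; rewrite [e](splitr e) mulrDl.
  apply: lerD.
    apply: le_trans E1 _; rewrite normrZ ger0_norm //.
    apply: le_trans (ler_wpM2l (ltW e2) (ler_wpM2l t0 vN)) _.
    by rewrite mulrCA divfK ?gt_eqF // mulrC.
  by rewrite normrZ ger0_norm // mulrC ler_wpM2r // distrC ltW.
have := lim 1 ler01; rewrite (onepE 1 hg) scale1r.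
by rewrite (_ : (fun v => expG (1 *: v)) = expG) //; apply/funext => v; rewrite scale1r.
Qed.

End Exponential.

(** * The adjoint representation *)

Section Adjoint.
Context {R : realType} {d : nat} {G : lieGroupType R d}.
Implicit Types (g h k : G) (u : 'rV[R]_d).

Local Notation c1 := (chart_at (1%g : G)).
Local Notation e0 := (cmap c1 (1%g : G)).

Lemma expZ0 u : @expG R d G ((0 : R) *: u) = 1%g.
Proof. by rewrite scale0r expG0. Qed.

(** In a chart the curve satisfies [y' = 'd Phi (y, e0) (0, u)], where [Phi] reads the
    multiplication. The right-hand side is smooth in [y], so each order of regularity gives the
    next. *)
Lemma smooth_curve_exp u : smooth_curve (fun t => @expG R d G (t *: u)).
Proof.
pose gamma (t : R) : G := expG (t *: u).
have gc : continuous (gamma : R -> G) by move=> t; exact: (vdiff_expZ u t).1.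
split=> // x.
pose T : set R^o := gamma @^-1` cdom (chart_at x).
pose y (t : R^o) := cmap (chart_at x) (gamma t).
have oT : open T by have /continuousP := gc; apply; exact: open_cdom.
pose Phi := read2 (fun g h : G => (g * h)%g) x 1%g x.
have sPhi : smooth_on (dom2 (fun g h : G => (g * h)%g) x 1%g x) Phi.
  exact: (read2_smooth (smooth_mulg (s := G))).
have yD t : T t -> dom2 (fun g h : G => (g * h)%g) x 1%g x (y t, e0).
  by move=> Tt; apply: dom2_point => //; [exact: cdom1|rewrite mulg1].
have dy t : T t -> is_diff t y (fun v => v *: 'd Phi (y t, e0) (0, u)).
  move=> Tt.
  have [hc hd] := (onep_exp (G := G) u).2; rewrite expZ0 in hc hd.
  have sh := @is_diff_shift _ R^o t t.
  have hd' : is_diff (t - t : R^o) (fun s : R^o => cmap c1 (expG (s *: u))) (fun s => s *: u).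
    by rewrite subrr.
  have h1 := is_diff_compose sh hd'.
  have h2 := is_diff_pair (is_diff_const (y t) (t : R^o)) h1.
  have h3 : is_diff (y t, cmap c1 (expG ((t - t) *: u))) Phi ('d Phi (y t, e0)).
    by rewrite subrr expZ0; apply: is_diff_self; apply: smooth_on_diff sPhi (yD t Tt).
  have h4 := is_diff_compose h2 h3.
  have h5 : is_diff (t : R^o) y (fun v : R^o => 'd Phi (y t, e0) (0, v *: u)).
    apply: is_diff_near h4.
    have hc' : expG ((s - t) *: u) @[s --> t] --> (1%g : G).
      have sc : s - t @[s --> t] --> (0 : R).
        by rewrite -(subrr t); apply: cvgB; [exact: cvg_id|exact: cvg_cst].
      exact: (cvg_comp _ _ sc hc).
    have ev : \forall s \near t, cdom c1 (@expG R d G ((s - t) *: u)) by exact: hc' (chart_nbhs _).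
    apply: filterS ev => s ds; rewrite /Phi /read2 /= !cmapK //.
    by rewrite /y /gamma -expGD addrC subrK.
  apply: is_diff_ext h5 => v.
  have -> : ((0, v *: u) : 'rV[R]_d * 'rV[R]_d) = v *: (0, u).
    by apply: injective_projections; rewrite /= ?scaler0.
  exact: (linearZ_LR ('d Phi (y t, e0))).
suff H i : Ck i T y by move=> i; exact: H.
elim: i => [|i IH].
  by move=> t Tt; apply: differentiable_continuous; case: (dy t Tt).
split=> [t Tt|v]; first by case: (dy t Tt).
have cst_v : Ck i T (fun _ : R^o => v : R^o) by exact: Ck_cst.
have h := Ck_scale oT cst_v (Ck_comp_curve oT (smooth_on_dir (0, u) sPhi) IH yD).
by apply: Ck_eq oT _ h => t Tt; case/is_diffE: (dy t Tt) => _ ->.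
Qed.

Lemma lie_subgroupE (H : set G) u :
  lie_subgroup H u <-> forall t : R, H (expG (t *: u)).
Proof.
split=> [[gamma [[gc gs] gm gH gu]] t|h]; last first.
  exists (fun t => expG (t *: u)); split=> //.
  - exact: smooth_curve_exp.
  - by move=> s t; rewrite expGD.
  - have [_ hd] := (onep_exp (G := G) u).2; rewrite expZ0 in hd.
    by case/is_diffE: hd => _; rewrite /comp /= => ->; rewrite scale1r.
have g0 : gamma 0 = 1%g.
  have := gm 0 0; rewrite addr0 => /(congr1 (fun x => (gamma 0)^-1 * x)%g).
  by rewrite mulVg mulKg.
suff hg : onep gamma u by rewrite -(onepE t hg); exact: gH.
split; first exact: gm.
split; first exact: gc.
rewrite g0.
have := smooth_on_diff (gs 1%g) _; rewrite /preimage /= => /(_ (0 : R^o)).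
rewrite g0 => /(_ cdom1) hd.
apply: is_diff_ext (is_diff_self hd) => s.
rewrite -gu -[s in LHS]mulr1; exact: (linearZ_LR ('d (cmap c1 \o gamma : R^o -> _) 0) s (1 : R^o)).
Qed.

Local Notation mulf := (fun g h : G => (g * h)%g).
Local Notation mu := (read2 mulf 1%g 1%g 1%g).
Local Notation Om := (dom2 mulf 1%g 1%g 1%g).

Let smu : smooth_on Om mu.
Proof. exact: (read2_smooth (smooth_mulg (s := G))). Qed.

Let dmu q : Om q -> is_diff q mu ('d mu q).
Proof. by move=> h; apply: is_diff_self; exact: smooth_on_diff smu h. Qed.

Let D2 (b : 'rV[R]_d * 'rV[R]_d) : 'rV[R]_d * 'rV[R]_d -> 'rV[R]_d :=
  'd (fun q => 'd mu q b) (e0, e0).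

Let Om0 : Om (e0, e0).
Proof. by apply: dom2_point; rewrite ?mulg1; exact: cdom1. Qed.

Let dD2 b : is_diff (e0, e0) (fun q => 'd mu q b) (D2 b).
Proof.
by apply: is_diff_self; exact: smooth_on_diff (smooth_on_dir b smu) Om0.
Qed.

Let D2sym a b : D2 a b = D2 b a.
Proof.
apply: schwarz.
- by apply: filterS dom2_nbhs1 => q Dq; case: (dmu Dq).
- by case: (dD2 a).
- by case: (dD2 b).
Qed.

Let D2D b a a' : D2 b (a + a') = D2 b a + D2 b a'.
Proof. exact: linearD. Qed.

Let D2N b a : D2 b (- a) = - D2 b a.
Proof. exact: linearN. Qed.

Let Om_l g : cdom c1 g -> Om (cmap c1 g, e0).
Proof. by move=> dg; apply: dom2_point; rewrite ?mulg1 //; exact: cdom1. Qed.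

Let dmu0 u v : 'd mu (e0, e0) (u, v) = u + v.
Proof.
have := smooth2_diff (smooth_mulg (s := G)) 1%g 1%g.
by rewrite mulg1 => /is_diffE[_ ->] /=; rewrite tangent_mul1g tangent_mulg1.
Qed.

Let dmu_left g v : cdom c1 g -> 'd mu (cmap c1 g, e0) (v, 0) = v.
Proof.
move=> dg.
have h1 := is_diff_pair (is_diff_ident (cmap c1 g)) (is_diff_const e0 (cmap c1 g)).
have h2 := is_diff_compose h1 (dmu (Om_l dg)).
have h3 : is_diff (cmap c1 g) (fun y => mu (y, e0)) (fun v => v).
  apply: is_diff_near (is_diff_ident (cmap c1 g)).
  apply: filterS (cimg_nbhs dg) => y cy.
  by rewrite /read2 /= [cinv c1 e0]cmapK ?mulg1 ?cinvK //; exact: cdom1.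
by have := is_diff_uniq h2 h3 => /(congr1 (fun f => f v)).
Qed.

(** Multiplication by 1 on the right is the identity, so [mu] has no pure second derivative in its
    first variable. *)
Let D2_left v w : D2 (v, 0) (w, 0) = 0.
Proof.
have h1 := is_diff_pair (is_diff_ident e0) (is_diff_const e0 e0).
have h2 := is_diff_compose h1 (dD2 (v, 0)).
have h3 : is_diff e0 (fun y => 'd mu (y, e0) (v, 0)) (fun _ => 0).
  apply: is_diff_near (is_diff_const v e0).
  by apply: filterS (cimg_nbhs cdom1) => y [g dg <-]; rewrite dmu_left.
by have := is_diff_uniq h2 h3 => /(congr1 (fun f => f w)).
Qed.

Let left_read v y : cimg c1 y ->
  vf_read c1 (@left_field R d G v) y = 'd mu (y, e0) (0, v).
Proof.
move=> [g dg <-]; rewrite /vf_read (cmapK dg).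
have hf : vdiff (fun z => g * cinv c1 z)%g e0 (tangent (fun h : G => (g * h)%g) 1%g).
  exact: mdiff_vdiff (mulg_mdiffr g 1%g).
have fd : cdom c1 (g * cinv c1 e0)%g by rewrite cmapK ?mulg1 //; exact: cdom1.
have h1 := vdiff_chart hf fd.
have h2 := is_diff_pair (is_diff_const (cmap c1 g) e0) (is_diff_ident e0).
have h3 := is_diff_compose h2 (dmu (Om_l dg)).
have h4 : is_diff e0 (fun z => mu (cmap c1 g, z))
    (fun w => to_coord c1 (g * cinv c1 e0)%g (tangent (fun h : G => (g * h)%g) 1%g w)).
  by move: h1; rewrite /read2 /= (cmapK dg).
have := is_diff_uniq h3 h4 => /(congr1 (fun f => f v)) ->.
by rewrite (cmapK cdom1) mulg1.
Qed.

Lemma left_field1 u : @left_field R d G u 1%g = u.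
Proof. by rewrite /left_field tangent_mul1g. Qed.

(** By [left_read], left-invariant fields are partial derivatives of [mu], so the bracket is the
    antisymmetrized mixed second derivative of the multiplication. *)
Let bracketE w v : @lie_bracket R d G w v = D2 (0, v) (w, 0) - D2 (0, w) (v, 0).
Proof.
rewrite /lie_bracket /vf_bracket !left_field1.
have h x : is_diff e0 (vf_read c1 (@left_field R d G x)) (fun w => D2 (0, x) (w, 0)).
  have h1 := is_diff_pair (is_diff_ident e0) (is_diff_const e0 e0).
  have h2 := is_diff_compose h1 (dD2 (0, x)).
  apply: is_diff_near h2.
  by apply: filterS (cimg_nbhs cdom1) => y cy; exact: (esym (left_read x cy)).
have E x y := congr1 (fun f => f y) (is_diffE (h x)).2.
exact: (congr2 (fun a b => a - b) (E v w) (E w v)).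
Qed.

Let iota y := cmap c1 ((cinv c1 y)^-1)%g.

(** Conjugation is left multiplication by [g] followed by right multiplication by its inverse. The
    outer differential is expanded on the basis so that its base point can be differentiated in
    [Ad_diff]. *)
Let Ad_chart g v : cdom c1 g -> cdom c1 (g^-1)%g ->
  Ad g v = \sum_(j < d) ('d mu (cmap c1 g, e0) (0, v)) 0 j *:
     'd mu (cmap c1 g, iota (cmap c1 g)) (delta_mx 0 j, 0).
Proof.
move=> dg dg'; rewrite -(linear_pair_sum ('d mu (cmap c1 g, iota (cmap c1 g)))).
have iE : iota (cmap c1 g) = cmap c1 (g^-1)%g by rewrite /iota cmapK.
rewrite iE.
have O2 : Om (cmap c1 g, cmap c1 (g^-1)%g).
  by apply: dom2_point; rewrite ?mulgV //; exact: cdom1.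
have h1 := is_diff_compose (is_diff_pair (is_diff_const (cmap c1 g) e0) (is_diff_ident e0))
  (dmu (Om_l dg)).
have m0 : mu (cmap c1 g, e0) = cmap c1 g.
  by rewrite /read2 /= !cmapK ?mulg1 //; exact: cdom1.
have h2 := is_diff_pair h1 (is_diff_const (cmap c1 (g^-1)%g) e0).
have h3 : is_diff (mu (cmap c1 g, e0), cmap c1 (g^-1)%g) mu ('d mu (cmap c1 g, cmap c1 (g^-1)%g)).
  by rewrite m0; exact: dmu.
have h4 := is_diff_compose h2 h3.
have [_ h5] := Ad_mdiff g.
rewrite /= mulg1 mulgV in h5.
have h6 : is_diff e0 (read c1 c1 (fun k : G => (g * k * g^-1)%g))
    (fun w => 'd mu (cmap c1 g, cmap c1 (g^-1)%g) ('d mu (cmap c1 g, e0) (0, w), 0)).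
  apply: is_diff_near h4.
  have ev : \forall z \near e0, cdom c1 (g * cinv c1 z)%g.
    have h : (g * cinv c1 z)%g @[z --> e0] --> g.
      have : (g * cinv c1 z)%g @[z --> e0] --> (g * 1)%g.
        by exact: mulg_cvg (cvg_cst g) (cinv_cvg cdom1).
      by rewrite mulg1.
    by apply: h; exact: cdom_nbhs.
  apply: filterS ev => z dz; rewrite /read /read2 /= [cinv c1 (cmap c1 g)]cmapK //.
  by rewrite [cinv c1 (cmap c1 (g^-1)%g)]cmapK // [cinv c1 (cmap c1 (g * _)%g)]cmapK.
exact: (congr1 (fun f => f v) (is_diff_uniq h5 h6)).
Qed.

(** Two terms arise. Varying the left multiplication gives [D2 (0, v) (w, 0)]; varying the right one
    gives [D2 (v, 0) (w, - w)], which is [- D2 (0, w) (v, 0)] by [D2_left] and symmetry. Their sum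
    is the bracket by [bracketE]. *)
Lemma Ad_diff v : is_diff e0 (fun y => Ad (cinv c1 y) v) (fun w => @lie_bracket R d G w v).
Proof.
have hi : is_diff e0 iota (fun w => - w).
  have [_ h] := @inv_mdiff _ _ G 1%g; rewrite invg1 in h.
  by apply: is_diff_ext h => w; rewrite tangent_inv1.
have i0 : iota e0 = e0 by rewrite /iota cmapK ?invg1 //; exact: cdom1.
have hk j : is_diff e0 (fun y => ('d mu (y, e0) (0, v)) 0 j : R^o) (fun w => D2 (0, v) (w, 0) 0 j).
  apply: is_diff_rV_coord.
  exact: is_diff_compose (is_diff_pair (is_diff_ident e0) (is_diff_const e0 e0)) (dD2 (0, v)).
have hf j : is_diff e0 (fun y => 'd mu (y, iota y) (delta_mx 0 j, 0))
    (fun w => D2 (delta_mx 0 j, 0) (w, - w)).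
  have h0 : is_diff (e0, iota e0) (fun q => 'd mu q (delta_mx 0 j, 0)) (D2 (delta_mx 0 j, 0)).
    by rewrite i0; exact: dD2.
  exact: is_diff_compose (is_diff_pair (is_diff_ident e0) hi) h0.
have hs := is_diff_sum (fun j => is_diff_scale (hk j) (hf j)).
have nr : \forall y \near e0, \sum_(j < d) ('d mu (y, e0) (0, v)) 0 j *:
     'd mu (y, iota y) (delta_mx 0 j, 0) = Ad (cinv c1 y) v.
  have ev : \forall y \near e0, cdom c1 (cinv c1 y)^-1%g.
    have h : (cinv c1 y)^-1%g @[y --> e0] --> (1%g : G).
      by rewrite -[X in _ --> X]invg1; apply: invg_cvg; exact: cinv_cvg cdom1.
    exact: h (chart_nbhs _).
  apply: filterS2 ev (cimg_nbhs cdom1) => y dy' cy.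
  by rewrite Ad_chart ?cinvK //; exact: cinv_cdom.
apply: is_diff_ext (is_diff_near nr hs) => w.
rewrite big_split /= bracketE; congr (_ + _).
  rewrite [RHS]row_deltaE; apply: eq_bigr => j _; congr (_ *: _).
  by rewrite i0 dmu0 addr0.
have lin : \sum_(j < d) v 0 j *: D2 (delta_mx 0 j, 0) (w, - w) = D2 (v, 0) (w, - w).
  have h1 : is_diff (e0, e0) (fun q => 'd mu q (v, 0)) (fun a => \sum_(j < d) v 0 j *: D2 (delta_mx 0 j, 0) a).
    have h2 : is_diff (e0, e0) (fun q => \sum_(j < d) v 0 j *: 'd mu q (delta_mx 0 j, 0))
      (fun a => \sum_(j < d) v 0 j *: D2 (delta_mx 0 j, 0) a).
      by apply: is_diff_sum => j; exact: is_diffZ (dD2 _).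
    rewrite (_ : (fun q => 'd mu q (v, 0)) = (fun q => \sum_(j < d) v 0 j *: 'd mu q (delta_mx 0 j, 0))) //.
    by apply/funext => q; exact: (linear_pair_sum ('d mu q)).
  by have := is_diff_uniq h1 (dD2 (v, 0)) => /(congr1 (fun f => f (w, - w))).
have -> : \sum_(i < d) ('d mu (e0, e0) (0, v)) 0 i *: D2 (delta_mx 0 i, 0) (w, - w) =
  \sum_(j < d) v 0 j *: D2 (delta_mx 0 j, 0) (w, - w).
  by apply: eq_bigr => j _; rewrite dmu0 add0r.
rewrite lin.
have -> : ((w, - w) : 'rV[R]_d * 'rV[R]_d) = (w, 0) + - (0, w).
  by apply: injective_projections; rewrite /= ?oppr0 ?addr0 ?add0r.
by rewrite D2D D2_left add0r D2N (D2sym (v, 0)).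
Qed.

Lemma Ad_cvg g v : Ad h v @[h --> g] --> Ad g v.
Proof.
have h1 : Ad h v @[h --> (1%g : G)] --> v.
  have := differentiable_continuous (is_diffE (Ad_diff v)).1.
  rewrite /prop_for /continuous_at cmapK ?Ad1; last exact: cdom1.
  move=> hc; have := cvg_comp _ _ (cmap_cvg cdom1) hc; apply: cvg_trans; apply: near_eq_cvg.
  by apply: filterS (chart_nbhs 1%g) => h dh /=; rewrite cmapK.
have h2 : (g^-1 * h)%g @[h --> g] --> (1%g : G).
  have : (g^-1 * h)%g @[h --> g] --> (g^-1 * g)%g.
    by exact: mulg_cvg (cvg_cst _) cvg_id.
  by rewrite mulVg.
have h3 := cvg_comp _ _ h2 h1.
have lc : {for v, continuous (Ad g)} by apply: linear_rV_continuous.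
have h4 : Ad g (Ad (g^-1 * h)%g v) @[h --> g] --> Ad g v by exact: cvg_comp h3 lc.
rewrite (_ : (fun h => Ad h v) = (fun h => Ad g (Ad (g^-1 * h)%g v))) //.
by apply/funext => h; rewrite -AdM mulVKg.
Qed.

Lemma Ad_exp_derive u v t :
  is_derive t (1 : R) (fun s : R => Ad (@expG R d G (s *: u)) v)
    (Ad (@expG R d G (t *: u)) (@lie_bracket R d G u v)).
Proof.
have d0 : is_diff (0 : R^o) (fun s : R^o => Ad (@expG R d G (s *: u)) v)
    (fun s => @lie_bracket R d G (s *: u) v).
  have [hc hd] := (onep_exp (G := G) u).2; rewrite expZ0 in hc hd.
  have A : is_diff (cmap c1 (expG ((0 : R) *: u))) (fun y => Ad (cinv c1 y) v) (fun w => @lie_bracket R d G w v).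
    by rewrite expZ0; exact: Ad_diff.
  apply: is_diff_near (is_diff_compose hd A).
  have ev : \forall s \near (0 : R^o), cdom c1 (@expG R d G (s *: u)) by exact: hc (chart_nbhs _).
  by apply: filterS ev => s ds; rewrite cmapK.
have d0' : is_diff (t - t : R^o) (fun s : R^o => Ad (@expG R d G (s *: u)) v)
    (fun s => @lie_bracket R d G (s *: u) v) by rewrite subrr.
have h1 := is_diff_compose (@is_diff_shift _ R^o t t) d0'.
have h2 := is_diff_compose h1 (is_diff_linear_rV _ (@Ad_linear R d G (@expG R d G (t *: u)))).
apply/is_derive_diffE.
have h3 : (fun s : R^o => Ad (@expG R d G (s *: u)) v) =
  (fun s : R^o => Ad (@expG R d G (t *: u)) (Ad (@expG R d G ((s - t) *: u)) v)).
  by apply/funext => s; rewrite -AdM -expGD addrC subrK.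
by rewrite h3; case/is_diffE: h2 => h4 h5; split=> //; rewrite h5 scale1r.
Qed.

Lemma rV_derive0_cst n (f : R -> 'rV[R]_n) :
  (forall t, is_derive t (1 : R) f 0) -> forall s t, f s = f t.
Proof.
move=> h s t; apply/rowP => i.
apply: (@is_derive_0_is_cst R (fun x => f x 0 i)) => x.
have /is_derive_diffE [h1 h2] := h x.
have := is_diff_rV_coord i (is_diff_self h1) => /is_diffE[h3 h4].
by apply/is_derive_diffE; split=> //; rewrite h4 h2 mxE.
Qed.

Lemma Ad_exp_fix u v : @lie_bracket R d G u v = 0 -> Ad (@expG R d G u) v = v.
Proof.
move=> h; have := @rV_derive0_cst d (fun s => Ad (@expG R d G (s *: u)) v).
move=> /(_ _ 1 0); rewrite scale1r expZ0 Ad1; apply => t.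
by have := Ad_exp_derive u v t; rewrite h linear0.
Qed.

End Adjoint.

(** * Brackets, commuting exponentials, and closed sets that can be moved in all directions *)

Section Spanning.
Context {R : realType} {d : nat} {G : lieGroupType R d}.
Implicit Types (g h k : G) (u : 'rV[R]_d).

Local Notation expG := (@expG R d G).
Local Notation br := (@lie_bracket R d G).

(** Derivative at 0 of the identity [Ad (expG (t *: Ad g u)) (Ad g v) = Ad g (Ad (expG (t *: u))
    v)]. *)
Lemma Ad_bracket g u v : Ad g (br u v) = br (Ad g u) (Ad g v).
Proof.
have h1 := Ad_exp_derive (G := G) (Ad g u) (Ad g v) 0.
rewrite expZ0 Ad1 in h1.
have /is_derive_diffE [h2 h2'] := Ad_exp_derive (G := G) u v 0.
have h3 := is_diff_compose (is_diff_self h2) (is_diff_linear_rV _ (@Ad_linear R d G g)).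
have E : (fun t : R => Ad (expG (t *: Ad g u)) (Ad g v)) =
   (fun t : R => Ad g (Ad (expG (t *: u)) v)).
  apply/funext => t; have -> : t *: Ad g u = Ad g (t *: u) by rewrite linearZ.
  by rewrite -expG_conj -AdM mulgVK AdM.
rewrite E in h1.
have /is_derive_diffE [h4 h4'] := h1.
have H := congr1 (fun f => f 1) (is_diff_uniq (is_diff_self h4) h3).
rewrite expZ0 Ad1 in h2'.
exact: etrans (etrans (congr1 (Ad g) (esym h2')) (esym H)) h4'.
Qed.

Lemma expG_commute u v : br u v = 0 -> (expG u * expG v = expG v * expG u)%g.
Proof.
move=> h; have := Ad_exp_fix h => /(congr1 expG).
rewrite -expG_conj => /(congr1 (fun x => x * expG u)%g).
by rewrite mulgVK.
Qed.

Lemma expG_add u v : (forall s t : R, br (s *: u) (t *: v) = 0) ->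
  (expG u * expG v)%g = expG (u + v).
Proof.
move=> h; have hc s t := expG_commute (h s t).
have hg : onep (fun t => expG (t *: u) * expG (t *: v))%g (u + v).
  split.
    move=> s t; rewrite !expGD !mulgA; congr (_ * _)%g.
    by rewrite -!mulgA; congr (_ * _)%g; rewrite hc.
  have := vdiff_mul1 (f := fun t : R^o => expG (t *: u)) (g := fun t : R^o => expG (t *: v))
    (x := 0) (expZ0 u) (expZ0 v) (onep_exp (G := G) u).2 (onep_exp (G := G) v).2.
  by apply: vdiff_ext => s; rewrite scalerDr.
by have := onepE 1 hg; rewrite !scale1r.
Qed.

Lemma left_field_onto g w : exists u, @left_field R d G u g = w.
Proof.
exists (tangent (fun h : G => (g^-1 * h)%g) g w).
have hl : mdiff (fun k : G => (g * k)%g) (g^-1 * g)%g (tangent (fun h : G => (g * h)%g) 1%g).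
  by rewrite mulVg; exact: mulg_mdiffr.
have h1 := mdiff_comp (mulg_mdiffr (g^-1)%g g) hl.
have h2 : mdiff (fun y : G => (g * (g^-1 * y))%g) g (fun v => v).
  by apply: mdiff_near (mdiff_id g) => y; rewrite mulVKg.
exact: (congr1 (fun f => f w) (mdiff_uniq h1 h2)).
Qed.

Lemma to_coord_onto m (M : manifoldType R m) (z p : M) w :
  cdom (chart_at z) p -> exists v, to_coord (chart_at z) p v = w.
Proof.
move=> zp; exists (of_coord (chart_at z) p w).
have h0 : is_diff (read (chart_at z) (chart_at p) id (cmap (chart_at z) p))
   (read (chart_at p) (chart_at z) id) (to_coord (chart_at z) p).
  by rewrite /read cmapK //; exact: to_coordP.
have h1 := is_diff_compose (of_coordP zp) h0.
have h2 : is_diff (cmap (chart_at z) p) (fun y => read (chart_at p) (chart_at z) id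
    (read (chart_at z) (chart_at p) id y)) (fun v => v).
  apply: is_diff_near (is_diff_ident _).
  have ev : \forall y \near cmap (chart_at z) p, cdom (chart_at p) (cinv (chart_at z) y).
    exact: (cinv_cvg zp) (chart_nbhs p).
  apply: filterS2 ev (cimg_nbhs zp) => y dy cy.
  by rewrite /read /= [cinv (chart_at p) _]cmapK // cinvK.
exact: (congr1 (fun f => f w) (is_diff_uniq h1 h2)).
Qed.

Lemma local_min_derive0 (f : R -> R) (a : R) :
  is_diff (0 : R^o) (f : R^o -> R^o) (fun s : R^o => s * a) ->
  (\forall t \near (0 : R), f 0 <= f t) -> a = 0.
Proof.
move=> hf /nbhs_ballP [r /= r0 rb].
apply/eqP; rewrite -normr_le0; apply/ler_addgt0Pr => e e0; rewrite add0r.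
have [r' r'0 h] := is_diff_eps hf e0.
pose m := Order.min r r' / 2.
have m0 : 0 < m by rewrite divr_gt0 // lt_min r0.
have mm : m < Order.min r r' by rewrite ltr_pdivrMr // ltr_pMr ?ltr1n // lt_min r0.
move: mm; rewrite lt_min => /andP[mr mr'].
have hr t : `|t| = m -> f 0 <= f t.
  by move=> tm; apply: rb; rewrite -ball_normE /= sub0r normrN tm.
have he t : `|t| = m -> `|f t - f 0 - t * a| <= e * m.
  by move=> tm; have := h t; rewrite add0r tm => /(_ mr').
have p1 : `|m| = m by exact: gtr0_norm.
have p2 : `|- m| = m by rewrite normrN.
have := hr _ p1; have := hr _ p2; have := he _ p1; have := he _ p2.
rewrite !ler_norml => /andP[h1 h2] /andP[h3 h4] h5 h6.
rewrite -(ler_pM2l m0); case: (lerP 0 a) => ha; nra.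
Qed.

Lemma is_diff_dist2 n (x y : 'rV[R]_n) :
  is_diff y (fun z : 'rV[R]_n => \sum_(i < n) (z 0 i - x 0 i) * (z 0 i - x 0 i) : R^o)
    (fun w => \sum_(i < n) (y 0 i - x 0 i) * w 0 i *+ 2).
Proof.
apply: is_diff_sum => i.
have h : is_diff y (fun z : 'rV[R]_n => z 0 i - x 0 i : R^o) (fun w => w 0 i).
  have := is_diffB (is_diff_rV_coord i (is_diff_ident y)) (is_diff_const (x 0 i : R^o) y).
  by apply: is_diff_ext => w; rewrite fctE subr0.
have := is_diff_scale h h; apply: is_diff_ext => w.
by rewrite mulr2n [w 0 i *: _]mulrC.
Qed.

(* A closed set that can be moved infinitesimally in a spanning set of
   directions at each of its points is open: at the point of the set nearest to
   a given point, the vector between the two is orthogonal to all velocities. *)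
Lemma exp_spanning_setT (S : set G) :
  connected [set: G] -> closed S -> S !=set0 ->
  (forall s, S s -> forall zeta : 'rV[R]_d -> R,
     (forall a u v, zeta (a *: u + v) = a * zeta u + zeta v) ->
     (forall u1 u2, (forall t : R, S (s * expG (t *: u1) * expG (t *: u2))%g) ->
        zeta (u1 + u2) = 0) ->
     forall w, zeta w = 0) ->
  S = setT.
Proof.
move=> cG cS S0 HS; apply: connected_clopen => //.
rewrite openE => s Ss; rewrite /interior.
pose c := chart_at s; pose p := cmap c s.
have ds : cdom c s by exact: chart_atP.
have /nbhs_ballP [r /= r0 rb] := cimg_nbhs ds.
pose r' := r / 2; have r'0 : 0 < r' by rewrite divr_gt0.
(* If all coordinates of [X - p] are below [eta], the squared Euclidean distance is at most
   [d * eta ^+ 2], hence at most [(r' / 2) ^+ 2]. The point of [K] nearest to [X] is then within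
   [r' / 2] of [X] and strictly inside the ball, so that short curves from it stay in the ball. *)
pose eta := r' / 2 / d.+1%:R.
have eta0 : 0 < eta by rewrite !divr_gt0 // ltr0n.
have Bi y : `|y - p| <= r' -> cimg c y.
  move=> yp; apply: rb; rewrite -ball_normE /= distrC; apply: le_lt_trans yp _.
  by rewrite ltr_pdivrMr // ltr_pMr // ltr1n.
have ev : \forall x \near s, `|cmap c x - p| < eta.
  have := cmap_cvg ds => /cvgrPdist_lt /(_ _ eta0).
  by apply: filterS => x; rewrite distrC.
apply: filterS2 ev (chart_nbhs s) => x xp dx.
pose X := cmap c x.
pose D2 (y : 'rV[R]_d) : R := \sum_(i < d) (y 0 i - X 0 i) * (y 0 i - X 0 i).
pose K : set 'rV[R]_d := [set y : 'rV[R]_d | `|y - p| <= r' /\ S (cinv c y)].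
have cB : compact (closed_ball p r').
  apply: bounded_closed_compact; last exact: closed_ball_closed.
  exists (`|p| + r'); split; first exact: num_real.
  move=> M hM y; rewrite closed_ballE //= => yB; apply: le_trans (ltW hM).
  rewrite -(subrK p y) addrC; apply: le_trans (ler_normD _ _) _.
  by rewrite lerD2l distrC.
have cK : compact K.
  rewrite compact_ultra => F UF FK.
  have FB : F (closed_ball p r').
    by apply: filterS FK => y [yp _]; rewrite closed_ballE //= /closed_ball_ /= distrC.
  rewrite compact_ultra in cB; have [y [By Uy]] := cB F UF FB.
  have yp : `|y - p| <= r' by move: By; rewrite closed_ballE //= /closed_ball_ /= distrC.
  exists y; split=> //; split=> //.
  have [q dq qy] := Bi y yp.
  apply: (@closed_cvg _ _ F _ (cinv c) S cS); first by apply: filterS FK => z [].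
  rewrite -qy cmapK //; rewrite -qy in Uy.
  exact: (cvg_comp (fun z => z) (cinv c) Uy (cinv_cvg dq)).
have Kp : K p by split; rewrite ?subrr ?normr0 ?ltW // /p cmapK.
have D2c : {within K, continuous D2}.
  apply: continuous_subspaceT => y.
  exact: (differentiable_continuous (is_diffE (is_diff_dist2 X y)).1).
have [y /set_mem [yp Sy] ymin] := compact_EVT_min (ex_intro _ p Kp) cK D2c.
have D2p : D2 p <= (r' / 2) ^+ 2.
  have pX i : `|p 0 i - X 0 i| <= eta.
    have := rV_coord_norm (X - p) i; rewrite !mxE distrC => /le_trans; apply.
    exact: ltW.
  apply: (@le_trans _ _ (\sum_(i < d) eta ^+ 2)).
    apply: ler_sum => i _; rewrite -expr2 -[leLHS]real_normK ?num_real //.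
    by apply: lerXn2r (pX i); rewrite nnegrE // ltW.
  have q0 : 0 <= r' / 2 by rewrite divr_ge0 // ltW.
  have -> : \sum_(i < d) eta ^+ 2 = (r' / 2) ^+ 2 * (d%:R / d.+1%:R ^+ 2).
    rewrite sumr_const card_ord -[LHS]mulr_natr /eta; field.
    by rewrite nat1r pnatr_eq0.
  rewrite ler_piMr ?exprn_ge0 //.
  rewrite ler_pdivrMr ?exprn_gt0 ?ltr0n // mul1r -natrX ler_nat.
  by rewrite expnS expn1 (leq_trans (leqnSn d)) // leq_pmulr.
have yX : `|y - X| <= r' / 2.
  have h0 : 0 <= r' / 2 by rewrite divr_ge0 // ltW.
  apply: rV_norm_le => // i; rewrite !mxE.
  rewrite -(@ler_pXn2r _ 2) // ?nnegrE // real_normK ?num_real //.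
  apply: le_trans (le_trans (ymin p (mem_set Kp)) D2p).
  rewrite /D2 (bigD1 i) //= expr2 lerDl sumr_ge0 // => j _.
  by rewrite -expr2 sqr_ge0.
have ypl : `|y - p| < r'.
  have -> : y - p = (y - X) + (X - p) by rewrite addrA subrK.
  apply: le_lt_trans (ler_normD _ _) _; rewrite [r']splitr ler_ltD //.
  apply: lt_le_trans xp _; rewrite /eta ler_pdivrMr ?ltr0n // ler_peMr ?ler1n //.
  by rewrite divr_ge0 // ltW.
have cy := Bi y yp.
pose e := cinv c y.
have de : cdom c e by exact: cinv_cdom.
have ey : cmap c e = y by exact: cinvK.
(* Derivative at [y] of the squared distance to [X] along the left-invariant field of [w]. *)
pose zeta w := \sum_(i < d) (y 0 i - X 0 i) * (to_coord c e (@left_field R d G w e)) 0 i *+ 2.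
have zl a u v : zeta (a *: u + v) = a * zeta u + zeta v.
  rewrite /zeta mulr_sumr -big_split; apply: eq_bigr => i _ /=.
  have -> : @left_field R d G (a *: u + v) e = a *: @left_field R d G u e + @left_field R d G v e.
    exact: tangent_linear.
  have -> : to_coord c e (a *: @left_field R d G u e + @left_field R d G v e) =
     a *: to_coord c e (@left_field R d G u e) + to_coord c e (@left_field R d G v e).
    exact: linearP.
  by rewrite !mxE; ring.
have zv u1 u2 : (forall t : R, S (e * expG (t *: u1) * expG (t *: u2))%g) -> zeta (u1 + u2) = 0.
  move=> hS.
  pose f (t : R^o) : G := (e * (expG (t *: u1) * expG (t *: u2)))%g.
  have f0 : f 0 = e by rewrite /f !expZ0 !mulg1.
  have hv := vdiff_mul1 (f := fun t : R^o => expG (t *: u1))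
    (g := fun t : R^o => expG (t *: u2)) (x := 0) (expZ0 u1) (expZ0 u2)
    (onep_exp (G := G) u1).2 (onep_exp (G := G) u2).2.
  have hm : mdiff (fun h : G => (e * h)%g) (expG ((0 : R) *: u1) * expG ((0 : R) *: u2))%g
     (tangent (fun h : G => (e * h)%g) 1%g).
    by rewrite !expZ0 mulg1; exact: mulg_mdiffr.
  have hf := vdiff_comp hv hm.
  have h1 := vdiff_chart (z := s) hf.
  rewrite !expZ0 !mulg1 in h1; have {}h1 := h1 de.
  have h1' : is_diff (0 : R^o) (fun t => cmap c (f t))
     (fun t => t *: to_coord c e (@left_field R d G (u1 + u2) e)).
    apply: is_diff_ext h1 => t; rewrite -scalerDr tangentZ.
    exact: (linearZ_LR ('d _ _)).
  have h2 : is_diff (cmap c (f 0)) (D2 : _ -> R^o) (fun w => \sum_(i < d) (y 0 i - X 0 i) * w 0 i *+ 2).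
    by rewrite f0 ey; exact: is_diff_dist2.
  have h3 := is_diff_compose h1' h2.
  apply: (@local_min_derive0 (fun t => D2 (cmap c (f t)))).
    apply: is_diff_ext h3 => t; rewrite /zeta mulr_sumr; apply: eq_bigr => i _.
    by rewrite !mxE; ring.
  have cf : cmap c (f t) @[t --> (0 : R)] --> y.
    have := differentiable_continuous (is_diffE h1').1.
    by rewrite /prop_for /continuous_at f0 ey.
  have e1 : \forall t \near (0 : R), `|cmap c (f t) - p| < r'.
    have eps0 : 0 < r' - `|y - p| by rewrite subr_gt0.
    have := cf => /cvgrPdist_lt /(_ _ eps0); apply: filterS => t ht.
    rewrite -(subrK y (cmap c (f t))) -addrA; apply: le_lt_trans (ler_normD _ _) _.
    by rewrite -ltrBrDr distrC.
  have e2 : \forall t \near (0 : R), cdom c (f t).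
    have := hf.1; rewrite !expZ0 !mulg1 => hc; exact: hc (cdom_nbhs de).
  apply: filterS2 e1 e2 => t h4 h5; rewrite f0 ey; apply: ymin; apply: mem_set.
  by split; [exact: ltW|rewrite cmapK // /f mulgA].
have z0 := HS e Sy zeta zl zv.
(* Left-invariant fields span the tangent space, so [zeta] can be evaluated on the vector [y - X]
   itself, where it is twice the squared distance. *)
have [v hv] := to_coord_onto (y - X) de.
have [w hw] := left_field_onto e v.
have := z0 w; rewrite /zeta hw hv => H.
have yXe : y = X.
  apply/rowP => i; apply/eqP; rewrite -subr_eq0 -sqrf_eq0; apply/eqP.
  have nn j : true -> 0 <= (y 0 j - X 0 j) * (y - X) 0 j *+ 2.
    by move=> _; rewrite !mxE -expr2 mulrn_wge0 // sqr_ge0.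
  have /eqP := psumr_eq0P nn H isT (i := i).
  by rewrite !mxE -expr2 mulrn_eq0 /= => /eqP.
by move: Sy; rewrite yXe /X cmapK.
Qed.

End Spanning.

(** * The form induced by an orbit *)

Section BilinearForms.
Context {R : realType}.

Definition bilinear_form (n : nat) (b : 'rV[R]_n -> 'rV[R]_n -> R) : Prop :=
  (forall a u v w, b (a *: u + v) w = a * b u w + b v w) /\
  (forall a u v w, b w (a *: u + v) = a * b w u + b w v).

Lemma is_diff_bilinear (V : normedModType R) n (b : 'rV[R]_n -> 'rV[R]_n -> R)
    (f g df dg : V -> 'rV[R]_n) (x : V) :
  bilinear_form b -> is_diff x f df -> is_diff x g dg ->
  is_diff x (fun y => b (f y) (g y) : R^o) (fun w => b (df w) (g x) + b (f x) (dg w)).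
Proof.
move=> [bl br] hf hg.
have bE u v : b u v = \sum_(j < n) u 0 j * b (delta_mx 0 j) v.
  have lin : linear (fun u => b u v : R^o) by move=> a s t; rewrite bl.
  pose dlM := GRing.isLinear.Build _ _ _ _ _ lin.
  pose dL : {linear 'rV[R]_n -> R^o} := HB.pack (fun u => b u v : R^o) dlM.
  rewrite -[LHS]/(dL u) {1}(row_deltaE u) linear_sum.
  by apply: eq_bigr => j _; exact: (linearZ_LR dL).
have h j : is_diff x (fun y => b (delta_mx 0 j) (g y) : R^o) (fun w => b (delta_mx 0 j) (dg w)).
  have lin : linear (fun v => b (delta_mx 0 j) v : R^o) by move=> a s t; rewrite br.
  exact: is_diff_compose hg (is_diff_linear_rV (g x) lin).
have H := is_diff_sum (fun j => is_diff_scale (is_diff_rV_coord j hf) (h j)).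
rewrite (_ : (fun y => b (f y) (g y)) = fun y => \sum_(j < n) f y 0 j * b (delta_mx 0 j) (g y)); last first.
  by apply/funext => y; exact: bE.
apply: is_diff_ext H => w; rewrite big_split /=.
by rewrite (bE (df w)) (bE (f x)).
Qed.

End BilinearForms.

Section Orbit.
Context {R : realType} {d m : nat} {G : lieGroupType R d} {M : manifoldType R m}.
Variables (act : G -> M -> M) (g : M -> 'M[R]_m).
Hypothesis (sact : smooth_action act) (Lg : lorentz_metric g)
  (Pg : forall a : G, preserves_metric g (act a)).
Variable (x : M).

Local Notation expG := (@expG R d G).
Local Notation br := (@lie_bracket R d G).
Local Notation H := (stabilizer act x).

Definition orb (u : 'rV[R]_d) : 'rV[R]_m := tangent (fun a : G => act a x) 1%g u.

Definition orbit_form (u v : 'rV[R]_d) : R := Defs.form (g x) (orb u) (orb v).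

Let s2 : smooth2 act. Proof. by case: sact. Qed.
Let act1 y : act 1%g y = y. Proof. by case: sact. Qed.
Let actM a b y : act (a * b)%g y = act a (act b y). Proof. by case: sact. Qed.

Lemma stabilizer_closed : closed H.
Proof.
have c1 : closed [set x].
  apply: accessible_closed_set1; apply: hausdorff_accessible.
  exact: manifold_hausdorff.
have oc : continuous (fun a : G => act a x).
  by move=> a; exact: (smooth2_cvgl s2).
exact: ((continuous_closedP (fun a : G => act a x)).1 oc _ c1).
Qed.

Let orb_mdiff : mdiff (fun a : G => act a x) 1%g orb.
Proof. exact: (smooth2_mdiffl s2). Qed.

Let act_mdiff a : mdiff (act a) x (tangent (act a) x).
Proof. exact: (smooth2_mdiffr s2). Qed.

Lemma orbD u v : orb (u + v) = orb u + orb v. Proof. exact: tangentD. Qed.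
Lemma orbZ a u : orb (a *: u) = a *: orb u. Proof. exact: tangentZ. Qed.

(** Since [a^-1] fixes [x], acting on [x] by [a * k * a^-1] is acting by [k] and then by [a]. *)
Lemma orb_Ad a u : H a -> orb (Ad a u) = tangent (act a) x (orb u).
Proof.
rewrite /stabilizer /= => ax.
have ax' : act (a^-1)%g x = x by rewrite -[in LHS]ax -actM mulVg act1.
have h0 : mdiff (fun a : G => act a x) (a * 1 * a^-1)%g orb by rewrite mulg1 mulgV.
have h1 := mdiff_comp (Ad_mdiff a) h0.
have h0' : mdiff (act a) (act 1%g x) (tangent (act a) x) by rewrite act1.
have h2 := mdiff_comp orb_mdiff h0'.
have h3 := mdiff_near (fun k => _ : act a (act k x) = act (a * k * a^-1)%g x) h2.
have {}h3 : mdiff (fun k => act (a * k * a^-1)%g x) 1%g (fun v => tangent (act a) x (orb v)).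
  by apply: h3 => k; rewrite !actM ax'.
exact: (congr1 (fun f => f u) (mdiff_uniq h1 h3)).
Qed.

Lemma orbit_form_Ad a u v : H a -> orbit_form (Ad a u) (Ad a v) = orbit_form u v.
Proof.
move=> Ha; rewrite /orbit_form !orb_Ad //.
by have := @Pg a x (orb u) (orb v); rewrite Ha.
Qed.

(** At each time the velocity of the orbit of [x] under [expG (t *: u)] is the image of [orb u]
    under the tangent map of the action, so the orbit is constant as soon as [orb u = 0]. *)
Lemma lie_stabilizer u : lie_subgroup H u <-> orb u = 0.
Proof.
have hv t : vdiff (fun s : R^o => act (expG ((s - t) *: u)) x) t (fun s => s *: orb u).
  have h0 := (onep_exp (G := G) u).2.
  have h0' : vdiff (fun s : R^o => expG (s *: u)) (t - t : R^o) (fun s => s *: u) by rewrite subrr.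
  have h1 := vdiff_pre (@is_diff_shift _ R^o t t) h0'.
  have h2 : mdiff (fun a : G => act a x) (expG ((t - t) *: u)) orb by rewrite subrr expZ0.
  by apply: vdiff_ext (vdiff_comp h1 h2) => s; rewrite orbZ.
rewrite lie_subgroupE; split=> [h|u0 t].
  have := hv 0; rewrite (_ : (fun s : R^o => act _ x) = fun _ => x); last first.
    by apply/funext => s; rewrite subr0; exact: h.
  move=> [_ h1]; have [_ h2] := vdiff_cst x (0 : R^o).
  have := congr1 (fun f => f 1) (is_diff_uniq h1 h2).
  by rewrite scale1r.
have c : forall s t, act (expG (s *: u)) x = act (expG (t *: u)) x.
  apply: vdiff_zero_cst => {}t.
  have h0 : mdiff (act (expG (t *: u))) (act (expG ((t - t) *: u)) x) (tangent (act (expG (t *: u))) x).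
    by rewrite subrr expZ0 act1.
  have h1 := vdiff_comp (hv t) h0.
  rewrite (_ : (fun s : R^o => act (expG (s *: u)) x) =
     fun s => act (expG (t *: u)) (act (expG ((s - t) *: u)) x)); last first.
    by apply/funext => s; rewrite -actM -expGD addrC subrK.
  apply: vdiff_ext h1 => s; rewrite u0 scaler0; exact: tangent0.
by rewrite /stabilizer /= (c t 0) expZ0 act1.
Qed.

Let orb_lin : linear orb. Proof. by move=> a u v; rewrite orbD orbZ. Qed.

(** [Ad (expG (s *: u)) v] stays in the kernel of [orb], and its derivative at 0 is the bracket. *)
Lemma lie_stabilizer_bracket u v : lie_subgroup H u -> lie_subgroup H v ->
  lie_subgroup H (br u v).
Proof.
move=> hu /lie_stabilizer hv; apply/lie_stabilizer.
have Hu := (lie_subgroupE H u).1 hu.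
have /is_derive_diffE [d1 d2] := Ad_exp_derive (G := G) u v 0.
have h1 := is_diff_compose (is_diff_self d1) (is_diff_linear_rV _ orb_lin).
have h2 : is_diff (0 : R^o) (fun s : R^o => orb (Ad (expG (s *: u)) v)) (fun _ => 0).
  rewrite (_ : (fun s : R^o => _) = fun _ => 0); first exact: is_diff_const.
  apply/funext => s; rewrite orb_Ad //.
  by rewrite hv; exact: tangent0.
have := congr1 (fun f => f 1) (is_diff_uniq h1 h2).
by rewrite expZ0 Ad1 in d2; apply: etrans; apply: congr1; exact: esym.
Qed.

Lemma lie_stabilizer_subalgebra : lie_subalgebra br (lie_subgroup H).
Proof.
split.
- by apply/lie_stabilizer; rewrite /orb; exact: tangent0.
- move=> a u v /lie_stabilizer u0 /lie_stabilizer v0; apply/lie_stabilizer.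
  by rewrite orbD orbZ u0 v0 scaler0 addr0.
- exact: lie_stabilizer_bracket.
Qed.

Lemma form_bilinear n (A : 'M[R]_n) : bilinear_form (Defs.form A).
Proof.
split=> a u v w; rewrite /Defs.form.
  by rewrite !mulmxDl -!scalemxAl [LHS]mxE [X in X + _ = _]mxE.
by rewrite linearP mulmxDr -scalemxAr [LHS]mxE [X in X + _ = _]mxE.
Qed.

Lemma form_sym n (A : 'M[R]_n) u v : A^T = A -> Defs.form A u v = Defs.form A v u.
Proof.
move=> As; rewrite /Defs.form.
have -> : v *m A *m u^T = (u *m A *m v^T)^T by rewrite !trmx_mul trmxK As mulmxA.
by rewrite [RHS]mxE.
Qed.

Lemma orbit_form_bilinear : bilinear_form orbit_form.
Proof.
have [fl fr] := form_bilinear (g x).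
by split=> a u v w; rewrite /orbit_form orbD orbZ ?fl ?fr.
Qed.

Lemma orbit_form_sym u v : orbit_form u v = orbit_form v u.
Proof.
have [/(_ x) [_ gs _] _] := Lg.
exact: form_sym.
Qed.

Lemma orbit_form_ad u v w : lie_subgroup H u ->
  orbit_form (br u v) w + orbit_form v (br u w) = 0.
Proof.
move=> /lie_subgroupE hu.
have /is_derive_diffE [d1 d2] := Ad_exp_derive (G := G) u v 0.
have /is_derive_diffE [d1' d2'] := Ad_exp_derive (G := G) u w 0.
have h1 := is_diff_bilinear orbit_form_bilinear (is_diff_self d1) (is_diff_self d1').
have h2 : is_diff (0 : R^o) (fun s : R^o => orbit_form (Ad (expG (s *: u)) v) (Ad (expG (s *: u)) w) : R^o) (fun _ => 0).
  rewrite (_ : (fun s : R^o => _) = fun _ => orbit_form v w); first exact: is_diff_const.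
  by apply/funext => s; rewrite orbit_form_Ad.
have E := congr1 (fun f => f 1) (is_diff_uniq h1 h2).
rewrite expZ0 !Ad1 in d2 d2' E.
apply: etrans E; congr (orbit_form _ _ + orbit_form _ _); exact: esym.
Qed.

(** In a diagonalizing basis some nontrivial combination has time coordinate 0. It is still null,
    and a null vector without time component vanishes. *)
Lemma lorentz_isotropic n (A : 'M[R]_n) (p1 p2 : 'rV[R]_n) : lorentz_form A ->
  Defs.form A p1 p1 = 0 -> Defs.form A p1 p2 = 0 -> Defs.form A p2 p2 = 0 ->
  exists a b, (a != 0) || (b != 0) /\ a *: p1 + b *: p2 = 0.
Proof.
move=> [n0 As [P Pu PA]] f11 f12 f22.
case: n A p1 p2 n0 As P Pu PA f11 f12 f22 => // n A p1 p2 _ As P Pu PA f11 f12 f22.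
have A' : A = invmx P *m diag_mx (\row_(i < n.+1) if (i : nat) == 0%N then -1 else 1) *m (invmx P)^T.
  by rewrite -PA !mulmxA mulVmx // mul1mx -mulmxA -trmx_mul mulVmx // trmx1 mulmx1.
pose y p : 'rV[R]_n.+1 := p *m invmx P.
have yK p : y p *m P = p by rewrite /y -mulmxA mulVmx // mulmx1.
have fE p q : Defs.form A p q = - (y p 0 0 * y q 0 0) + \sum_(i < n) y p 0 (lift ord0 i) * y q 0 (lift ord0 i).
  rewrite /Defs.form A' !mulmxA -/(y p) -(mulmxA _ (invmx P)^T) -trmx_mul -/(y q) mul_mx_diag.
  rewrite mxE big_ord_recl !mxE /= mulrN1 mulNr; congr (_ + _).
  by apply: eq_bigr => i _; rewrite !mxE /= mulr1.
have [bl brr] := form_bilinear A.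
have null p : Defs.form A p p = 0 -> y p 0 0 = 0 -> p = 0.
  rewrite fE => h h0; rewrite h0 mul0r oppr0 add0r in h.
  have yp0 : y p = 0.
    apply/rowP => i; rewrite [RHS]mxE; case: (unliftP ord0 i) => [j ->|->]; last exact: h0.
    have nn k : true -> 0 <= y p 0 (lift ord0 k) * y p 0 (lift ord0 k).
      by move=> _; rewrite -expr2 sqr_ge0.
    have /eqP := psumr_eq0P nn h isT (i := j).
    by rewrite mulf_eq0 orbb => /eqP.
  by rewrite -(yK p) yp0 mul0mx.
have yl a b : y (a *: p1 + b *: p2) 0 0 = a * y p1 0 0 + b * y p2 0 0.
  by rewrite /y mulmxDl -!scalemxAl !mxE.
have b0 q : Defs.form A 0 q = 0 by rewrite /Defs.form !mul0mx mxE.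
have e q a b : Defs.form A (a *: p1 + b *: p2) q = a * Defs.form A p1 q + b * Defs.form A p2 q.
  by rewrite bl -[b *: p2]addr0 bl b0 addr0.
have nullc a b : Defs.form A (a *: p1 + b *: p2) (a *: p1 + b *: p2) = 0.
  rewrite e !(form_sym _ (a *: p1 + b *: p2) As) !e (form_sym p2 p1 As) f11 f12 f22; ring.
have [h1|h1] := eqVneq (y p1 0 0) 0.
  exists 1, 0; rewrite oner_neq0; split=> //.
  by apply: null; rewrite ?nullc // yl h1; ring.
exists (y p2 0 0), (- y p1 0 0); rewrite oppr_eq0 h1 orbT; split=> //.
by apply: null; rewrite ?nullc // yl; ring.
Qed.

Lemma orbit_form_isotropic u v : orbit_form u u = 0 -> orbit_form u v = 0 ->
  orbit_form v v = 0 ->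
  exists a b, (a != 0) || (b != 0) /\ lie_subgroup H (a *: u + b *: v).
Proof.
have [/(_ x) L _] := Lg.
move=> h1 h2 h3; have [a [b [ab E]]] := lorentz_isotropic L h1 h2 h3.
by exists a, b; split=> //; apply/lie_stabilizer; rewrite orbD !orbZ.
Qed.

End Orbit.

(** * Subalgebras of o(1,n) *)

Section LorentzAlgebra.
Context {R : realType} {n : nat}.
Implicit Types (x y z : 'cV[R]_(1 + n)) (Z U : 'M[R]_(1 + n)).

Local Notation eta := (sig_mx R 1 n).
Local Notation oalg := (orth_alg R 1 n).

Definition sgn (i : 'I_(1 + n)) : R := if (i : nat) == 0%N then -1 else 1.

Lemma sig_mxE i j : eta i j = sgn i *+ (i == j).
Proof.
rewrite /sig_mx /sgn.
case: (split_ordP i) => a ->; case: (split_ordP j) => b ->.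
- by rewrite block_mxEul !mxE !ord1 !eqxx.
- by rewrite block_mxEur mxE eq_lrshift.
- by rewrite block_mxEdl mxE eq_rlshift.
- by rewrite block_mxEdr !mxE eq_rshift.
Qed.

Lemma sgn_sq i : sgn i * sgn i = 1.
Proof. by rewrite /sgn; case: ifP => _; ring. Qed.

Lemma sig_tr : eta^T = eta.
Proof. by apply/matrixP => i j; rewrite mxE !sig_mxE eq_sym; case: eqP => [->|]. Qed.

Lemma mul_sigE m (A : 'M[R]_(1 + n, m)) i j : (eta *m A) i j = sgn i * A i j.
Proof.
rewrite mxE (bigD1 i) //= sig_mxE eqxx big1 ?addr0 // => k ki.
by rewrite sig_mxE eq_sym (negbTE ki) mul0r.
Qed.

Lemma mulmx_sigE m (A : 'M[R]_(m, 1 + n)) i j : (A *m eta) i j = A i j * sgn j.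
Proof.
rewrite mxE (bigD1 j) //= sig_mxE eqxx big1 ?addr0 // => k ki.
by rewrite sig_mxE (negbTE ki) mulr0.
Qed.

Lemma sig_sq : eta *m eta = 1%:M.
Proof.
apply/matrixP => i j; rewrite mul_sigE sig_mxE mxE.
by case: eqP => _; rewrite ?mulr0 //= sgn_sq.
Qed.

Definition bf x y : R := (x^T *m eta *m y) 0 0.

Lemma bfE x y : bf x y = \sum_i sgn i * (x i 0 * y i 0).
Proof.
rewrite /bf mxE; apply: eq_bigr => i _.
by rewrite mulmx_sigE mxE; ring.
Qed.

Lemma bfC x y : bf x y = bf y x.
Proof. by rewrite !bfE; apply: eq_bigr => i _; rewrite [x i 0 * _]mulrC. Qed.

Lemma bfDl x y z : bf (x + y) z = bf x z + bf y z.
Proof. by rewrite !bfE -big_split; apply: eq_bigr => i _; rewrite /= !mxE; ring. Qed.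

Lemma bfZl a x z : bf (a *: x) z = a * bf x z.
Proof. by rewrite !bfE mulr_sumr; apply: eq_bigr => i _; rewrite /= !mxE; ring. Qed.

Lemma bfDr x y z : bf z (x + y) = bf z x + bf z y.
Proof. by rewrite bfC bfDl !(bfC z). Qed.

Lemma bfZr a x z : bf z (a *: x) = a * bf z x.
Proof. by rewrite bfC bfZl (bfC z). Qed.

Lemma bfNl x z : bf (- x) z = - bf x z.
Proof. by rewrite -scaleN1r bfZl mulN1r. Qed.

Lemma bfNr x z : bf z (- x) = - bf z x.
Proof. by rewrite -scaleN1r bfZr mulN1r. Qed.

Lemma bf0l z : bf 0 z = 0. Proof. by rewrite -(scale0r z) bfZl mul0r. Qed.
Lemma bf0r z : bf z 0 = 0. Proof. by rewrite bfC bf0l. Qed.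

Definition bflin := (bfDl, bfDr, bfZl, bfZr, bfNl, bfNr, bf0l, bf0r).

Lemma bf_space z : z 0 0 = 0 -> 0 <= bf z z.
Proof.
move=> z0; rewrite bfE sumr_ge0 // => i _; rewrite /sgn; case: eqP => [i0|_].
  have -> : i = 0 by exact: val_inj.
  by rewrite z0 mulr0 mulr0.
by rewrite mul1r -expr2 sqr_ge0.
Qed.

Lemma bf_space0 z : z 0 0 = 0 -> bf z z = 0 -> z = 0.
Proof.
move=> z0 h; apply/matrixP => i j; rewrite ord1 mxE.
have nn k : true -> 0 <= sgn k * (z k 0 * z k 0).
  move=> _; rewrite /sgn; case: eqP => [i0|_].
    have -> : k = 0 by exact: val_inj.
    by rewrite z0 !mulr0.
  by rewrite mul1r -expr2 sqr_ge0.
move: h; rewrite bfE => h; have /eqP := psumr_eq0P nn h isT (i := i).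
rewrite mulf_eq0 mulf_eq0 orbb => /orP[|/eqP //].
by rewrite /sgn; case: ifP => _; rewrite ?oppr_eq0 oner_eq0.
Qed.

(* The vector on the left has time coordinate 0, so the orthogonal of a null vector is
   positive semidefinite. *)
Lemma bf_null_orth x y : x 0 0 != 0 -> bf x x = 0 -> bf x y = 0 ->
  bf (x 0 0 *: y - y 0 0 *: x) (x 0 0 *: y - y 0 0 *: x) = x 0 0 ^+ 2 * bf y y.
Proof. by move=> x0 xx xy; rewrite !bflin xx (bfC y x) xy; ring. Qed.

(** By [bf_null_orth], a [y] of nonpositive square would be proportional to [x], and pairing with
    [x'] then gives [y = 0]. So the orthogonal of the plane of [x] and [x'] is positive definite. *)
Lemma bf_pos x x' y : x 0 0 != 0 -> bf x x = 0 -> bf x x' != 0 ->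
  bf x y = 0 -> bf x' y = 0 -> y != 0 -> 0 < bf y y.
Proof.
move=> x0 xx xx' xy x'y; apply: contraNT; rewrite -leNgt => yy.
have E := bf_null_orth x0 xx xy.
set z := _ - _ in E; have z0 : z 0 0 = 0 by rewrite /z !mxE; ring.
have zz : bf z z = 0.
  apply/eqP; rewrite eq_le bf_space // andbT E.
  by rewrite mulr_ge0_le0 // sqr_ge0.
have /eqP := bf_space0 z0 zz; rewrite subr_eq0 => /eqP h.
have := congr1 (bf x') h; rewrite !bflin x'y mulr0 => /esym/eqP.
rewrite mulf_eq0 (bfC x') (negbTE xx') orbF => /eqP y0.
by move: h; rewrite y0 scale0r => /eqP; rewrite scaler_eq0 (negbTE x0).
Qed.

(** The bivector x ^ y as an infinitesimal isometry, see [wedge_mul]. Such elements span o(1,n), and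
    [commx_wedge] computes their brackets. *)
Definition wedge x y : 'M[R]_(1 + n) := x *m (y^T *m eta) - y *m (x^T *m eta).

Lemma wedge_mul x y z : wedge x y *m z = bf y z *: x - bf x z *: y.
Proof.
rewrite /wedge mulmxBl -!mulmxA !(mulmxA _ eta z).
by rewrite [_ *m eta *m z]mx11_scalar [x^T *m eta *m z]mx11_scalar !mul_mx_scalar.
Qed.

Lemma wedgeDl x y z : wedge (x + y) z = wedge x z + wedge y z.
Proof. by rewrite /wedge linearD !mulmxDl mulmxDr opprD addrACA. Qed.

Lemma wedgeZl a x z : wedge (a *: x) z = a *: wedge x z.
Proof. by rewrite /wedge linearZ /= -!scalemxAl -!scalemxAr -scalerBr. Qed.

Lemma wedgeC x y : wedge x y = - wedge y x.
Proof. by rewrite /wedge opprB. Qed.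

Lemma wedgeDr x y z : wedge z (x + y) = wedge z x + wedge z y.
Proof. by rewrite wedgeC wedgeDl opprD -!wedgeC. Qed.

Lemma wedgeZr a x z : wedge z (a *: x) = a *: wedge z x.
Proof. by rewrite wedgeC wedgeZl -scalerN -wedgeC. Qed.

Lemma wedgexx x : wedge x x = 0. Proof. exact: subrr. Qed.

Lemma wedge0r x : wedge x 0 = 0. Proof. by rewrite -(scale0r 0) wedgeZr scale0r. Qed.
Lemma wedge0l x : wedge 0 x = 0. Proof. by rewrite wedgeC wedge0r oppr0. Qed.
Lemma wedgeNr x y : wedge x (- y) = - wedge x y.
Proof. by rewrite -scaleN1r wedgeZr scaleN1r. Qed.
Lemma wedgeNl x y : wedge (- x) y = - wedge x y.
Proof. by rewrite -scaleN1r wedgeZl scaleN1r. Qed.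

Definition wlin := (wedgeDl, wedgeDr, wedgeZl, wedgeZr, wedgeNl, wedgeNr, wedge0l, wedge0r, wedgexx).

Lemma orthP Z : oalg Z <-> eta *m Z = - (Z^T *m eta).
Proof.
rewrite /orth_alg /=; split=> [/eqP|->]; last exact: subrr.
by rewrite addrC addr_eq0 => /eqP.
Qed.

Lemma orth0 : oalg 0. Proof. by rewrite /orth_alg /= trmx0 mul0mx mulmx0 addr0. Qed.

Lemma orthL a Z U : oalg Z -> oalg U -> oalg (a *: Z + U).
Proof.
rewrite /orth_alg /= => h h'.
by rewrite linearP mulmxDl mulmxDr -scalemxAl -scalemxAr addrACA -scalerDr h h' scaler0 addr0.
Qed.

Lemma orth_commx Z U : oalg Z -> oalg U -> oalg (commx Z U).
Proof.
move=> /orthP hZ /orthP hU; apply/orthP; rewrite /commx mulmxBr !mulmxA hZ hU.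
rewrite !mulNmx -!(mulmxA _ eta) hZ hU linearB /= !trmx_mul mulmxBl !mulmxN !opprK -!mulmxA.
by rewrite opprB.
Qed.

Lemma orth_bf Z x y : oalg Z -> bf (Z *m x) y = - bf x (Z *m y).
Proof.
move=> /orthP hZ; rewrite /bf trmx_mul -!mulmxA [Z^T *m _]mulmxA.
have -> : Z^T *m eta = - (eta *m Z) by rewrite hZ opprK.
by rewrite mulNmx mulmxN mxE -!mulmxA.
Qed.

Lemma wedge_orth x y : oalg (wedge x y).
Proof.
apply/orthP; rewrite /wedge [(_ - _)^T]linearB /= !trmx_mul !trmxK sig_tr mulmxBr mulmxBl.
by rewrite opprB !mulmxA.
Qed.

Lemma commx_wedge Z x y : oalg Z ->
  commx Z (wedge x y) = wedge (Z *m x) y + wedge x (Z *m y).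
Proof.
move=> /orthP hZ.
have h u w : w *m (u^T *m eta) *m Z = - (w *m ((Z *m u)^T *m eta)).
  by rewrite -!mulmxA hZ trmx_mul !mulmxN !mulmxA.
have r (A B C D : 'M[R]_(1 + n)) : A - B - (- C - - D) = A - D + (C - B).
  by apply/matrixP => i j; rewrite !mxE; ring.
by rewrite /commx /wedge mulmxBl mulmxBr !h !mulmxA r.
Qed.

End LorentzAlgebra.

Section Span.
Context {R : realType} {n : nat}.
Implicit Types (x y z : 'cV[R]_(1 + n)) (Z U P : 'M[R]_(1 + n)).

Local Notation eta := (sig_mx R 1 n).
Local Notation oalg := (orth_alg R 1 n).

Lemma sig_sum : eta = \sum_i sgn i *: (delta_mx i 0 *m (delta_mx i 0 : 'cV[R]_(1 + n))^T).
Proof.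
apply/matrixP => i j; rewrite sig_mxE summxE (bigD1 i) //= big1 => [|k ki].
  by rewrite addr0 trmx_delta mul_delta_mx !mxE eqxx /= eq_sym mulr_natr.
by rewrite trmx_delta mul_delta_mx !mxE eq_sym (negbTE ki) mulr0.
Qed.

(** The resolution of the identity [sig_sum] is inserted into the sum. In the applications [P] is a
    self-adjoint projection through which [Z] factors on both sides, so [Z] becomes a combination of
    bivectors of vectors in the image of [P]. *)
Lemma span_wedge Z P : oalg Z -> eta *m P^T *m eta = P -> Z *m P = Z -> P *m Z = Z ->
  Z = \sum_i (sgn i / 2) *: wedge (Z *m delta_mx i 0) (P *m delta_mx i 0).
Proof.
move=> /orthP hZ hP ZP PZ.
have E i : wedge (Z *m delta_mx i 0) (P *m delta_mx i 0) =
   Z *m (delta_mx i 0 *m (delta_mx i 0 : 'cV[R]_(1 + n))^T) *m (P^T *m eta) -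
   P *m (delta_mx i 0 *m (delta_mx i 0 : 'cV[R]_(1 + n))^T) *m (Z^T *m eta).
  by rewrite /wedge !trmx_mul !mulmxA.
have -> : \sum_i (sgn i / 2) *: wedge (Z *m delta_mx i 0) (P *m delta_mx i 0) =
   2^-1 *: (Z *m eta *m (P^T *m eta) - P *m eta *m (Z^T *m eta)).
  rewrite {1 3}sig_sum !mulmx_sumr !mulmx_suml -sumrB scaler_sumr.
  apply: eq_bigr => i _; rewrite E mulrC -scalerA; congr (_ *: _).
  by rewrite -!scalemxAr -!scalemxAl scalerBr.
have h1 : eta *m (P^T *m eta) = P by rewrite mulmxA.
have h2 : eta *m (Z^T *m eta) = - Z.
  have -> : Z^T *m eta = - (eta *m Z) by rewrite hZ opprK.
  by rewrite mulmxN mulmxA sig_sq mul1mx.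
rewrite -!mulmxA h1 h2 mulmxN opprK ZP PZ.
have -> : Z + Z = (2 : R) *: Z by rewrite scaler_nat mulr2n.
by rewrite scalerA mulVf ?scale1r // pnatr_eq0.
Qed.

Lemma span_wedge_in (h : set 'M[R]_(1 + n)) Z P :
  h 0 -> (forall a U U', h U -> h U' -> h (a *: U + U')) ->
  oalg Z -> eta *m P^T *m eta = P -> Z *m P = Z -> P *m Z = Z ->
  (forall x y, h (wedge (P *m x) (P *m y))) -> h Z.
Proof.
move=> h0 hL oZ hP ZP PZ hw; rewrite (span_wedge oZ hP ZP PZ).
elim/big_ind: _ => //.
  by move=> U U' hU hU'; rewrite -(scale1r U); exact: hL.
move=> i _; rewrite -[X in h X]addr0; apply: hL => //.
by rewrite -{1}PZ -mulmxA; exact: hw.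
Qed.

(** Three linear conditions on a space of dimension [1 + n >= 4]. A zero or repeated argument leaves
    two conditions. *)
Lemma orth3 x y z : (3 <= n)%N -> exists2 w, w != 0 & [/\ bf x w = 0, bf y w = 0 & bf z w = 0].
Proof.
move=> n3; pose A : 'M[R]_(1 + n, 1 + (1 + 1)) := row_mx (eta *m x) (row_mx (eta *m y) (eta *m z)).
have : kermx A != 0.
  rewrite kermx_eq0 /row_free; apply/negP => /eqP h.
  have := rank_leq_col A; rewrite h; apply/negP; rewrite -ltnNge.
  by rewrite !add1n ltnS.
case/rowV0Pn => u /sub_kermxP uA u0.
exists u^T; first by rewrite trmx_eq0.
move: uA; rewrite /A !mul_mx_row -[RHS]hsubmxK => /eq_row_mx [h1 h2].
move: h2; rewrite -[RHS]hsubmxK => /eq_row_mx [h2 h3].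
by split; rewrite bfC /bf trmxK -mulmxA ?h1 ?h2 ?h3 !mxE.
Qed.

End Span.

(** * Subalgebras that meet every isotropic plane *)

Section Classification.
Context {R : realType} {n : nat}.
Implicit Types (x y z w : 'cV[R]_(1 + n)) (Z U : 'M[R]_(1 + n)).

Local Notation eta := (sig_mx R 1 n).
Local Notation oalg := (orth_alg R 1 n).

Variables (h : set 'M[R]_(1 + n)) (q : 'M[R]_(1 + n) -> 'M[R]_(1 + n) -> R).
Hypotheses (n3 : (3 <= n)%N)
  (h0 : h 0) (hL : forall a U V, h U -> h V -> h (a *: U + V))
  (hB : forall U V, h U -> h V -> h (commx U V)) (ho : forall U, h U -> oalg U)
  (qL : forall a U V W, q (a *: U + V) W = a * q U W + q V W)
  (qC : forall U V, q U V = q V U)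
  (q0 : forall U V, h U -> q U V = 0)
  (qI : forall U V W, h U -> oalg V -> oalg W -> q (commx U V) W + q V (commx U W) = 0)
  (qN : forall U V, oalg U -> oalg V -> q U U = 0 -> q U V = 0 -> q V V = 0 ->
     exists a b, (a != 0) || (b != 0) /\ h (a *: U + b *: V)).

Let hD U V : h U -> h V -> h (U + V).
Proof. by move=> hU hV; rewrite -(scale1r U); exact: hL. Qed.
Let hZ a U : h U -> h (a *: U).
Proof. by move=> hU; rewrite -[_ *: _]addr0; exact: hL. Qed.
Let hN U : h U -> h (- U).
Proof. by move=> hU; rewrite -scaleN1r; exact: hZ. Qed.
Let hBr U V : h U -> h V -> h (U - V).
Proof. by move=> hU hV; apply: hD => //; exact: hN. Qed.
Let hZi a U : a != 0 -> h (a *: U) -> h U.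
Proof. by move=> a0 /(hZ a^-1); rewrite scalerA mulVf // scale1r. Qed.
Let hDi U V : h V -> h (U + V) -> h U.
Proof. by move=> hV hUV; rewrite -(addrK V U); exact: hBr. Qed.

Let q0r U V : h V -> q U V = 0. Proof. by move=> hV; rewrite qC q0. Qed.
Let q0x U : q 0 U = 0.
Proof. by have := qL (-1) 0 0 U; rewrite scaler0 addr0 => E; lra. Qed.
Let qZl a U V : q (a *: U) V = a * q U V.
Proof. by have := qL a U 0 V; rewrite !addr0 q0x addr0. Qed.
Let qDl U V W : q (U + V) W = q U W + q V W.
Proof. by have := qL 1 U V W; rewrite scale1r mul1r. Qed.
Let qZr a U V : q V (a *: U) = a * q V U. Proof. by rewrite qC qZl qC. Qed.
Let qDr U V W : q W (U + V) = q W U + q W V. Proof. by rewrite qC qDl !(qC W). Qed.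
Let qNl U V : q (- U) V = - q U V. Proof. by rewrite -scaleN1r qZl mulN1r. Qed.
Let qNr U V : q V (- U) = - q V U. Proof. by rewrite -scaleN1r qZr mulN1r. Qed.

Variable l : 'cV[R]_(1 + n).
Hypotheses (l0 : l 0 0 != 0) (ll : bf l l = 0).

Let qU U V W : h U -> oalg V -> oalg W -> q (commx U V) W = - q V (commx U W).
Proof. by move=> hU oV oW; apply/eqP; rewrite -addr_eq0 qI. Qed.

(** The equations say that [q] is infinitesimally invariant under the map sending [U1] to
    [k *: U1 - p *: U2] and [U2] to [r *: U1 + k *: U2]. Its two eigenvalues have real part [k], so
    the sum of any two has nonzero real part and no invariant form survives on the plane. *)
Lemma skew_plane U1 U2 k p r : k != 0 -> 0 <= p * r ->
  q (k *: U1 - p *: U2) U1 + q U1 (k *: U1 - p *: U2) = 0 ->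
  q (r *: U1 + k *: U2) U2 + q U2 (r *: U1 + k *: U2) = 0 ->
  q (k *: U1 - p *: U2) U2 + q U1 (r *: U1 + k *: U2) = 0 ->
  [/\ q U1 U1 = 0, q U1 U2 = 0 & q U2 U2 = 0].
Proof.
move=> k0 pr; rewrite !(qDl, qDr, qNl, qNr, qZl, qZr) (qC U2 U1).
set q11 := q U1 U1; set q12 := q U1 U2; set q22 := q U2 U2 => E1 E2 E3.
have k2 : 0 < k ^+ 2 by rewrite lt_def sqrf_eq0 k0 sqr_ge0.
have e1 : k * q11 = p * q12 by lra.
have e2 : k * q22 = - (r * q12) by lra.
have e3 : (2 * k ^+ 2 + 2 * (p * r)) * q12 = 0.
  have : k * (2 * k * q12 - p * q22 + r * q11) = 0.
    by rewrite (_ : 2 * k * q12 - _ + _ = 0) ?mulr0 //; lra.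
  have -> : k * (2 * k * q12 - p * q22 + r * q11) =
    2 * k ^+ 2 * q12 - p * (k * q22) + r * (k * q11) by ring.
  by rewrite e1 e2 => <-; ring.
have q12_0 : q12 = 0.
  move/eqP: e3; rewrite mulf_eq0 => /orP[|/eqP //].
  by rewrite gt_eqF //; lra.
split=> //.
  by move/eqP: e1; rewrite q12_0 mulr0 mulf_eq0 (negbTE k0) => /eqP.
by move/eqP: e2; rewrite q12_0 mulr0 oppr0 mulf_eq0 (negbTE k0) => /eqP.
Qed.

Section Partner.
Variable l' : 'cV[R]_(1 + n).
Hypotheses (ll' : bf l l' != 0) (l'l' : bf l' l' = 0).

Definition wperp w := bf l w = 0 /\ bf l' w = 0.

Lemma wperp_pos w : wperp w -> w != 0 -> 0 < bf w w.
Proof. by move=> [h1 h2]; exact: bf_pos ll' h1 h2. Qed.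

Lemma wperpL a x y : wperp x -> wperp y -> wperp (a *: x + y).
Proof. by move=> [h1 h2] [h3 h4]; split; rewrite !bflin ?h1 ?h2 ?h3 ?h4; ring. Qed.

Lemma bracket_lx x y : wperp x -> wperp y ->
  commx (wedge l x) (wedge l' y) =
  bf x y *: wedge l' l - bf l l' *: wedge x y.
Proof.
move=> [x1 x2] [y1 y2]; rewrite (commx_wedge _ _ (wedge_orth _ _)) !wedge_mul.
by rewrite (bfC x l') x2 y1 scale0r sub0r scale0r subr0 !wlin addrC.
Qed.

Lemma bracket_lxly x x' y : wperp x -> wperp x' -> wperp y ->
  commx (wedge l x) (commx (wedge l x') (wedge l' y)) =
  wedge l (bf l l' *: (bf x y *: x' + bf x' y *: x - bf x x' *: y)).
Proof.
move=> wx wx' wy; have [x1 x2] := wx; have [x1' x2'] := wx'; have [y1 y2] := wy.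
have cD Z U V : commx Z (U - V) = commx Z U - commx Z V.
  by rewrite /commx mulmxBr mulmxBl; apply/matrixP => i j; rewrite !mxE; ring.
have cZ Z a U : commx Z (a *: U) = a *: commx Z U.
  by rewrite /commx -scalemxAr -scalemxAl scalerBr.
rewrite (bracket_lx wx' wy) cD !cZ !(commx_wedge _ _ (wedge_orth _ _)) !wedge_mul.
rewrite ?(bfC x l') ?(bfC x l) ?(bfC x' l) x2 x1 ll x1' y1 !scale0r !subr0 !sub0r.
rewrite !wlin (wedgeC x l) (wedgeC x' l) !addr0.
apply/matrixP => i j; rewrite !mxE; ring.
Qed.

Lemma weight_l' y : wperp y -> commx (wedge l' l) (wedge l' y) = bf l l' *: wedge l' y.
Proof.
move=> [y1 y2]; rewrite (commx_wedge _ _ (wedge_orth _ _)) !wedge_mul.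
by rewrite l'l' y1 y2 !scale0r !subr0 wedge0r addr0 wedgeZl.
Qed.

(** The boost multiplies both vectors by [bf l l'], so invariance of [q] makes [2 * bf l l'] times
    the value vanish. *)
Lemma weight_q y y' : h (wedge l' l) -> wperp y -> wperp y' ->
  q (wedge l' y) (wedge l' y') = 0.
Proof.
move=> hA wy wy'; have := qI hA (wedge_orth l' y) (wedge_orth l' y').
rewrite !weight_l' // qZl qZr => /eqP; rewrite -mulr2n mulrn_eq0 /= mulf_eq0.
by rewrite (negbTE ll') => /eqP.
Qed.

(** Invariance moves [wedge l x] to the other argument. There [bracket_lxly] computes a double
    bracket, which lies in [h] by the last hypothesis, hence in the radical of [q]. *)
Lemma null_bracket x y x' y' : wperp x -> wperp y -> wperp x' -> wperp y' ->
  h (wedge l x) ->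
  h (wedge l (bf l l' *: (bf x y' *: x' + bf x' y' *: x - bf x x' *: y'))) ->
  q (commx (wedge l x) (wedge l' y)) (commx (wedge l x') (wedge l' y')) = 0.
Proof.
move=> wx wy wx' wy' hx hd; rewrite (qU hx (wedge_orth _ _) (orth_commx (wedge_orth _ _) (wedge_orth _ _))).
by rewrite bracket_lxly // q0r ?oppr0.
Qed.

(** The orthogonal of [l] and [l'] has dimension [n - 1 >= 2], which is what a plane of bivectors l
    ^ y or l' ^ y requires. *)
Lemma wperp_pair : exists y1 y2, [/\ wperp y1, wperp y2, y1 != 0, y2 != 0 & bf y1 y2 = 0].
Proof.
have [y1 y10 [a1 a2 _]] := orth3 l l' 0 n3.
have [y2 y20 [b1 b2 b3]] := orth3 l l' y1 n3.
by exists y1, y2.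
Qed.

Lemma pair_comb_neq0 y1 y2 a b : wperp y1 -> wperp y2 -> y1 != 0 -> y2 != 0 ->
  bf y1 y2 = 0 -> (a != 0) || (b != 0) -> 0 < bf (a *: y1 + b *: y2) (a *: y1 + b *: y2).
Proof.
move=> w1 w2 y10 y20 y12 ab; have p1 := wperp_pos w1 y10; have p2 := wperp_pos w2 y20.
rewrite !bflin (bfC y2 y1) y12.
have a2 := sqr_ge0 a; have b2 := sqr_ge0 b.
case/orP: ab => [a0|b0].
  have a3 : 0 < a ^+ 2 by rewrite lt_def sqrf_eq0 a0.
  nra.
have b3 : 0 < b ^+ 2 by rewrite lt_def sqrf_eq0 b0.
nra.
Qed.

Definition projw : 'M[R]_(1 + n) :=
  1%:M - (bf l l')^-1 *: (l *m (l'^T *m eta) + l' *m (l^T *m eta)).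

Lemma projwE z : projw *m z = z - (bf l l')^-1 *: (bf l' z *: l + bf l z *: l').
Proof.
rewrite /projw mulmxBl mul1mx -scalemxAl mulmxDl -!mulmxA !(mulmxA _ eta z).
by rewrite [l'^T *m eta *m z]mx11_scalar [l^T *m eta *m z]mx11_scalar !mul_mx_scalar.
Qed.

Lemma projw_perp z : wperp (projw *m z).
Proof.
split; rewrite projwE !bflin ?ll ?l'l' ?(bfC l' l) mulr0 ?addr0 ?add0r.
  by rewrite [_ * bf l l']mulrC mulrA mulVf // mul1r subrr.
by rewrite [_ * bf l l']mulrC mulrA mulVf // mul1r subrr.
Qed.

Lemma projw_id z : wperp z -> projw *m z = z.
Proof. by move=> [z1 z2]; rewrite projwE z1 z2 !scale0r addr0 scaler0 subr0. Qed.

Lemma decomp z : z = projw *m z + (bf l l')^-1 *: (bf l' z *: l + bf l z *: l').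
Proof. by rewrite projwE subrK. Qed.

Lemma projw_adj : eta *m projw^T *m eta = projw.
Proof.
rewrite /projw; rewrite [(_ - _)^T]linearB /= trmx1 mulmxBr mulmx1 mulmxBl sig_sq.
congr (_ - _); rewrite linearZ /= -scalemxAr -scalemxAl; congr (_ *: _).
rewrite [(_ + _)^T]linearD /= !trmx_mul !trmxK sig_tr mulmxDr mulmxDl !mulmxA sig_sq !mul1mx.
by rewrite addrC -!mulmxA.
Qed.

(** Killing [l] and [l'], and being skew for the form, [Z] factors through [projw] on both sides. *)
Lemma killed_span Z : oalg Z -> Z *m l = 0 -> Z *m l' = 0 ->
  (forall x y, wperp x -> wperp y -> h (wedge x y)) -> h Z.
Proof.
move=> oZ Zl Zl' hw; apply: (span_wedge_in h0 hL oZ projw_adj).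
- rewrite /projw mulmxBr mulmx1 -scalemxAr mulmxDr !mulmxA Zl Zl' !mul0mx addr0.
  by rewrite scaler0 subr0.
- rewrite /projw mulmxBl mul1mx -scalemxAl mulmxDl -!mulmxA ((orthP Z).1 oZ).
  rewrite !mulmxN !mulmxA -!mulmxA ![_^T *m (Z^T *m _)]mulmxA -!trmx_mul Zl Zl'.
  by rewrite !trmx0 !mul0mx !mulmx0 oppr0 addr0 scaler0 subr0.
- by move=> x y; apply: hw; exact: projw_perp.
Qed.

Lemma all_span : h (wedge l' l) -> (forall x, wperp x -> h (wedge l x)) ->
  (forall x, wperp x -> h (wedge l' x)) ->
  (forall x y, wperp x -> wperp y -> h (wedge x y)) -> forall Z, oalg Z -> h Z.
Proof.
move=> hA hl hl' hw Z oZ.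
apply: (span_wedge_in h0 hL oZ (P := 1%:M)); rewrite ?trmx1 ?mulmx1 ?mul1mx ?sig_sq //.
have hA' : h (wedge l l') by rewrite wedgeC; exact: hN.
have hlr x : wperp x -> h (wedge x l) by move=> wx; rewrite wedgeC; apply/hN/hl.
have hlr' x : wperp x -> h (wedge x l') by move=> wx; rewrite wedgeC; apply/hN/hl'.
have gen u (hu : h (wedge u l)) (hu' : h (wedge u l')) :
    (forall y, wperp y -> h (wedge u y)) -> forall y, h (wedge u y).
  move=> hp y; rewrite (decomp y) !(wedgeDr, wedgeZr).
  apply: hD; first exact/hp/projw_perp.
  by apply: hZ; apply: hD; exact: hZ.
have H1 := gen l; rewrite wedgexx in H1; have {}H1 := H1 h0 hA' hl.
have H2 := gen l'; rewrite wedgexx in H2; have {}H2 := H2 hA h0 hl'.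
have H3 x : wperp x -> forall y, h (wedge x y).
  by move=> wx; apply: gen; [exact: hlr|exact: hlr'|move=> y; exact: hw].
move=> x y; rewrite !mul1mx (decomp x) !(wedgeDl, wedgeZl).
apply: hD; first exact/H3/projw_perp.
by apply: hZ; apply: hD; exact: hZ.
Qed.

Lemma h_l'y_A y : wperp y -> y != 0 -> h (wedge l y) -> h (wedge l' y) -> h (wedge l' l).
Proof.
move=> wy y0 h1 h2; have p := wperp_pos wy y0.
have := hB h1 h2; rewrite bracket_lx // wedgexx scaler0 subr0.
by apply: hZi; rewrite gt_eqF.
Qed.

Lemma h_wedge_perp x y : h (wedge l' l) -> wperp x -> wperp y ->
  h (wedge l x) -> h (wedge l' y) -> h (wedge x y).
Proof.
move=> hA wx wy h1 h2; have := hB h1 h2; rewrite bracket_lx // => H.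
apply: (hZi ll'); rewrite -[X in h X]opprK; apply: hN.
by apply: (hDi (hZ (bf x y) hA)); rewrite addrC.
Qed.

Section FullNilradical.
Hypothesis hl : forall w, wperp w -> h (wedge l w).

(** The bivectors l' ^ y all have the same weight under the boost, so any two span an isotropic
    subspace, and one of them with y nonzero lies in [h]. Its brackets with the l ^ x give all
    rotations x ^ y for this y, and these carry l' ^ y to every l' ^ x. *)
Lemma full_case : h (wedge l' l) -> forall Z, oalg Z -> h Z.
Proof.
move=> hA; have [y1 [y2 [w1 w2 y10 y20 y12]]] := wperp_pair.
have [a [b [ab hab]]] := qN (wedge_orth l' y1) (wedge_orth l' y2)
  (weight_q hA w1 w1) (weight_q hA w1 w2) (weight_q hA w2 w2).
pose y := a *: y1 + b *: y2.
have c0 := pair_comb_neq0 w1 w2 y10 y20 y12 ab; rewrite -/y in c0.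
have hy : h (wedge l' y) by rewrite /y !(wedgeDr, wedgeZr).
have wy : wperp y by apply: wperpL => //; rewrite -[b *: _]addr0; apply: wperpL => //; split; rewrite bf0r.
have hl'x x : wperp x -> h (wedge l' x).
  move=> wx; have hxy := h_wedge_perp hA wx wy (hl wx) hy.
  have := hB hxy hy; rewrite (commx_wedge _ _ (wedge_orth _ _)) !wedge_mul.
  have [x1 x2] := wx; have [z1 z2] := wy.
  rewrite (bfC x l') (bfC y l') x2 z2 !scale0r subrr wedge0l add0r wedgeDr wedgeNr !wedgeZr => H.
  apply: (@hZi (bf y y)); first by rewrite gt_eqF.
  by apply: (hDi (hN (hZ (bf x y) hy))).
apply: all_span => // x z wx wz.
by apply: h_wedge_perp => //; [exact: hl|exact: hl'x].
Qed.

(** For orthogonal u and w, the rotation u ^ w and the boost l' ^ l are, up to scalars, brackets of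
    l ^ u with l' ^ w and l' ^ u, and span an isotropic plane. A member of [h] involving both acts
    on the plane of l' ^ u and l' ^ w as in [skew_plane], so that plane is isotropic too and some l'
    ^ y lies in [h]. Its bracket with l ^ y would put the boost in [h]. *)
Lemma null_case_wedge x y : ~ h (wedge l' l) -> wperp x -> wperp y -> h (wedge x y).
Proof.
move=> nA.
have orth_case u w : wperp u -> wperp w -> u != 0 -> w != 0 -> bf u w = 0 -> h (wedge u w).
  move=> wu ww u0 w0 uw.
  have p := wperp_pos wu u0; have r := wperp_pos ww w0.
  have Tuu : commx (wedge l u) (wedge l' u) = bf u u *: wedge l' l.
    by rewrite bracket_lx // wedgexx scaler0 subr0.
  have Tuw : commx (wedge l u) (wedge l' w) = - bf l l' *: wedge u w.
    by rewrite bracket_lx // uw scale0r sub0r scaleNr.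
  have wq z1 z2 z3 z4 : wperp z1 -> wperp z2 -> wperp z3 -> wperp z4 ->
    q (commx (wedge l z1) (wedge l' z2)) (commx (wedge l z3) (wedge l' z4)) = 0.
    move=> v1 v2 v3 v4; apply: null_bracket => //; first exact: hl.
    apply: hl; rewrite -[_ *: _]addr0; apply: wperpL; last by split; rewrite bf0r.
    rewrite -addrA; apply: wperpL => //; apply: wperpL => //.
    rewrite -scaleNr -[_ *: _]addr0; apply: wperpL => //; by split; rewrite bf0r.
  have qAA : q (wedge l' l) (wedge l' l) = 0.
    have := wq _ _ _ _ wu wu wu wu; rewrite Tuu qZl qZr => /eqP.
    by rewrite mulf_eq0 mulf_eq0 orbA orbb gt_eqF // => /eqP.
  have quA : q (wedge u w) (wedge l' l) = 0.
    have := wq _ _ _ _ wu ww wu wu; rewrite Tuu Tuw qZl qZr => /eqP.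
    by rewrite mulf_eq0 oppr_eq0 (negbTE ll') /= mulf_eq0 gt_eqF // => /eqP.
  have quu : q (wedge u w) (wedge u w) = 0.
    have := wq _ _ _ _ wu ww wu ww; rewrite Tuw qZl qZr => /eqP.
    by rewrite mulf_eq0 mulf_eq0 orbA orbb oppr_eq0 (negbTE ll') => /eqP.
  have [a [b [ab hab]]] := qN (wedge_orth u w) (wedge_orth l' l) quu quA qAA.
  have [a0|a0] := eqVneq a 0.
    rewrite a0 eqxx /= in ab; rewrite a0 scale0r add0r in hab.
    by case: nA; exact: hZi hab.
  have [b0|b0] := eqVneq b 0.
    by rewrite b0 scale0r addr0 in hab; exact: hZi hab.
  case: nA.
  pose Z := a *: wedge u w + b *: wedge l' l.
  have [u1 u2] := wu; have [w1 w2] := ww.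
  have cD U V W : commx (U + V) W = commx U W + commx V W.
    by rewrite /commx mulmxDr mulmxDl; apply/matrixP => i j; rewrite !mxE; ring.
  have cZ k U V : commx (k *: U) V = k *: commx U V.
    by rewrite /commx -scalemxAr -scalemxAl scalerBr.
  have Zu : commx Z (wedge l' u) = b * bf l l' *: wedge l' u - a * bf u u *: wedge l' w.
    rewrite /Z cD !cZ weight_l' // (commx_wedge _ _ (wedge_orth _ _)) !wedge_mul.
    rewrite !(bfC _ l') u2 w2 (bfC w u) uw !scale0r subrr wedge0l add0r sub0r.
    by rewrite wedgeNr wedgeZr; apply/matrixP => i j; rewrite !mxE; ring.
  have Zw : commx Z (wedge l' w) = a * bf w w *: wedge l' u + b * bf l l' *: wedge l' w.
    rewrite /Z cD !cZ weight_l' // (commx_wedge _ _ (wedge_orth _ _)) !wedge_mul.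
    rewrite !(bfC _ l') u2 w2 uw !scale0r subrr wedge0l add0r subr0.
    by rewrite wedgeZr; apply/matrixP => i j; rewrite !mxE; ring.
  have E1 := qI hab (wedge_orth l' u) (wedge_orth l' u).
  have E2 := qI hab (wedge_orth l' w) (wedge_orth l' w).
  have E3 := qI hab (wedge_orth l' u) (wedge_orth l' w).
  rewrite -/Z Zu Zw in E1 E2 E3.
  have k0 : b * bf l l' != 0 by rewrite mulf_neq0.
  have pr : 0 <= a * bf u u * (a * bf w w).
    by rewrite mulrACA -expr2 mulr_ge0 ?sqr_ge0 // mulr_ge0 // ltW.
  have [q11_0 q12_0 q22_0] := skew_plane k0 pr E1 E2 E3.
  have [a' [b' [ab' hab']]] := qN (wedge_orth l' u) (wedge_orth l' w) q11_0 q12_0 q22_0.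
  have c0 := pair_comb_neq0 wu ww u0 w0 uw ab'.
  have wy : wperp (a' *: u + b' *: w).
    by apply: wperpL => //; rewrite -[b' *: _]addr0; apply: wperpL => //; split; rewrite bf0r.
  apply: (h_l'y_A wy); [|exact: hl|by rewrite !(wedgeDr, wedgeZr)].
  by apply: contraTN c0 => /eqP ->; rewrite bf0r ltxx.
move=> wx wy; have [->|x0] := eqVneq x 0; first by rewrite wedge0l.
have p := wperp_pos wx x0.
(* Gram-Schmidt: adding a multiple of [x] to [y] does not change the bivector. *)
pose y' := - (bf x y / bf x x) *: x + y.
have wy' : wperp y' by exact: wperpL.
have -> : wedge x y = wedge x y' by rewrite /y' wedgeDr wedgeZr wedgexx scaler0 add0r.
have [->|y0] := eqVneq y' 0; first by rewrite wedge0r.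
apply: orth_case => //.
by rewrite /y' !bflin mulNr divfK ?gt_eqF // addNr.
Qed.

Lemma orth_self Z x : oalg Z -> bf x (Z *m x) = 0.
Proof.
move=> oZ; have := orth_bf x x oZ; rewrite bfC => /eqP.
by rewrite -addr_eq0 -mulr2n mulrn_eq0 => /eqP.
Qed.

(** If Z kills l, adding a multiple of l ^ w with w = Z l' makes it kill l' as well, and it is then
    a combination of rotations. Conversely, an element of [h] reduces modulo the stabilizer of l to
    l' ^ y + a l' ^ l. If y were nonzero, the bracket with l ^ y would put the boost in [h]; with y
    = 0, so would a nonzero a. *)
Lemma null_case : ~ h (wedge l' l) -> forall Z, oalg Z -> (h Z <-> Z *m l = 0).
Proof.
move=> nA.
have kill Z : oalg Z -> Z *m l = 0 -> h Z.
  move=> oZ Zl; pose w := Z *m l'.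
  have ww : wperp w.
    split; last exact: orth_self.
    by apply/eqP; rewrite -oppr_eq0 -orth_bf // Zl bf0l.
  apply: (hDi (hZ (bf l l')^-1 (hl ww))).
  have oZ' : oalg (Z + (bf l l')^-1 *: wedge l w).
    by rewrite addrC; apply: orthL => //; exact: wedge_orth.
  apply: killed_span => //.
  - rewrite mulmxDl Zl add0r -scalemxAl wedge_mul ll (bfC w l) ww.1.
    by rewrite !scale0r subrr scaler0.
  - rewrite mulmxDl -scalemxAl wedge_mul (bfC w l') ww.2 scale0r sub0r scalerN scalerA.
    by rewrite mulVf // scale1r subrr.
  - by move=> x y wx wy; exact: null_case_wedge.
move=> Z oZ; split; last exact: kill.
move=> hZ0.
pose y := projw *m (Z *m l); pose a := (bf l l')^-1 * bf l' (Z *m l).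
have Zl : Z *m l = y + a *: l.
  rewrite {1}(decomp (Z *m l)) (orth_self l oZ) scale0r addr0 scalerA //.
have wy : wperp y by exact: projw_perp.
have hYA : h (wedge l' y + a *: wedge l' l).
  apply: (@hZi (bf l l')^-1); first by rewrite invr_eq0.
  apply: (hDi hZ0); rewrite addrC; apply: kill.
    rewrite addrC; apply: orthL => //.
    by rewrite addrC; apply: orthL; exact: wedge_orth.
  rewrite mulmxDl -scalemxAl mulmxDl -scalemxAl !wedge_mul ll (bfC y l) wy.1 (bfC l' l).
  have E (Y L : 'cV[R]_(1 + n)) (k : R) : k != 0 ->
      Y + a *: L + k^-1 *: (- (k *: Y) + a *: - (k *: L)) = 0.
    by move=> k0; apply/matrixP => i j; rewrite !mxE; field.
  by rewrite !scale0r !sub0r Zl E.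
have y0 : y = 0.
  apply/eqP; apply: contrapT => /negP y0; case: nA.
  have p := wperp_pos wy y0.
  have := hB (hl wy) hYA.
  have cDr U V W k : commx U (V + k *: W) = commx U V + k *: commx U W.
    by rewrite /commx mulmxDr mulmxDl -scalemxAr -scalemxAl; apply/matrixP => i j; rewrite !mxE; ring.
  rewrite cDr bracket_lx // wedgexx scaler0 subr0 (commx_wedge _ _ (wedge_orth _ _)) !wedge_mul.
  rewrite ll (bfC y l') (bfC y l) wy.1 wy.2 !scale0r subrr wedge0r addr0 sub0r wedgeNl wedgeZl.
  rewrite (wedgeC y l) !scalerN opprK => H.
  apply: (@hZi (bf y y)); first by rewrite gt_eqF.
  exact: (hDi (hZ a (hZ (bf l l') (hl wy)))).
have a0 : a = 0.
  rewrite y0 wedge0r add0r in hYA; apply/eqP; apply: contrapT => /negP a0.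
  by case: nA; exact: hZi hYA.
by rewrite Zl y0 a0 scale0r addr0.
Qed.

End FullNilradical.

Hypothesis qll : forall w w', wperp w -> wperp w' -> q (wedge l w) (wedge l w') = 0.

Lemma half_nilradical : exists x, [/\ wperp x, x != 0 & h (wedge l x)].
Proof.
have [y1 [y2 [w1 w2 y10 y20 y12]]] := wperp_pair.
have [a [b [ab hab]]] := qN (wedge_orth l y1) (wedge_orth l y2)
  (qll w1 w1) (qll w1 w2) (qll w2 w2).
exists (a *: y1 + b *: y2); split.
- by apply: wperpL => //; rewrite -[b *: _]addr0; apply: wperpL => //; split; rewrite bf0r.
- have c0 := pair_comb_neq0 w1 w2 y10 y20 y12 ab.
  by apply: contraTN c0 => /eqP ->; rewrite bf0r ltxx.
- by rewrite !(wedgeDr, wedgeZr).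
Qed.

(** The boost is a multiple of the bracket of l ^ x and l' ^ x for some l ^ x in [h], hence null for
    [q], and it spans an isotropic plane with l ^ v. The element of [h] found in this plane involves
    the boost because l ^ v is not in [h]. *)
Lemma half_case_boost v : wperp v -> ~ h (wedge l v) ->
  q (wedge l v) (wedge l' l) = 0 -> exists c, h (wedge l' l + c *: wedge l v).
Proof.
move=> wv nv qvA; have [x [wx x0 hx]] := half_nilradical.
have p := wperp_pos wx x0.
have Txx : commx (wedge l x) (wedge l' x) = bf x x *: wedge l' l.
  by rewrite bracket_lx // wedgexx scaler0 subr0.
have qAA : q (wedge l' l) (wedge l' l) = 0.
  have : q (commx (wedge l x) (wedge l' x)) (commx (wedge l x) (wedge l' x)) = 0.
    apply: null_bracket => //.
    by rewrite addrK wedgeZr wedgeZr; apply: hZ; exact: hZ.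
  rewrite Txx qZl qZr => /eqP.
  by rewrite mulf_eq0 mulf_eq0 orbA orbb gt_eqF // => /eqP.
have [a [b [ab hab]]] := qN (wedge_orth l v) (wedge_orth l' l) (qll wv wv) qvA qAA.
have [b0|b0] := eqVneq b 0.
  rewrite b0 eqxx orbF in ab; rewrite b0 scale0r addr0 in hab.
  by case: nv; exact: hZi hab.
exists (b^-1 * a); apply: (hZi b0).
by rewrite scalerDr scalerA mulrA mulfV // mul1r addrC.
Qed.

Lemma projw_l : projw *m l = 0.
Proof. by rewrite projwE ll scale0r addr0 (bfC l' l) scalerA mulVf // scale1r subrr. Qed.

Lemma projw_l' : projw *m l' = 0.
Proof. by rewrite projwE l'l' scale0r add0r scalerA mulVf // scale1r subrr. Qed.

Lemma wperpZ a x : wperp x -> wperp (a *: x).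
Proof. by move=> [h1 h2]; split; rewrite bfZr ?h1 ?h2 mulr0. Qed.

(* The nilradical meets [h] in the vectors [l ^ w] with [w] orthogonal to a unit
   vector, obtained by representing the coordinate along [l ^ v1] modulo [h]. *)
Lemma half_normal v1 : wperp v1 -> ~ h (wedge l v1) ->
  exists v, [/\ wperp v, bf v v = 1 &
    forall w, wperp w -> (h (wedge l w) <-> bf v w = 0)].
Proof.
move=> wv1 nv1.
have ex z : exists m, h (wedge l (projw *m z - m *: v1)).
  have wz := projw_perp z.
  have [a [b [ab hab]]] := qN (wedge_orth l (projw *m z)) (wedge_orth l v1)
    (qll wz wz) (qll wz wv1) (qll wv1 wv1).
  have [a0|a0] := eqVneq a 0.
    rewrite a0 eqxx /= in ab; rewrite a0 scale0r add0r in hab.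
    by case: nv1; exact: hZi hab.
  exists (- (a^-1 * b)); apply: (hZi a0).
  by rewrite scaleNr opprK wedgeDr wedgeZr scalerDr scalerA mulrA mulfV // mul1r.
have uniq z m m' : h (wedge l (z - m *: v1)) -> h (wedge l (z - m' *: v1)) -> m = m'.
  move=> h1 h2; apply/eqP; apply: contrapT => /negP mm; case: nv1.
  apply: (@hZi (m - m')); first by rewrite subr_eq0.
  have := hBr h2 h1; congr (h _); rewrite -wedgeNr -wedgeDr -wedgeZr; congr (wedge l _).
  by apply/matrixP => i j; rewrite !mxE; ring.
pose mu z := projT1 (cid (ex z)).
have muP z : h (wedge l (projw *m z - mu z *: v1)) := projT2 (cid (ex z)).
have muL a x y : mu (a *: x + y) = a * mu x + mu y.
  apply: (uniq (projw *m (a *: x + y))); first exact: muP.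
  have -> : projw *m (a *: x + y) - (a * mu x + mu y) *: v1 =
    a *: (projw *m x - mu x *: v1) + (projw *m y - mu y *: v1).
    rewrite mulmxDr -scalemxAr scalerBr scalerDl scalerA opprD addrACA //.
  by rewrite wedgeDr wedgeZr; exact: hL.
(* The linear form [mu] represented by a vector for [bf]; the factor [sgn i] cancels the sign in the
   form. *)
pose r : 'cV[R]_(1 + n) := \col_i (sgn i * mu (delta_mx i 0)).
have lin : linear (mu : _ -> R^o) by move=> a x y; rewrite muL.
pose dlM := GRing.isLinear.Build _ _ _ _ _ lin.
pose dL : {linear 'cV[R]_(1 + n) -> R^o} := HB.pack mu dlM.
have rE z : bf r z = mu z.
  have zE : z = \sum_i z i 0 *: delta_mx i 0.
    by rewrite {1}[z]matrix_sum_delta; apply: eq_bigr => i _; rewrite big_ord1.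
  rewrite -[RHS]/(dL z) {2}zE linear_sum bfE; apply: eq_bigr => i _.
  have -> : dL (z i 0 *: delta_mx i 0) = z i 0 * mu (delta_mx i 0) by exact: (linearZ_LR dL).
  by rewrite /r mxE !mulrA sgn_sq mul1r mulrC.
have mu0 w : wperp w -> (h (wedge l w) <-> mu w = 0).
  move=> ww; have := muP w; rewrite projw_id // => hw; split=> [h1|E].
    by apply: (uniq w) => //; rewrite scale0r subr0.
  by move: hw; rewrite E scale0r subr0.
have wr : wperp r.
  split; rewrite bfC rE.
    by apply: (uniq (projw *m l)); [exact: muP|rewrite projw_l scale0r subr0 wedge0r].
  by apply: (uniq (projw *m l')); [exact: muP|rewrite projw_l' scale0r subr0 wedge0r].
have r0 : r != 0.
  apply/eqP => r0; case: nv1; apply/(mu0 _ wv1).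
  by rewrite -rE r0 bf0l.
have c0 := wperp_pos wr r0.
pose k := Num.sqrt (bf r r).
have k0 : k != 0 by rewrite gt_eqF // sqrtr_gt0.
have kk : k ^+ 2 = bf r r by rewrite sqr_sqrtr // ltW.
exists (k^-1 *: r); split.
- exact: wperpZ.
- rewrite !bflin -kk; field.
  exact: k0.
- move=> w ww; rewrite bfZl rE mu0 //; split=> [->|/eqP]; first by rewrite mulr0.
  by rewrite mulf_eq0 invr_eq0 (negbTE k0) => /eqP.
Qed.

Lemma commx_add U V W : commx U (V + W) = commx U V + commx U W.
Proof. by rewrite /commx mulmxDr mulmxDl opprD addrACA. Qed.

Lemma commx_scale a U V : commx U (a *: V) = a *: commx U V.
Proof. by rewrite /commx -scalemxAr -scalemxAl scalerBr. Qed.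

(** With v from [half_normal], the l ^ w in [h] are those with w orthogonal to v. Double brackets
    with such an l ^ x carry l' ^ y to a multiple of l ^ y modulo [h], so y must be orthogonal to v
    here too; conversely the isotropic planes of weight vectors show that all these l' ^ y occur.
    Together they generate the stabilizer of v. A further element would give some z ^ v in [h] with
    z nonzero and orthogonal to v, which is excluded. *)
Lemma spacelike_case v1 : wperp v1 -> ~ h (wedge l v1) -> h (wedge l' l) ->
  exists2 s, bf s s = 1 & forall Z, oalg Z -> (h Z <-> Z *m s = 0).
Proof.
move=> wv1 nv1 hA; have [v [wv vv hv]] := half_normal wv1 nv1.
have [v2 v3] := wv.
have nv : ~ h (wedge l v) by move=> /(hv _ wv) E; move: (oner_eq0 R); rewrite -vv E eqxx.
have [x x0 [x1 x2 x3]] := orth3 l l' v n3.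
have wx : wperp x by [].
have hx : h (wedge l x) by apply/hv.
have p := wperp_pos wx x0.
have sub1 y : wperp y -> h (wedge l' y) -> bf v y = 0.
  move=> wy hy; apply/hv => //.
  have := hB hx (hB hx hy); rewrite bracket_lxly // wedgeZr => /(hZi ll').
  rewrite wedgeDr wedgeNr !wedgeDr !wedgeZr => H.
  apply: (@hZi (bf x x)); first by rewrite gt_eqF.
  have H' := hN H; rewrite opprD opprK addrC in H'; apply: (hDi _ H').
  by apply: hN; apply: hD; exact: hZ.
have sub2 y : wperp y -> bf v y = 0 -> h (wedge l' y).
  move=> wy vy.
  have [a [b [ab hab]]] := qN (wedge_orth l' y) (wedge_orth l' v)
    (weight_q hA wy wy) (weight_q hA wy wv) (weight_q hA wv wv).
  have b0 : b = 0.
    have := sub1 (a *: y + b *: v); rewrite !bflin vy vv mulr0 add0r mulr1; apply.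
      by apply: wperpL => //; exact: wperpZ.
    by rewrite wedgeDr !wedgeZr.
  rewrite b0 eqxx orbF in ab; rewrite b0 scale0r addr0 in hab.
  exact: hZi hab.
have nv' : ~ h (wedge l' v) by move=> /(sub1 _ wv) E; move: (oner_eq0 R); rewrite -vv E eqxx.
have hA' : h (wedge l l') by rewrite wedgeC; exact: hN.
have gen u (hu : h (wedge u l)) (hu' : h (wedge u l')) :
    (forall y, wperp y -> bf v y = 0 -> h (wedge u y)) -> forall y, bf v y = 0 -> h (wedge u y).
  move=> hp y vy.
  have vp : bf v (projw *m y) = 0.
    by rewrite projwE !bflin vy (bfC v l) (bfC v l') v2 v3 !mulr0 addr0 mulr0 subr0.
  rewrite (decomp y) !(wedgeDr, wedgeZr).
  apply: hD; first by apply: hp => //; exact: projw_perp.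
  by apply: hZ; apply: hD; exact: hZ.
have H1 : forall y, bf v y = 0 -> h (wedge l y).
  by apply: gen => //; [rewrite wedgexx|move=> y wy vy; apply/hv].
have H2 : forall y, bf v y = 0 -> h (wedge l' y).
  by apply: gen => //; rewrite wedgexx.
have vl : bf v l = 0 by rewrite bfC.
have vl' : bf v l' = 0 by rewrite bfC.
have H3 u y : wperp u -> bf v u = 0 -> bf v y = 0 -> h (wedge u y).
  move=> wu vu; move: y; apply: gen.
  - by rewrite wedgeC; exact/hN/H1.
  - by rewrite wedgeC; exact/hN/H2.
  - by move=> y wy vy; apply: h_wedge_perp => //; [exact: H1|exact: H2].
have H4 u y : bf v u = 0 -> bf v y = 0 -> h (wedge u y).
  move=> vu vy; rewrite wedgeC; apply: hN; move: u vu; apply: gen.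
  - by rewrite wedgeC; exact/hN/H1.
  - by rewrite wedgeC; exact/hN/H2.
  - by move=> u wu vu; rewrite wedgeC; exact/hN/H3.
have kill Z : oalg Z -> Z *m v = 0 -> h Z.
  move=> oZ Zv; pose P : 'M[R]_(1 + n) := 1%:M - v *m (v^T *m eta).
  have PE z : P *m z = z - bf v z *: v.
    by rewrite /P mulmxBl mul1mx -!mulmxA (mulmxA _ eta z) [v^T *m eta *m z]mx11_scalar mul_mx_scalar.
  apply: (span_wedge_in h0 hL oZ (P := P)).
  - rewrite /P [(_ - _)^T]linearB /= trmx1 mulmxBr mulmx1 mulmxBl sig_sq; congr (_ - _).
    by rewrite !trmx_mul !trmxK sig_tr !mulmxA sig_sq mul1mx.
  - by rewrite /P mulmxBr mulmx1 !mulmxA Zv !mul0mx subr0.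
  - rewrite /P mulmxBl mul1mx -!mulmxA ((orthP Z).1 oZ) !mulmxN (mulmxA v^T) -trmx_mul Zv.
    by rewrite trmx0 !mul0mx mulmx0 oppr0 subr0.
  - by move=> y z; apply: H4; rewrite PE !bflin vv mulr1 subrr.
exists v => // Z oZ; split; last exact: kill.
move=> hZ0; pose z := Z *m v.
have vz : bf v z = 0 by exact: orth_self.
have hz : h (wedge z v).
  rewrite -[X in h X]opprK; apply: hN; apply: (hDi hZ0); rewrite addrC; apply: kill.
    by rewrite -scaleN1r addrC; apply: orthL => //; exact: wedge_orth.
  by rewrite mulmxBl wedge_mul vv (bfC z v) vz scale1r scale0r subr0 subrr.
have zE := decomp z.
set w := projw *m z in zE.
have ww : wperp w by exact: projw_perp.
pose c := (bf l l')^-1 * bf l' z; pose c' := (bf l l')^-1 * bf l z.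
have {}zE : z = w + (c *: l + c' *: l') by rewrite [LHS]zE scalerDr !scalerA.
(* The components of z along l and l' have opposite weights under the boost, and the rest has weight
   0. Combining one and two brackets isolates the first two. *)
have ad1 : commx (wedge l' l) (wedge z v) = (c' * bf l l') *: wedge l' v - (c * bf l l') *: wedge l v.
  rewrite (commx_wedge _ _ (wedge_orth _ _)) !wedge_mul v2 v3 !scale0r subr0 wedge0r addr0.
  rewrite zE !bflin ww.1 ww.2 ll l'l' (bfC l' l) !mulr0 !add0r !addr0.
  by rewrite wedgeDl wedgeNl !wedgeZl.
have ad2 : commx (wedge l' l) (commx (wedge l' l) (wedge z v)) =
   (c' * bf l l' ^+ 2) *: wedge l' v + (c * bf l l' ^+ 2) *: wedge l v.
  rewrite ad1 -scaleNr commx_add !commx_scale weight_l' //.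
  rewrite (commx_wedge _ _ (wedge_orth _ _)) !wedge_mul v2 v3 ll (bfC l' l) !scale0r sub0r subr0 wedge0r addr0.
  by rewrite wedgeNl wedgeZl; apply/matrixP => i j; rewrite !mxE; ring.
have h1 := hB hA hz; have h2 := hB hA h1.
rewrite ad2 in h2; rewrite ad1 in h1.
have c'0 : c' = 0.
  apply/eqP; apply: contrapT => /negP c'0; case: nv'.
  apply: (@hZi (2 * c' * bf l l' ^+ 2)); first by apply: mulf_neq0; [apply: mulf_neq0 => //; rewrite pnatr_eq0|exact: expf_neq0].
  have := hD h2 (hZ (bf l l') h1); congr (h _).
  by apply/matrixP => i j; rewrite !mxE; ring.
have c0 : c = 0.
  apply/eqP; apply: contrapT => /negP c0; case: nv.
  apply: (@hZi (2 * c * bf l l' ^+ 2)); first by apply: mulf_neq0; [apply: mulf_neq0 => //; rewrite pnatr_eq0|exact: expf_neq0].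
  have := hBr h2 (hZ (bf l l') h1); congr (h _).
  by apply/matrixP => i j; rewrite !mxE; ring.
have {}zE : z = w by rewrite zE c0 c'0 !scale0r !addr0.
have vw : bf v w = 0 by rewrite -zE.
apply/eqP; apply: contrapT => /negP z0; case: nv.
have pw : 0 < bf w w by apply: wperp_pos => //; rewrite -zE.
have := hB hz (H1 _ vw); rewrite zE (commx_wedge _ _ (wedge_orth _ _)) !wedge_mul.
rewrite (bfC w l) (bfC v l) ww.1 v2 !scale0r subrr wedge0l add0r vw scale0r sub0r wedgeNr wedgeZr => H.
apply: (@hZi (bf w w)); first by rewrite gt_eqF.
by rewrite -[X in h X]opprK; exact: hN.
Qed.

End Partner.

(** l ^ w depends on w only modulo l, so the hypotheses on the l ^ w do not depend on the null
    partner [l']. *)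
Lemma wperp_shift l' w : bf l w = 0 -> bf l l' != 0 ->
  exists2 w', wperp l' w' & wedge l w = wedge l w'.
Proof.
move=> lw ll'; exists (w - (bf l l')^-1 * bf l' w *: l); last first.
  by rewrite wedgeDr wedgeNr wedgeZr wedgexx scaler0 subr0.
split; rewrite !bflin ?lw ?ll ?(bfC l' l); first by ring.
by field.
Qed.

Theorem classification l' : bf l l' != 0 -> bf l' l' = 0 ->
  (forall w w', wperp l' w -> wperp l' w' -> q (wedge l w) (wedge l w') = 0) ->
  (forall w, wperp l' w -> q (wedge l w) (wedge l' l) = 0) ->
  [\/ forall Z, oalg Z -> h Z,
      exists2 s, bf s s = 1 & forall Z, oalg Z -> (h Z <-> Z *m s = 0) |
      forall Z, oalg Z -> (h Z <-> Z *m l = 0)].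
Proof.
move=> ll' l'l' qll qlA.
have [hl|] := pselect (forall w, wperp l' w -> h (wedge l w)).
  have [hA|nA] := pselect (h (wedge l' l)).
    by apply: Or31; exact: (full_case ll' l'l' hl hA).
  by apply: Or33; exact: (null_case ll' l'l' hl nA).
move=> /existsNP [v /not_implyP [wv nv]]; apply: Or32.
have [c hc] := half_case_boost ll' qll wv nv (qlA v wv).
pose b := bf l l'.
(* [l2] is chosen so that the element l' ^ l + c l ^ v of [h] becomes the pure boost l2 ^ l. Adding
   a multiple of l does not affect this, and [d] makes [l2] null. *)
pose d := - (c ^+ 2 * bf v v - 2 * c * bf l' v) / (2 * b).
pose l2 := l' - c *: v + d *: l.
have [v1 v2] := wv.
have ll2 : bf l l2 = b by rewrite /l2 !bflin v1 ll /b; ring.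
have l2l2 : bf l2 l2 = 0.
  rewrite /l2 !bflin l'l' ll (bfC v l') (bfC v l) v1 v2 (bfC l' l) -/b /d v2; field.
  exact: ll'.
have hA2 : h (wedge l2 l).
  move: hc; congr (h _); rewrite /l2 !(wedgeDl, wedgeZl, wedgeNl) wedgexx scaler0 addr0.
  by rewrite (wedgeC v l) scalerN opprK.
have ll2' : bf l l2 != 0 by rewrite ll2.
have qll2 w w' : wperp l2 w -> wperp l2 w' -> q (wedge l w) (wedge l w') = 0.
  move=> [w1 _] [w1' _].
  have [u wu ->] := wperp_shift w1 ll'; have [u' wu' ->] := wperp_shift w1' ll'.
  exact: qll.
have [v' wv' Ev] := wperp_shift v1 ll2'.
by apply: (spacelike_case ll2' l2l2 qll2 wv' _ hA2); rewrite -Ev.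
Qed.
End Classification.

(** * Stabilizers of vectors in o(1,n) *)

Section LieIsomorphisms.
Context {R : realType}.

Lemma lie_isomorphic_trans (V W X : lmodType R) (bV : V -> V -> V) (A : set V)
    (bW : W -> W -> W) (B : set W) (bX : X -> X -> X) (C : set X) :
  lie_isomorphic bV A bW B -> lie_isomorphic bW B bX C -> lie_isomorphic bV A bX C.
Proof.
move=> [sA _ [f [fb fl fbr]]] [sB sC [g [gb gl gbr]]]; split=> //.
have fAB u : A u -> B (f u) by case: fb => h _ _; exact: h.
exists (g \o f); split; first exact: set_bij_comp fb gb.
- by move=> a u v Au Av /=; rewrite fl // gl //; exact: fAB.
- by move=> u v Au Av /=; rewrite fbr // gbr //; exact: fAB.
Qed.

Definition stab_alg n (s : 'cV[R]_(1 + n)) : set 'M[R]_(1 + n) :=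
  [set Z | orth_alg R 1 n Z /\ Z *m s = 0].

Lemma stab_alg_subalgebra n (s : 'cV[R]_(1 + n)) : lie_subalgebra (@commx R (1 + n)) (stab_alg s).
Proof.
split.
- by split; [exact: orth0|rewrite mul0mx].
- move=> a u v [ou us] [ov vs]; split; first exact: orthL.
  by rewrite mulmxDl -scalemxAl us vs scaler0 addr0.
- move=> u v [ou us] [ov vs]; split; first exact: orth_commx.
  by rewrite /commx mulmxBl -!mulmxA us vs !mulmx0 subrr.
Qed.

Lemma orth_alg_subalgebra n : lie_subalgebra (@commx R (1 + n)) (orth_alg R 1 n).
Proof.
split; [exact: orth0|by move=> a u v; exact: orthL|by move=> u v; exact: orth_commx].
Qed.

Lemma orth_entry n (Z : 'M[R]_(1 + n)) :
  orth_alg R 1 n Z <-> forall i j, sgn i * Z i j = - (sgn j * Z j i).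
Proof.
split=> [/orthP h i j|h].
  have := congr1 (fun M : 'M[R]_(1 + n) => M i j) h.
  by rewrite mul_sigE [in RHS]mxE mulmx_sigE mxE [_ * sgn j]mulrC.
by apply/orthP/matrixP => i j; rewrite mul_sigE [RHS]mxE mulmx_sigE mxE [_ * sgn j]mulrC.
Qed.

Lemma mx_ext n (A B : 'M[R]_n) : (forall z : 'cV[R]_n, A *m z = B *m z) -> A = B.
Proof.
move=> h; apply/matrixP => i j; have := h (delta_mx j 0).
by rewrite -!colE => /(congr1 (fun M : 'cV[R]_n => M i 0)); rewrite !mxE.
Qed.

Definition reflection n (w : 'cV[R]_(1 + n)) : 'M[R]_(1 + n) :=
  1%:M - (2 / bf w w) *: (w *m (w^T *m sig_mx R 1 n)).

Lemma reflectionE n (w z : 'cV[R]_(1 + n)) :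
  reflection w *m z = z - (2 / bf w w * bf w z) *: w.
Proof.
rewrite /reflection mulmxBl mul1mx -scalemxAl -!mulmxA (mulmxA _ (sig_mx _ _ _) z).
by rewrite [w^T *m _ *m z]mx11_scalar mul_mx_scalar scalerA.
Qed.

Lemma reflection_sq n (w : 'cV[R]_(1 + n)) : bf w w != 0 ->
  reflection w *m reflection w = 1%:M.
Proof.
move=> w0; apply: mx_ext => z; rewrite mul1mx -mulmxA !reflectionE !bflin.
apply/matrixP => i j; rewrite !mxE; field.
exact: w0.
Qed.

Lemma reflection_adj n (w : 'cV[R]_(1 + n)) :
  (reflection w)^T *m sig_mx R 1 n = sig_mx R 1 n *m reflection w.
Proof.
rewrite /reflection [(_ - _)^T]linearB /= trmx1 mulmxBl mulmxBr mul1mx mulmx1; congr (_ - _).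
by rewrite linearZ /= !trmx_mul !trmxK sig_tr -scalemxAl -scalemxAr !mulmxA.
Qed.

(** The conditions on [T] say that it is an involution and self-adjoint for the form, hence an
    isometry equal to its own inverse; the isomorphism is conjugation by it. *)
Lemma stab_alg_conj n (T : 'M[R]_(1 + n)) s : T *m T = 1%:M ->
  T^T *m sig_mx R 1 n = sig_mx R 1 n *m T ->
  lie_isomorphic (@commx R (1 + n)) (stab_alg s) (@commx R (1 + n)) (stab_alg (T *m s)).
Proof.
move=> TT adj; split; [exact: stab_alg_subalgebra|exact: stab_alg_subalgebra|].
have cT (Z : 'M[R]_(1 + n)) : T *m (T *m Z *m T) *m T = Z.
  by rewrite !mulmxA TT mul1mx -mulmxA TT mulmx1.
have oT Z : orth_alg R 1 n Z -> orth_alg R 1 n (T *m Z *m T).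
  move=> /orthP oZ; apply/orthP; rewrite !trmx_mul !mulmxA -adj -(mulmxA T^T) oZ.
  by rewrite mulmxN mulNmx -!mulmxA adj.
exists (fun Z => T *m Z *m T); split.
- split.
  + move=> Z [oZ Zs]; split; first exact: oT.
    by rewrite -!mulmxA (mulmxA T T) TT mul1mx Zs mulmx0.
  + by move=> Z U _ _ /(congr1 (fun M => T *m M *m T)); rewrite !cT.
  + move=> Z [oZ Zs]; exists (T *m Z *m T); last exact: cT.
    by split; [exact: oT|rewrite -!mulmxA Zs mulmx0].
- by move=> a u v _ _; rewrite mulmxDr mulmxDl -scalemxAr -scalemxAl.
- move=> u v _ _; rewrite /commx mulmxBr mulmxBl; congr (_ - _);
    by rewrite -!mulmxA (mulmxA T T) TT mul1mx.
Qed.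

Lemma stab_alg_scale n (s : 'cV[R]_(1 + n)) a : a != 0 -> stab_alg (a *: s) = stab_alg s.
Proof.
move=> a0; apply/seteqP; split=> Z [oZ Zs]; split=> //; last by rewrite -scalemxAr Zs scaler0.
by move: Zs; rewrite -scalemxAr => /eqP; rewrite scaler_eq0 (negbTE a0) => /eqP.
Qed.

(** The reflection along s - e exchanges s and e, provided s - e has nonzero square. If not, s + e
    has, and the reflection along it sends s to - e, which has the same stabilizer as e. *)
Lemma spacelike_normal n (s e : 'cV[R]_(1 + n)) : bf s s = 1 -> bf e e = 1 ->
  lie_isomorphic (@commx R (1 + n)) (stab_alg s) (@commx R (1 + n)) (stab_alg e).
Proof.
move=> ss ee.
have [ww|ww] := eqVneq (bf (s - e) (s - e)) 0; last first.
  have Ts : reflection (s - e) *m s = e.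
    rewrite reflectionE; move: ww; rewrite !bflin ss ee (bfC e s) => ww.
    apply/matrixP => i j; rewrite !mxE; field.
    by apply: contraNN ww => /eqP h; apply/eqP; lra.
  by have := stab_alg_conj s (reflection_sq ww) (reflection_adj _); rewrite Ts.
have se : bf s e = 1 by move: ww; rewrite !bflin ss ee (bfC e s); lra.
have ww' : bf (s + e) (s + e) != 0.
  by rewrite !bflin ss ee (bfC e s) se; apply/eqP; lra.
have Ts : reflection (s + e) *m s = - 1 *: e.
  rewrite reflectionE; move: ww'; rewrite !bflin ss ee (bfC e s) se => ww'.
  apply/matrixP => i j; rewrite !mxE; field.
  by [].
have h := stab_alg_conj s (reflection_sq ww') (reflection_adj _).
by rewrite Ts stab_alg_scale ?oppr_eq0 ?oner_eq0 in h.
Qed.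

(** If [bf s e] is nonzero, the reflection along s - e exchanges the two vectors; otherwise they are
    orthogonal null vectors, hence proportional. *)
Lemma null_normal n (s e : 'cV[R]_(1 + n)) : bf s s = 0 -> bf e e = 0 ->
  s 0 0 != 0 -> e 0 0 != 0 ->
  lie_isomorphic (@commx R (1 + n)) (stab_alg s) (@commx R (1 + n)) (stab_alg e).
Proof.
move=> ss ee s0 e0.
have [se|se] := eqVneq (bf s e) 0; last first.
  have ww : bf (s - e) (s - e) != 0.
    by rewrite !bflin ss ee (bfC e s); apply: contraNN se => /eqP h; apply/eqP; lra.
  have Ts : reflection (s - e) *m s = e.
    rewrite reflectionE; move: ww; rewrite !bflin ss ee (bfC e s) => ww.
    apply/matrixP => i j; rewrite !mxE; field.
    by apply: contraNN ww => /eqP h; apply/eqP; lra.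
  by have := stab_alg_conj s (reflection_sq ww) (reflection_adj _); rewrite Ts.
have z0 : (s 0 0 *: e - e 0 0 *: s) 0 0 = 0 by rewrite !mxE; ring.
have /eqP := bf_space0 z0 (etrans (bf_null_orth s0 ss se) (etrans (congr1 _ ee) (mulr0 _))).
rewrite subr_eq0 => /eqP E.
have <- : stab_alg s = stab_alg e.
  by rewrite -(stab_alg_scale e s0) E stab_alg_scale.
have := stab_alg_conj (T := 1%:M) s; rewrite !mul1mx trmx1 mul1mx mulmx1; exact.
Qed.

Section Corner.
Variable k : nat.
Local Notation N := (1 + k.+1)%N.

Definition last_ix : 'I_N := (ord_max : 'I_(1 + k).+1).
Definition init_ix (i : 'I_(1 + k)) : 'I_N := lift (ord_max : 'I_(1 + k).+1) i.

Lemma sum_init (V : nmodType) (f : 'I_N -> V) :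
  \sum_i f i = \sum_(i < 1 + k) f (init_ix i) + f last_ix.
Proof.
rewrite (big_ord_recr (1 + k)); congr (_ + _); apply: eq_bigr => i _; congr (f _).
by apply: val_inj; rewrite /= /bump leqNgt ltn_ord.
Qed.

Lemma sgn_init i : sgn (init_ix i) = sgn i :> R.
Proof. by rewrite /sgn /= /bump leqNgt ltn_ord. Qed.

Lemma sgn_last : sgn last_ix = 1 :> R.
Proof. by []. Qed.

Lemma ix_case (P : 'I_N -> Prop) : (forall i, P (init_ix i)) -> P last_ix -> forall i, P i.
Proof.
move=> h1 h2 i; case: (unliftP (ord_max : 'I_(1 + k).+1) i) => [j ->|->] //.
Qed.

Definition extend (T : Type) (f : 'I_(1 + k) -> T) (a : T) (i : 'I_N) : T :=
  if unlift (ord_max : 'I_(1 + k).+1) i is Some j then f j else a.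

Lemma extend_init T (f : 'I_(1 + k) -> T) a i : extend f a (init_ix i) = f i.
Proof. by rewrite /extend /init_ix liftK. Qed.

Lemma extend_last T (f : 'I_(1 + k) -> T) a : extend f a last_ix = a.
Proof. by rewrite /extend /last_ix unlift_none. Qed.

Definition e_last : 'cV[R]_N := delta_mx last_ix 0.

Lemma bf_e_last : bf e_last e_last = 1.
Proof.
rewrite bfE (bigD1 last_ix) //= big1 => [|i ni]; last by rewrite !mxE (negbTE ni) mul0r mulr0.
by rewrite !mxE eqxx sgn_last mul1r mulr1 addr0.
Qed.

(** An element killing [e_last] has zero last column and, by skewness, zero last row; the remaining
    block is arbitrary in o(1,k). *)
Lemma stab_spacelike_std :
  lie_isomorphic (@commx R N) (stab_alg e_last) (@commx R (1 + k)) (orth_alg R 1 k).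
Proof.
split; [exact: stab_alg_subalgebra|exact: orth_alg_subalgebra|].
pose F (Z : 'M[R]_N) : 'M[R]_(1 + k) := \matrix_(i, j) Z (init_ix i) (init_ix j).
have colz Z i : stab_alg e_last Z -> Z i last_ix = 0.
  by move=> [_]; rewrite -colE => /(congr1 (fun M : 'cV[R]_N => M i 0)); rewrite !mxE.
have rowz Z i : stab_alg e_last Z -> Z last_ix i = 0.
  move=> hZ; have [/orth_entry oZ _] := hZ; have := oZ last_ix i.
  by rewrite sgn_last mul1r colz // mulr0 oppr0.
exists F; split.
- split.
  + move=> Z [/orth_entry oZ _]; apply/orth_entry => i j; rewrite !mxE.
    by have := oZ (init_ix i) (init_ix j); rewrite !sgn_init.
  + move=> Z U /set_mem hZ /set_mem hU E; apply/matrixP => i j.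
    elim/ix_case: i => [i|]; last by rewrite !rowz.
    elim/ix_case: j => [j|]; last by rewrite !colz.
    by have := congr1 (fun M : 'M[R]_(1 + k) => M i j) E; rewrite !mxE.
  + move=> B /orth_entry oB.
    pose Z : 'M[R]_N := \matrix_(i, j) extend (fun i' => extend (fun j' => B i' j') 0 j) 0 i.
    exists Z; last first.
      by apply/matrixP => i j; rewrite !mxE !extend_init.
    split.
      apply/orth_entry => i j; rewrite !mxE.
      elim/ix_case: i => [i|]; elim/ix_case: j => [j|];
        rewrite ?extend_init ?extend_last ?extend_init ?mulr0 ?oppr0 // !sgn_init.
      exact: oB.
    apply/matrixP => i j; rewrite -colE !mxE.
    by elim/ix_case: i => [i|]; rewrite ?extend_init ?extend_last.
- by move=> a u v _ _; apply/matrixP => i j; rewrite !mxE.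
- move=> u v hu hv; apply/matrixP => i j; rewrite !mxE !sum_init !colz // !mul0r !addr0.
  by congr (_ - _); apply: eq_bigr => a _; rewrite !mxE.
Qed.

Definition mid_ix (a : 'I_k) : 'I_N := init_ix (lift (ord0 : 'I_k.+1) a).
Definition first_ix : 'I_N := init_ix (ord0 : 'I_k.+1).

Lemma sum_mid (V : nmodType) (f : 'I_N -> V) :
  \sum_i f i = f first_ix + \sum_(a < k) f (mid_ix a) + f last_ix.
Proof. by rewrite sum_init (big_ord_recl k). Qed.

Lemma sgn_first : sgn first_ix = -1 :> R.
Proof. by rewrite sgn_init. Qed.

Lemma sgn_mid a : sgn (mid_ix a) = 1 :> R.
Proof. by rewrite sgn_init. Qed.

Lemma mid_case (P : 'I_N -> Prop) : P first_ix -> (forall a, P (mid_ix a)) -> P last_ix ->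
  forall i, P i.
Proof.
move=> h1 h2 h3; apply: ix_case => // i.
by case: (unliftP (ord0 : 'I_k.+1) i) => [j ->|->]; [exact: h2|exact: h1].
Qed.

Definition extend3 (T : Type) (b : T) (f : 'I_k -> T) (a : T) (i : 'I_N) : T :=
  extend (fun j : 'I_(1 + k) => if unlift (ord0 : 'I_k.+1) j is Some c then f c else b) a i.

Lemma extend3_first T (b : T) f a : extend3 b f a first_ix = b.
Proof. by rewrite /extend3 extend_init unlift_none. Qed.
Lemma extend3_mid T (b : T) f a c : extend3 b f a (mid_ix c) = f c.
Proof. by rewrite /extend3 extend_init liftK. Qed.
Lemma extend3_last T (b : T) f a : extend3 b f a last_ix = a.
Proof. by rewrite /extend3 extend_last. Qed.

Definition e_null : 'cV[R]_N := delta_mx first_ix 0 + delta_mx last_ix 0.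

Lemma bf_e_null : bf e_null e_null = 0.
Proof.
have fl : (first_ix == last_ix) = false by apply/negbTE/eqP => /(congr1 val).
rewrite bfE sum_mid big1 => [|a _].
  by rewrite !mxE !eqxx [last_ix == _]eq_sym fl sgn_first sgn_last /=; ring.
have vm : mid_ix a = a.+1 :> nat by rewrite /mid_ix /init_ix lift_max lift0.
have m1 : (mid_ix a == first_ix) = false.
  apply/negbTE/eqP => E; have := congr1 (@nat_of_ord _) E.
  by rewrite vm /first_ix /init_ix lift_max.
have m2 : (mid_ix a == last_ix) = false.
  apply/negbTE/eqP => E; have := congr1 (@nat_of_ord _) E; rewrite vm => -[{}E].
  by have := ltn_ord a; rewrite [X in (X < _)%N]E ltnn.
by rewrite !mxE m1 m2 /= addr0 mul0r mulr0.
Qed.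

Lemma euc_alg_subalgebra : lie_subalgebra (@euc_bracket R k) (euc_alg R k).
Proof.
split; rewrite /euc_alg /skew_alg /=.
- by rewrite trmx0 addr0.
- move=> a [A u] [B v] /= hA hB.
  by rewrite linearP /= addrACA -scalerDr hA hB scaler0 addr0.
- move=> [A u] [B v] /= /eqP hA /eqP hB.
  rewrite addr_eq0 in hA; rewrite addr_eq0 in hB.
  rewrite /commx linearB /= !trmx_mul (eqP hA) (eqP hB) !mulmxN !mulNmx !opprK.
  by rewrite addrA subrK subrr.
Qed.

(** Killing [e_null] makes the last column opposite to the first, and skewness determines the first
    and last rows. The middle block and the middle of the first column remain free: they are the
    parts in o(k) and in R^k. *)
Lemma stab_null_std :
  lie_isomorphic (@commx R N) (stab_alg e_null) (@euc_bracket R k) (euc_alg R k).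
Proof.
split; [exact: stab_alg_subalgebra|exact: euc_alg_subalgebra|].
pose F (Z : 'M[R]_N) : 'M[R]_k * 'cV[R]_k :=
  (\matrix_(a, b) Z (mid_ix a) (mid_ix b), \col_a Z (mid_ix a) first_ix).
have en Z i : stab_alg e_null Z -> Z i last_ix = - Z i first_ix.
  move=> [_]; rewrite /e_null mulmxDr -!colE => /(congr1 (fun M : 'cV[R]_N => M i 0)).
  by rewrite !mxE => /eqP; rewrite addrC addr_eq0 => /eqP.
have en00 Z : stab_alg e_null Z -> Z first_ix first_ix = 0.
  by move=> [/orth_entry /(_ first_ix first_ix) + _]; rewrite sgn_first; lra.
have enl0 Z : stab_alg e_null Z -> Z last_ix first_ix = 0.
  move=> hZ; have [/orth_entry /(_ last_ix last_ix) + _] := hZ.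
  by rewrite en // sgn_last; lra.
have en0m Z a : stab_alg e_null Z -> Z first_ix (mid_ix a) = Z (mid_ix a) first_ix.
  by move=> [/orth_entry /(_ first_ix (mid_ix a)) + _]; rewrite sgn_first sgn_mid; lra.
have enlm Z a : stab_alg e_null Z -> Z last_ix (mid_ix a) = Z (mid_ix a) first_ix.
  move=> hZ; have [/orth_entry /(_ last_ix (mid_ix a)) + _] := hZ.
  by rewrite sgn_last sgn_mid (en _ _ hZ); lra.
exists F; split.
- split.
  + move=> Z [/orth_entry oZ _]; rewrite /euc_alg /skew_alg /=; apply/matrixP => a b.
    by rewrite !mxE; have := oZ (mid_ix a) (mid_ix b); rewrite !sgn_mid; lra.
  + move=> Z U /set_mem hZ /set_mem hU [E1 E2]; apply/matrixP => i j.
    have e1 a b : Z (mid_ix a) (mid_ix b) = U (mid_ix a) (mid_ix b).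
      by have := congr1 (fun M : 'M[R]_k => M a b) E1; rewrite !mxE.
    have e2 a : Z (mid_ix a) first_ix = U (mid_ix a) first_ix.
      by have := congr1 (fun M : 'cV[R]_k => M a 0) E2; rewrite !mxE.
    by elim/mid_case: i => [|a|]; elim/mid_case: j => [|b|];
      rewrite ?(en _ _ hZ) ?(en _ _ hU) ?(en00 _ hZ) ?(en00 _ hU) ?(enl0 _ hZ) ?(enl0 _ hU)
        ?(en0m _ _ hZ) ?(en0m _ _ hU) ?(enlm _ _ hZ) ?(enlm _ _ hU) ?e1 ?e2.
  + move=> [A u]; rewrite /euc_alg /skew_alg /= => hA.
    have {}hA a b : A a b = - A b a.
      by have := congr1 (fun M : 'M[R]_k => M a b) hA; rewrite !mxE; lra.
    pose Z : 'M[R]_N := \matrix_(i, j) extend3 (extend3 0 (fun b => u b 0) 0 j)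
      (fun a => extend3 (u a 0) (fun b => A a b) (- u a 0) j) (extend3 0 (fun b => u b 0) 0 j) i.
    exists Z; last first.
      rewrite /F; congr (_, _); apply/matrixP => a b; rewrite !mxE !(extend3_mid, extend3_first) //.
      by rewrite ord1.
    split.
      apply/orth_entry => i j; rewrite !mxE.
      elim/mid_case: i => [|a|]; elim/mid_case: j => [|b|];
        rewrite !(extend3_mid, extend3_first, extend3_last, sgn_first, sgn_mid, sgn_last); try lra.
      by rewrite hA; lra.
    apply/matrixP => i j; rewrite /e_null mulmxDr -!colE !mxE.
    by elim/mid_case: i => [|a|]; rewrite !(extend3_mid, extend3_first, extend3_last); lra.
- move=> a u v _ _; rewrite /F; apply: injective_projections => /=;
    by apply/matrixP => i j; rewrite !mxE.
- move=> Z U hZ hU; rewrite /F /euc_bracket; congr (_, _); apply/matrixP => a b; rewrite !mxE !sum_mid.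
    rewrite !(en _ _ hZ) !(en _ _ hU) !(enlm _ _ hZ) !(enlm _ _ hU) !(en0m _ _ hZ) !(en0m _ _ hU).
    set s1 := \sum_(i < k) _; set s2 := \sum_(i < k) _; set t1 := \sum_j _; set t2 := \sum_j _.
    have -> : s1 = t1 by apply: eq_bigr => c _; rewrite !mxE.
    have -> : s2 = t2 by apply: eq_bigr => c _; rewrite !mxE.
    ring.
  rewrite (en00 _ hZ) (en00 _ hU) (enl0 _ hZ) (enl0 _ hU).
  set s1 := \sum_(i < k) _; set s2 := \sum_(i < k) _; set t1 := \sum_j _; set t2 := \sum_j _.
  have -> : s1 = t1 by apply: eq_bigr => c _; rewrite !mxE.
  have -> : s2 = t2 by apply: eq_bigr => c _; rewrite !mxE.
  ring.
Qed.

End Corner.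

End LieIsomorphisms.

(** * The Lie algebra of O(1,n) *)

Section Trigonometry.
Context {R : realType}.

(* [true] is the hyperbolic case, [false] the elliptic one: both functions solve
   f'' = kap b * f. *)
Definition kap (b : bool) : R := if b then 1 else -1.
Definition sfun (b : bool) (t : R) : R := if b then (expR t - expR (- t)) / 2 else sin t.
Definition cfun (b : bool) (t : R) : R := if b then (expR t + expR (- t)) / 2 else cos t.

Lemma sfun0 b : sfun b 0 = 0.
Proof. by case: b => /=; rewrite /sfun ?sin0 // oppr0 expR0 subrr mul0r. Qed.

Lemma cfun0 b : cfun b 0 = 1.
Proof. by case: b => /=; rewrite /cfun ?cos0 // oppr0 expR0; field. Qed.

Lemma sfunN b t : sfun b (- t) = - sfun b t.
Proof. by case: b => /=; rewrite /sfun ?sinN // opprK; ring. Qed.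

Lemma cfunN b t : cfun b (- t) = cfun b t.
Proof. by case: b => /=; rewrite /cfun ?cosN // opprK; ring. Qed.

Lemma sfunD b s t : sfun b (s + t) = sfun b s * cfun b t + sfun b t * cfun b s.
Proof.
case: b => /=; rewrite /sfun /cfun; last by rewrite sinD; ring.
by rewrite opprD !expRD; field.
Qed.

Lemma cfunD b s t : cfun b (s + t) = cfun b s * cfun b t + kap b * (sfun b s * sfun b t).
Proof.
case: b => /=; rewrite /sfun /cfun /kap; last by rewrite cosD; ring.
by rewrite opprD !expRD; field.
Qed.

Lemma derive_expRN (t : R) : is_derive t (1 : R) (fun s => expR (- s)) (- expR (- t)).
Proof.
have h : is_derive (- t) (1 : R) expR (expR (- t)) by exact: is_derive_expR.
have := is_derive1_comp h (is_deriveN (is_derive_id t 1)).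
by rewrite mulrN1.
Qed.

Lemma derive_sfun b (t : R) : is_derive t (1 : R) (sfun b) (cfun b t).
Proof.
case: b => /=; last exact: is_derive_sin.
rewrite /sfun /cfun.
have -> : (fun t : R => (expR t - expR (- t)) / 2) = (fun t => 2^-1 *: (expR t - expR (- t))).
  by apply/funext => s; rewrite mulrC.
have -> : (expR t + expR (- t)) / 2 = 2^-1 *: (expR t - - expR (- t)).
  by rewrite opprK mulrC.
apply: is_deriveZ; apply: is_deriveB; exact: derive_expRN.
Qed.

Lemma derive_cfun b (t : R) : is_derive t (1 : R) (cfun b) (kap b * sfun b t).
Proof.
case: b => /=; last by rewrite mulN1r; exact: is_derive_cos.
rewrite /sfun /cfun mul1r.
have -> : (fun t : R => (expR t + expR (- t)) / 2) = (fun t => 2^-1 *: (expR t + expR (- t))).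
  by apply/funext => s; rewrite mulrC.
have -> : (expR t - expR (- t)) / 2 = 2^-1 *: (expR t + - expR (- t)).
  by rewrite mulrC.
apply: is_deriveZ; apply: is_deriveD; exact: derive_expRN.
Qed.

Lemma is_diff_sfun b (t : R) :
  is_diff (t : R^o) (sfun b : R^o -> R^o) (fun v => cfun b t *: v).
Proof.
have [d1 d2] := (is_derive_diffE _ _ _).1 (derive_sfun b t).
apply: is_diff_ext (is_diff_self d1) => v.
by rewrite -{1}[v]mulr1 -[v * 1]/(v *: (1 : R^o)) linearZ_LR d2; exact: mulrC.
Qed.

Lemma is_diff_cfun b (t : R) :
  is_diff (t : R^o) (cfun b : R^o -> R^o) (fun v => sfun b t *: (kap b *: v)).
Proof.
have [d1 d2] := (is_derive_diffE _ _ _).1 (derive_cfun b t).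
apply: is_diff_ext (is_diff_self d1) => v.
rewrite -{1}[v]mulr1 -[v * 1]/(v *: (1 : R^o)) linearZ_LR d2.
by transitivity (v * (kap b * sfun b t)); [|transitivity (sfun b t * (kap b * v)); [ring|]].
Qed.

(** Both statements go together since each function is, up to a constant factor, the derivative of
    the other. *)
Lemma Ck_sfun_cfun b k : Ck k setT (sfun b : R^o -> R^o) /\ Ck k setT (cfun b : R^o -> R^o).
Proof.
have ds := is_diff_sfun b; have dc := is_diff_cfun b.
elim: k => [|k [IHs IHc]].
  split=> x _; [have [h _] := is_diffE (ds x)|have [h _] := is_diffE (dc x)];
    exact: differentiable_continuous h.
have oT : open [set: R^o] by exact: openT.
split; split.
- by move=> x _; have [h _] := is_diffE (ds x).
- move=> v; apply: (Ck_eq oT _ (Ck_scale oT IHc (Ck_cst k (v : R^o) oT))) => x _.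
  by have [_ ->] := is_diffE (ds x).
- by move=> x _; have [h _] := is_diffE (dc x).
- move=> v; apply: (Ck_eq oT _ (Ck_scale oT IHs (Ck_cst k (kap b *: v : R^o) oT))) => x _.
  by have [_ ->] := is_diffE (dc x).
Qed.

End Trigonometry.

Lemma is_diff_mx_coord {R : realType} (V : normedModType R) m n
    (f df : V -> 'M[R]_(m, n)) (x : V) i j :
  is_diff x f df -> is_diff x (fun y => f y i j) (fun y => df y i j).
Proof.
move=> h; apply: (is_diff_compose h (g := fun v : 'M[R]_(m, n) => v i j)
  (dg := fun v : 'M[R]_(m, n) => v i j)).
have cl : linear (fun v : 'M[R]_(m, n) => v i j : R^o) by move=> a u w; rewrite !mxE.
pose dlM := GRing.isLinear.Build _ _ _ _ _ cl.
pose dL : {linear 'M[R]_(m, n) -> R^o} := HB.pack (fun v : 'M[R]_(m, n) => v i j : R^o) dlM.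
by apply: (is_diff_linear (f := dL)); exact: coord_continuous.
Qed.

Section OrthogonalGroup.
Context {R : realType} {n : nat}.
Local Notation eta := (sig_mx R 1 n).
Implicit Types (X Z : 'M[R]_(1 + n)) (x y z : 'cV[R]_(1 + n)).

(* exp(t X) when X^3 = kap b *: X. *)
Definition cexp (b : bool) X (t : R) : 'M[R]_(1 + n) :=
  1%:M + sfun b t *: X + (kap b * (cfun b t - 1)) *: (X *m X).

Lemma cexpD b X s t : X *m X *m X = kap b *: X ->
  cexp b X (s + t) = cexp b X s *m cexp b X t.
Proof.
move=> X3.
have X3' : X *m (X *m X) = kap b *: X by rewrite mulmxA.
have X4 : X *m X *m (X *m X) = kap b *: (X *m X) by rewrite mulmxA X3 -scalemxAl.
rewrite /cexp !mulmxDl !mulmxDr !mul1mx !mulmx1 -!scalemxAl -!scalemxAr !scalerA X3 X3' X4.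
rewrite sfunD cfunD; move: (X *m X) => Y; apply/matrixP => i j; rewrite !mxE.
by case: b {X3 X3' X4}; rewrite /kap; ring.
Qed.

Lemma cexp0 b X : cexp b X 0 = 1%:M.
Proof. by rewrite /cexp sfun0 cfun0 subrr mulr0 !scale0r !addr0. Qed.

Lemma cexp_adj b X t : orth_alg R 1 n X -> (cexp b X t)^T *m eta = eta *m cexp b X (- t).
Proof.
move=> /orthP oX.
have -> : (cexp b X t)^T = 1%:M + sfun b t *: X^T + (kap b * (cfun b t - 1)) *: (X^T *m X^T).
  by rewrite /cexp !linearD /= !linearZ /= trmx1 trmx_mul.
rewrite /cexp sfunN cfunN !mulmxDl !mulmxDr mul1mx mulmx1.
have e : X^T *m eta = - (eta *m X) by rewrite oX opprK.
congr (_ + _ + _); first by rewrite -scalemxAl -scalemxAr e scaleNr scalerN.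
by rewrite -scalemxAl -scalemxAr -mulmxA e mulmxN mulmxA e mulNmx opprK mulmxA.
Qed.

Lemma cexp_orth b X t : X *m X *m X = kap b *: X -> orth_alg R 1 n X ->
  orth_group R 1 n (cexp b X t).
Proof.
move=> X3 oX; rewrite /orth_group /=.
by rewrite cexp_adj // -mulmxA -cexpD // addNr cexp0 mulmx1.
Qed.

Lemma smooth_cexp b X : smooth_on setT (cexp b X : R^o -> 'M[R]_(1 + n)).
Proof.
move=> k; have [hs hc] := @Ck_sfun_cfun R b k.
have oT : open [set: R^o] by exact: openT.
apply: Ck_add => //; first apply: Ck_add => //; first exact: Ck_cst.
  by apply: Ck_scale => //; exact: Ck_cst.
apply: (Ck_scale oT _ (Ck_cst _ _ oT)).
apply: (Ck_scale (V := R^o) (W := R^o) oT (Ck_cst k (kap b : R^o) oT)).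
exact: (Ck_add oT hc (Ck_cst k (-1 : R^o) oT)).
Qed.

Lemma diff_cexp0 b X : 'd (cexp b X : R^o -> 'M[R]_(1 + n)) 0 1 = X.
Proof.
have hs := is_diff_scale (is_diff_sfun b 0) (is_diff_const X (0 : R^o)).
have hc := is_diff_scale (is_diff_scale (is_diff_const (kap b : R^o) (0 : R^o))
  (is_diffB (is_diff_cfun b 0) (is_diff_const (1 : R^o) (0 : R^o)))) (is_diff_const (X *m X) (0 : R^o)).
have h := is_diffD (is_diffD (is_diff_const (1%:M : 'M[R]_(1 + n)) (0 : R^o)) hs) hc.
have [_ ->] := is_diffE h; rewrite !fctE /= sfun0 cfun0.
have sc (a c : R) : a *: (c : R^o) = a * c by [].
by apply/matrixP => i j; rewrite !mxE !sc; ring.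
Qed.

Lemma wedge_cube b x y : bf x y = 0 -> - (bf x x * bf y y) = kap b ->
  wedge x y *m wedge x y *m wedge x y = kap b *: wedge x y.
Proof.
move=> xy hb; apply: mx_ext => z; rewrite -!mulmxA -scalemxAl !wedge_mul !bflin xy (bfC y x) xy -hb.
move: (bf x z) (bf y z) (bf x x) (bf y y) => a c d e.
by apply/matrixP => i j; rewrite !mxE; ring.
Qed.

(** Orthogonality together with the group law reads [(gam t)^T *m eta = eta *m gam (- t)]; its
    derivative at 0 is the equation of the algebra. *)
Lemma lie_orth_group_sub Z : lie_mxgroup (orth_group R 1 n) Z -> orth_alg R 1 n Z.
Proof.
move=> [gam [sg gD gO <-]]; apply/orth_entry => i j.
have g0 : gam 0 = 1%:M.
  have := gD 0 0; rewrite addr0 => E0; have := gO 0; rewrite /orth_group /= => O0.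
  have u : (sig_mx R 1 n *m (gam 0)^T *m sig_mx R 1 n) *m gam 0 = 1%:M.
    by rewrite -!mulmxA (mulmxA (gam 0)^T) O0 sig_sq.
  by rewrite -[LHS]mul1mx -u -mulmxA -E0.
have adj t : (gam t)^T *m eta = eta *m gam (- t).
  rewrite -[LHS]mulmx1 -g0 -(subrr t) gD mulmxA; congr (_ *m _); exact: gO.
have dg : is_diff (0 : R^o) gam ('d gam 0) by apply: is_diff_self; exact: smooth_on_diff sg I.
have dgN : is_diff (0 : R^o) (fun t => gam (- t)) (fun v => 'd gam 0 (- v)).
  have := is_diffN (is_diff_ident (0 : R^o)) => h.
  by apply: (is_diff_compose h (g := gam)); rewrite /= fctE oppr0.
have d1 := is_diff_scale (is_diff_const (sgn j : R^o) (0 : R^o)) (is_diff_mx_coord j i dg).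
have d2 := is_diff_scale (is_diff_const (sgn i : R^o) (0 : R^o)) (is_diff_mx_coord i j dgN).
have E : (fun t => sgn j *: gam t j i) = (fun t => sgn i *: gam (- t) i j).
  apply/funext => t; have := congr1 (fun M : 'M[R]_(1 + n) => M i j) (adj t).
  by rewrite mulmx_sigE mul_sigE mxE mulrC.
rewrite E in d1.
have := congr1 (fun f => f 1) (is_diff_uniq d1 d2).
have lN : 'd gam 0 (- 1) = - 'd gam 0 1.
  have -> : (-1 : R^o) = (-1) *: (1 : R^o) by rewrite scaleN1r.
  by rewrite linearZ_LR; exact: scaleN1r.
rewrite !scale0r !add0r lN mxE => h.
have sc (a c : R) : a *: (c : R^o) = a * c by [].
by move: h; rewrite !sc => ->; rewrite mulrN opprK.
Qed.

(** That the velocities are closed under sums comes with the local isomorphism, so it is enough to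
    exhibit one-parameter groups for the bivectors of two basis vectors. Their cubes are multiples
    of themselves, and [cexp] provides the groups. *)
Lemma lie_orth_groupE : lie_subalgebra (@commx R (1 + n)) (lie_mxgroup (orth_group R 1 n)) ->
  lie_mxgroup (orth_group R 1 n) = orth_alg R 1 n.
Proof.
move=> [h0 hL _]; apply/seteqP; split=> [Z|Z oZ]; first exact: lie_orth_group_sub.
have hd i j : lie_mxgroup (orth_group R 1 n) (wedge (delta_mx i 0) (delta_mx j 0)).
  have [<-|ij] := eqVneq i j; first by rewrite wedgexx.
  have bd k l : bf (delta_mx k 0) (delta_mx l 0) = sgn k *+ (k == l) :> R.
    rewrite bfE (bigD1 k) //= big1 => [|m mk]; last by rewrite !mxE (negbTE mk) mul0r mulr0.
    by rewrite !mxE eqxx mul1r addr0 andbT mulr_natr.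
  pose b := sgn i != sgn j :> R.
  have hb : - (bf (delta_mx i 0) (delta_mx i 0) * bf (delta_mx j 0) (delta_mx j 0)) = kap b :> R.
    rewrite !bd !eqxx /b /kap /sgn; case: ifP => _; case: ifP => _; rewrite ?eqxx //=.
    - ring.
    - by rewrite (_ : -1 != 1) ?mulN1r ?opprK //; apply/eqP; lra.
    - by rewrite (_ : 1 != -1) ?mul1r ?opprK //; apply/eqP; lra.
    - ring.
  have bij : bf (delta_mx i 0) (delta_mx j 0) = 0 :> R by rewrite bd (negbTE ij).
  have X3 := wedge_cube bij hb.
  exists (cexp b (wedge (delta_mx i 0) (delta_mx j 0))); split.
  - exact: smooth_cexp.
  - by move=> s t; exact: cexpD.
  - by move=> t; apply: cexp_orth => //; exact: wedge_orth.
  - exact: diff_cexp0.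
apply: (@span_wedge_in _ _ _ Z 1%:M) => //.
- by rewrite trmx1 mulmx1 sig_sq.
- by rewrite mulmx1.
- by rewrite mul1mx.
move=> x y; rewrite !mul1mx.
have hcol (z : 'cV[R]_(1 + n)) : z = \sum_i z i 0 *: delta_mx i 0.
  by rewrite {1}(matrix_sum_delta z); apply: eq_bigr => i _; rewrite big_ord1.
have hD A B : lie_mxgroup (orth_group R 1 n) A -> lie_mxgroup (orth_group R 1 n) B ->
    lie_mxgroup (orth_group R 1 n) (A + B).
  by move=> hA hB'; rewrite -(scale1r A); exact: hL.
have hZ a A : lie_mxgroup (orth_group R 1 n) A -> lie_mxgroup (orth_group R 1 n) (a *: A).
  by move=> hA; rewrite -[_ *: _]addr0; exact: hL.
rewrite (hcol x); elim/big_ind: _ => [|u v hu hv|i _]; first by rewrite wedge0l.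
  by rewrite wedgeDl; exact: hD.
rewrite wedgeZl; apply: (hZ).
rewrite (hcol y); elim/big_ind: _ => [|u v hu hv|j _]; first by rewrite wedge0r.
  by rewrite wedgeDr; exact: hD.
by rewrite wedgeZr; exact: hZ.
Qed.

End OrthogonalGroup.

(** * The Cartan decomposition *)

Section WedgeConjugation.
Context {R : realType} {n : nat}.
Implicit Types (x y z : 'cV[R]_(1 + n)) (Z U : 'M[R]_(1 + n)).

(** This relation closes the conjugation formula: if the cube of a bivector is [kap b] times itself,
    its adjoint action satisfies the same cubic equation, see [commx_sandwich3]. *)
Lemma wedge_sandwich x y U : orth_alg R 1 n U ->
  wedge x y *m U *m wedge x y = bf y (U *m x) *: wedge x y.
Proof.
move=> oU; have s0 z : bf z (U *m z) = 0.
  by have := orth_bf z z oU; rewrite bfC; lra.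
have sxy : bf x (U *m y) = - bf y (U *m x) by rewrite bfC orth_bf.
apply: mx_ext => z; rewrite -!mulmxA -scalemxAl !wedge_mul mulmxBr -!scalemxAr !bflin !s0 sxy.
move: (bf x z) (bf y z) (bf y (U *m x)) => a b c.
by apply/matrixP => i j; rewrite !mxE; ring.
Qed.

Lemma commx_sandwich2 Z U (lam : R) : Z *m U *m Z = lam *: Z ->
  commx Z (commx Z U) = Z *m Z *m U + U *m Z *m Z - (2 * lam) *: Z.
Proof.
move=> ZUZ; rewrite /commx mulmxBr mulmxBl !mulmxA ZUZ.
by move: (Z *m Z *m U) (U *m Z *m Z) => A B; apply/matrixP => i j; rewrite !mxE; ring.
Qed.

Lemma commx_sandwich3 b Z U (lam : R) : Z *m Z *m Z = kap b *: Z -> Z *m U *m Z = lam *: Z ->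
  commx Z (commx Z (commx Z U)) = kap b *: commx Z U.
Proof.
move=> Z3 ZUZ.
have E1 : Z *m Z *m U *m Z = lam *: (Z *m Z) by rewrite -!mulmxA (mulmxA Z U) ZUZ -scalemxAr.
have E2 : U *m Z *m Z *m Z = kap b *: (U *m Z) by rewrite -!mulmxA (mulmxA Z Z) Z3 -scalemxAr.
rewrite (commx_sandwich2 ZUZ) /commx !(mulmxBr, mulmxBl, mulmxDr, mulmxDl).
rewrite mulmxN mulNmx -!scalemxAl -!scalemxAr !mulmxA E1 E2 Z3 ZUZ -!scalemxAl.
by move: (Z *m U) (U *m Z) (Z *m Z) => A B C; apply/matrixP => i j; rewrite !mxE; ring.
Qed.

Lemma cexp_conj b Z U (lam : R) t : Z *m Z *m Z = kap b *: Z -> Z *m U *m Z = lam *: Z ->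
  cexp b Z t *m U *m cexp b Z (- t) = U + sfun b t *: commx Z U +
    (kap b * (cfun b t - 1)) *: commx Z (commx Z U).
Proof.
move=> Z3 ZUZ.
have cs : cfun b t * cfun b t = 1 + kap b * (sfun b t * sfun b t).
  have := cfunD b t (- t); rewrite subrr cfun0 cfunN sfunN => ->; ring.
have E1 : Z *m Z *m U *m Z = lam *: (Z *m Z).
  by rewrite -!mulmxA (mulmxA Z U) ZUZ -scalemxAr.
have E2 : Z *m U *m (Z *m Z) = lam *: (Z *m Z) by rewrite mulmxA ZUZ -scalemxAl.
have E3 : Z *m Z *m U *m (Z *m Z) = (lam * kap b) *: Z.
  by rewrite !mulmxA E1 -scalemxAl Z3 scalerA.
rewrite (commx_sandwich2 ZUZ) /cexp sfunN cfunN /commx !mulmxDl !mulmxDr !mul1mx !mulmx1.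
rewrite -!scalemxAl -!scalemxAr !scalerA E1 E2 E3 ZUZ !mulmxA.
move: (Z *m U) (U *m Z) (Z *m Z *m U) (U *m Z *m Z) (Z *m Z) => A B C D F.
apply/matrixP => i j; rewrite !mxE.
apply/eqP; rewrite -subr_eq0; apply/eqP.
(* The difference of the two sides is a multiple of the relation [cs] between the squares of [cfun]
   and [sfun]. *)
transitivity (kap b * lam * Z i j *
  (cfun b t * cfun b t - (1 + kap b * (sfun b t * sfun b t)))); last by rewrite cs subrr mulr0.
by case: (b); rewrite /kap; ring.
Qed.

End WedgeConjugation.

Lemma is_derive_is_diff {R : realType} (V : normedModType R) (c : R -> V) (t : R) (dc : V) :
  is_derive t (1 : R) c dc -> is_diff (t : R^o) (c : R^o -> V) (fun s => s *: dc).
Proof.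
move=> /is_derive_diffE[y1 y2]; apply: is_diff_ext (is_diff_self y1) => s.
by rewrite -{1}[s]mulr1 -[s * 1]/(s *: (1 : R^o)) linearZ_LR y2.
Qed.

(* [Phi] is defined on all matrices, which makes it linear without side condition. *)
Record lorentz_coordinates {R : realType} {n d : nat} {G : lieGroupType R d}
    (Psi : 'rV[R]_d -> 'M[R]_(1 + n)) (Phi : 'M[R]_(1 + n) -> 'rV[R]_d) : Prop := {
  coordL : forall a u v, Psi (a *: u + v) = a *: Psi u + Psi v;
  icoordL : forall a Z U, Phi (a *: Z + U) = a *: Phi Z + Phi U;
  coord_orth : forall u, orth_alg R 1 n (Psi u);
  coord_br : forall u v, Psi (@lie_bracket R d G u v) = commx (Psi u) (Psi v);
  coordK : forall u, Phi (Psi u) = u;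
  icoordK : forall Z, orth_alg R 1 n Z -> Psi (Phi Z) = Z }.

Section TraceForm.
Context {R : realType} {n d : nat}.
Variable (Psi : 'rV[R]_d -> 'M[R]_(1 + n)).

(** The Frobenius inner product carried over by [Psi]. It is positive definite and invariant under
    Ad(exp k), see [Ad_isometry], and provides the lengths used for compactness. *)
Definition trace_form u v : R := \tr ((Psi u)^T *m Psi v).
(** With [sym_space], the summands k and p of the Cartan decomposition. *)
Definition skew_space : set 'rV[R]_d := [set u | (Psi u)^T = - Psi u].
Definition sym_space : set 'rV[R]_d := [set u | (Psi u)^T = Psi u].

Lemma ipE u v : trace_form u v = \sum_i \sum_j Psi u j i * Psi v j i.
Proof.
by rewrite /trace_form /mxtrace; apply: eq_bigr => i _; rewrite mxE; apply: eq_bigr => j _; rewrite mxE.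
Qed.

Lemma ipC u v : trace_form u v = trace_form v u.
Proof. by rewrite !ipE; apply: eq_bigr => i _; apply: eq_bigr => j _; rewrite mulrC. Qed.

Lemma ip_entry u i j : Psi u j i ^+ 2 <= trace_form u u.
Proof.
rewrite ipE (bigD1 i) //= (bigD1 j) //= -expr2 -addrA lerDl addr_ge0 //.
  by apply: sumr_ge0 => k _; rewrite -expr2 sqr_ge0.
by apply: sumr_ge0 => k _; apply: sumr_ge0 => l _; rewrite -expr2 sqr_ge0.
Qed.

Lemma ip_ge0 u : 0 <= trace_form u u.
Proof. by rewrite ipE; apply: sumr_ge0 => k _; apply: sumr_ge0 => l _; rewrite -expr2 sqr_ge0. Qed.

End TraceForm.

Section SpacelikeVectors.
Context {R : realType} {n : nat}.
Implicit Types (x y z w : 'cV[R]_(1 + n)) (Z : 'M[R]_(1 + n)).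

Definition e_time : 'cV[R]_(1 + n) := delta_mx 0 0.

Lemma bf_time w : bf e_time w = - w 0 0.
Proof.
rewrite bfE (bigD1 0) //= big1 => [|i i0]; last by rewrite !mxE (negbTE i0) mul0r mulr0.
by rewrite !mxE eqxx /sgn /= mul1r mulN1r addr0.
Qed.

Lemma space_normalize w : w 0 0 = 0 -> w != 0 -> exists2 a : R, 0 < a &
  bf (a *: w) (a *: w) = 1.
Proof.
move=> w0 wn0; have w2 : 0 < bf w w.
  rewrite lt_def bf_space // andbT; apply: contraNN wn0 => /eqP h; apply/eqP; exact: bf_space0.
exists (Num.sqrt (bf w w))^-1; first by rewrite invr_gt0 sqrtr_gt0.
rewrite !bflin mulrA -expr2 exprVn sqr_sqrtr ?ltW // mulVf //; exact: lt0r_neq0.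
Qed.

Lemma skew_time Z : orth_alg R 1 n Z -> Z^T = - Z -> forall i, Z i 0 = 0.
Proof.
move=> /orth_entry oZ sZ i; have sE j : Z 0 j = - Z j 0.
  by have := congr1 (fun M : 'M[R]_(1 + n) => M j 0) sZ; rewrite !mxE.
have [->|i0] := eqVneq i 0; first by have := sE 0; lra.
have i1 : (i == 0 :> nat) = false by apply: contraNF i0 => /eqP h; apply/eqP/val_inj.
by have := oZ i 0; rewrite sE /sgn i1 eqxx; lra.
Qed.

Lemma skew_mul0 Z x : orth_alg R 1 n Z -> Z^T = - Z -> (Z *m x) 0 0 = 0.
Proof.
move=> oZ sZ; rewrite mxE big1 // => i _.
have := congr1 (fun M : 'M[R]_(1 + n) => M 0 i) sZ; rewrite !mxE (skew_time oZ sZ).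
by move=> /esym/eqP; rewrite oppr_eq0 => /eqP ->; rewrite mul0r.
Qed.

Lemma wedge_skew x y : x 0 0 = 0 -> y 0 0 = 0 -> (wedge x y)^T = - wedge x y.
Proof.
move=> x0 y0; have e z : z 0 0 = 0 -> z^T *m sig_mx R 1 n = z^T.
  move=> z0; apply/matrixP => i j; rewrite mulmx_sigE !mxE ord1 /sgn; case: eqP => [j0|_].
    have -> : j = 0 by exact: val_inj.
    by rewrite z0 mul0r.
  by rewrite mulr1.
by rewrite /wedge !e // linearB /= !trmx_mul !trmxK opprB.
Qed.

Lemma wedge_time_sym x : x 0 0 = 0 -> (wedge x e_time)^T = wedge x e_time.
Proof.
move=> x0; have e : x^T *m sig_mx R 1 n = x^T.
  apply/matrixP => i j; rewrite mulmx_sigE !mxE ord1 /sgn; case: eqP => [j0|_].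
    have -> : j = 0 by exact: val_inj.
    by rewrite x0 mul0r.
  by rewrite mulr1.
have e' : e_time^T *m sig_mx R 1 n = - e_time^T.
  apply/matrixP => i j; rewrite mulmx_sigE !mxE.
  by have [->|jn] := eqVneq j 0; rewrite ?mul0r ?oppr0 // /sgn /= mulrN1.
by rewrite /wedge e e' mulmxN linearB /= linearN /= !trmx_mul !trmxK addrC.
Qed.

Lemma quadratic_le0 (a b : R) : (forall t, t * b + t ^+ 2 * a <= 0) -> b = 0.
Proof.
move=> h; apply/eqP/negPn/negP => b0.
pose c := 1 + `|a|; have c0 : 0 < c by rewrite /c; have := normr_ge0 a; lra.
have := h (b / c); have := ler_norm (- a); rewrite normrN => ha.
have E : b / c * b + (b / c) ^+ 2 * a = (b / c) ^+ 2 * (c + a) by field; exact: lt0r_neq0.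
rewrite E leNgt mulr_gt0 //; first by rewrite exprn_even_gt0 //= mulf_neq0 // invr_neq0 // lt0r_neq0.
by rewrite /c; lra.
Qed.

Lemma bilinear_continuous m (b : 'rV[R]_m -> 'rV[R]_m -> R) : bilinear_form b ->
  continuous (fun r => b r r : R).
Proof.
move=> hb r; have [h _] := is_diffE (is_diff_bilinear hb (is_diff_ident r) (is_diff_ident r)).
exact: differentiable_continuous h.
Qed.

Definition space_sphere : set 'rV[R]_(1 + n) := [set r | bf r^T r^T = 1 /\ r 0 0 = 0].

Lemma space_sphere_compact : compact space_sphere.
Proof.
apply: bounded_closed_compact.
  exists 1; split; first exact: num_real.
  move=> M M1 r [r1 r0]; apply: le_trans (ltW M1); apply: rV_norm_le => // i.
  have : r 0 i ^+ 2 <= 1.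
    rewrite -r1 bfE (bigD1 i) //= !mxE -[leLHS]addr0; apply: lerD.
      rewrite /sgn; case: eqP => [i0|_]; last by rewrite mul1r expr2.
      have -> : i = 0 by exact: val_inj.
      by rewrite r0; nra.
    apply: sumr_ge0 => j _; rewrite !mxE /sgn; case: eqP => [j0|_]; last by rewrite mul1r -expr2 sqr_ge0.
    have -> : j = 0 by exact: val_inj.
    by rewrite r0 mul0r mulr0.
  by rewrite -real_normK ?num_real // expr_le1.
have bb : bilinear_form (fun r s : 'rV[R]_(1 + n) => bf r^T s^T).
  by split=> a u v w; rewrite linearP /= !bflin.
have -> : space_sphere = [set r | bf r^T r^T = 1] `&` [set r | r 0 0 = 0] by [].
apply: closedI.
  apply: (@preimage_closed _ _ (fun r : 'rV[R]_(1 + n) => bf r^T r^T) [set 1]) => [x _|].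
    exact: bilinear_continuous bb x.
  exact: closed_eq.
apply: (@preimage_closed _ _ (fun r : 'rV[R]_(1 + n) => r 0 0) [set 0]) => [x _|]; last exact: closed_eq.
exact: coord_continuous.
Qed.

(** A maximum of [bf (Z *m w) (Z *m w)] over unit space vectors exists by compactness, and the
    first-order condition makes w an eigenvector of the square of Z. It spans with its image the
    plane in which Z turns fastest. *)
Lemma skew_max_plane Z : (0 < n)%N -> orth_alg R 1 n Z -> Z^T = - Z ->
  exists w, [/\ w 0 0 = 0, bf w w = 1,
    Z *m (Z *m w) = - bf (Z *m w) (Z *m w) *: w &
    forall x, x 0 0 = 0 -> bf (Z *m x) (Z *m x) <= bf (Z *m w) (Z *m w) * bf x x].
Proof.
move=> n0 oZ sZ.
pose b2 (r s : 'rV[R]_(1 + n)) : R := bf (Z *m r^T) (Z *m s^T).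
have bb2 : bilinear_form b2 by split=> a u v w; rewrite /b2 linearP /= mulmxDr -scalemxAr !bflin.
pose K := space_sphere; have cK : compact K by exact: space_sphere_compact.
have K0 : K !=set0.
  pose i1 : 'I_(1 + n) := rshift 1 (Ordinal n0).
  exists (delta_mx 0 i1); split; last by rewrite /= !mxE.
  rewrite /= trmx_delta bfE (bigD1 i1) //= big1 => [|i ii]; last first.
    by rewrite !mxE (negbTE ii) mul0r mulr0.
  by rewrite !mxE eqxx /sgn /= !mulr1 addr0.
have cw : {within K, continuous (fun r : 'rV[R]_(1 + n) => b2 r r : R)}.
  exact/continuous_subspaceT/bilinear_continuous.
have [r /set_mem [r1 r0] rmax] := compact_EVT_max K0 cK cw.
exists r^T; set w := r^T; set L := bf (Z *m w) (Z *m w).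
have w0 : w 0 0 = 0 by rewrite mxE.
have mx x : x 0 0 = 0 -> bf (Z *m x) (Z *m x) <= L * bf x x.
  move=> x0; have [->|xn0] := eqVneq x 0; first by rewrite mulmx0 !bf0l mulr0.
  have [a a0 ax] := space_normalize x0 xn0.
  have := rmax (a *: x)^T; rewrite /b2 trmxK -/w -/L -scalemxAr !bflin => h.
  have xx : a * (a * bf x x) = 1 by rewrite -ax !bflin.
  have : a * (a * bf (Z *m x) (Z *m x)) <= L * (a * (a * bf x x)).
    rewrite xx mulr1; apply: h; apply/mem_set; split; first by rewrite /= trmxK.
    by rewrite /= !mxE x0 mulr0.
  rewrite !mulrA [L * a]mulrC -[a * L * a]mulrA [L * a]mulrC !mulrA -!(mulrA (a * a)).
  by rewrite ler_pM2l // mulr_gt0.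
split=> //.
have ww : bf w w = 1 by [].
have crit x : x 0 0 = 0 -> bf (Z *m w) (Z *m x) = L * bf w x.
  move=> x0; apply/eqP; rewrite -subr_eq0; apply/eqP.
  suff : 2 * (bf (Z *m w) (Z *m x) - L * bf w x) = 0 by lra.
  apply: (quadratic_le0 (a := bf (Z *m x) (Z *m x) - L * bf x x)) => t.
  have zz : (w + t *: x) 0 0 = 0 by move: (w) w0 => w' w'0; rewrite !mxE x0 w'0 mulr0 addr0.
  have := mx _ zz; rewrite mulmxDr -scalemxAr !bflin -/L ww (bfC (Z *m x) (Z *m w)) (bfC x w).
  by rewrite -subr_le0 => h; apply: le_trans h; rewrite le_eqVlt; apply/orP; left; apply/eqP; ring.
have : Z *m (Z *m w) + L *: w = 0.
  have y0 : (Z *m (Z *m w) + L *: w) 0 0 = 0.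
    have := skew_mul0 (Z *m w) oZ sZ.
    move: (Z *m (Z *m w)) (L) => q l q0; move: (w) w0 => w' w'0.
    by rewrite !mxE q0 w'0 mulr0 addr0.
  have h := crit _ y0; apply: (bf_space0 y0).
  by rewrite bfDl (bfZl L) -h orth_bf // addNr.
by rewrite scaleNr => /eqP; rewrite addr_eq0 => /eqP.
Qed.

End SpacelikeVectors.

Lemma bilinear_bound {R : realType} n (b : 'rV[R]_n -> 'rV[R]_n -> R) : bilinear_form b ->
  exists2 C : R, 0 <= C & forall u v, `|b u v| <= C * (`|u| * `|v|).
Proof.
move=> [bl br]; exists (\sum_i \sum_j `|b (delta_mx 0 i) (delta_mx 0 j)|).
  by apply: sumr_ge0 => i _; apply: sumr_ge0.
have bl0 w : b 0 w = 0 by have := bl (-1) 0 0 w; rewrite scaler0 addr0 => h; lra.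
have br0 w : b w 0 = 0 by have := br (-1) 0 0 w; rewrite scaler0 addr0 => h; lra.
have blD w : {morph b^~ w : u v / u + v} by move=> u v; have := bl 1 u v w; rewrite scale1r mul1r.
have brD w : {morph b w : u v / u + v} by move=> u v; have := br 1 u v w; rewrite scale1r mul1r.
have blZ a u w : b (a *: u) w = a * b u w by have := bl a u 0 w; rewrite addr0 bl0 addr0.
have brZ a u w : b w (a *: u) = a * b w u by have := br a u 0 w; rewrite addr0 br0 addr0.
move=> u v; rewrite {1}(row_deltaE u) {1}(row_deltaE v).
rewrite (big_morph (b^~ _) (blD _) (bl0 _)) mulr_suml.
apply: (le_trans (ler_norm_sum _ _ _)); apply: ler_sum => i _.
rewrite (big_morph (b _) (brD _) (br0 _)) mulr_suml.
apply: (le_trans (ler_norm_sum _ _ _)); apply: ler_sum => j _.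
rewrite blZ brZ !normrM mulrA mulrC; apply: ler_wpM2l => //.
by apply: ler_pM => //; exact: rV_coord_norm.
Qed.

Lemma cvg_bilinear {R : realType} n (b : 'rV[R]_n -> 'rV[R]_n -> R) (T : Type)
    (F : set_system T) {FF : Filter F} (f g : T -> 'rV[R]_n) u v : bilinear_form b ->
  f t @[t --> F] --> u -> g t @[t --> F] --> v -> b (f t) (g t) @[t --> F] --> b u v.
Proof.
move=> bb fu gv.
have E w w' : b w w' = \sum_i w 0 i * b (delta_mx 0 i) w'.
  rewrite {1}(row_deltaE w).
  have [bl _] := bb.
  have bl0 : b 0 w' = 0 by have := bl (-1) 0 0 w'; rewrite scaler0 addr0 => h; lra.
  have blD : {morph b^~ w' : u v / u + v} by move=> u' v'; have := bl 1 u' v' w'; rewrite scale1r mul1r.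
  rewrite (big_morph (b^~ w') blD bl0); apply: eq_bigr => i _.
  by have := bl (w 0 i) (delta_mx 0 i) 0 w'; rewrite addr0 bl0 addr0.
rewrite E; under eq_fun do rewrite E.
apply: (cvg_big_sum (W := R^o)) => i.
have h1 : (f t 0 i : R) @[t --> F] --> (u 0 i : R).
  by apply: (@cvg_comp _ _ _ f (fun w : 'rV[R]_n => w 0 i) _ (nbhs u)) => //; exact: coord_continuous.
have h2 : (b (delta_mx 0 i) (g t) : R) @[t --> F] --> (b (delta_mx 0 i) v : R).
  apply: (@cvg_comp _ _ _ g (b (delta_mx 0 i)) _ (nbhs v)) => //.
  have l : linear (b (delta_mx 0 i) : _ -> R^o) by move=> c p p'; have [_ br] := bb; exact: br.
  by have [h _] := is_diffE (is_diff_linear_rV v l); exact: differentiable_continuous h.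
by exact: (cvgM h1 h2).
Qed.

Lemma linear_continuous_rV {R : realType} m (L : 'rV[R]_m -> R) :
  (forall a u v, L (a *: u + v) = a * L u + L v) -> continuous L.
Proof.
move=> l u; have l' : linear (L : _ -> R^o) by move=> a v w; exact: l.
have [h _] := is_diffE (is_diff_linear_rV u l'); exact: differentiable_continuous h.
Qed.

Lemma closed_kernel {R : realType} m (L : 'rV[R]_m -> R) :
  (forall a u v, L (a *: u + v) = a * L u + L v) -> closed [set u | L u = 0].
Proof.
move=> /linear_continuous_rV cf.
by apply: (@preimage_closed _ _ L [set 0]) => [x _|]; [exact: cf|exact: closed_eq].
Qed.

Section CartanDecomposition.
Context {R : realType} {n d : nat} {G : lieGroupType R d}.
Variables (Psi : 'rV[R]_d -> 'M[R]_(1 + n)) (Phi : 'M[R]_(1 + n) -> 'rV[R]_d).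
Hypothesis iso : lorentz_coordinates (G := G) Psi Phi.

Local Notation expG := (@expG R d G).
Local Notation br := (@lie_bracket R d G).
Local Notation oalg := (orth_alg R 1 n).
Local Notation ip := (trace_form Psi).
Local Notation kk := (skew_space Psi).
Local Notation pp := (sym_space Psi).
Implicit Types (x y : 'cV[R]_(1 + n)) (Z U : 'M[R]_(1 + n)) (u v : 'rV[R]_d).

Let PsiL := coordL iso.
Let PhiL := icoordL iso.
Let PsiO := coord_orth iso.
Let PsiB := coord_br iso.
Let PsiK := coordK iso.
Let PhiK := icoordK iso.

Lemma Psi0 : Psi 0 = 0.
Proof. by have := PsiL (-1) 0 0; rewrite scaler0 addr0 scaleN1r addNr. Qed.
Lemma PsiZ a u : Psi (a *: u) = a *: Psi u.
Proof. by rewrite -[_ *: u]addr0 PsiL Psi0 addr0. Qed.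
Lemma PsiD u v : Psi (u + v) = Psi u + Psi v.
Proof. by rewrite -[u in LHS]scale1r PsiL scale1r. Qed.
Lemma PsiN u : Psi (- u) = - Psi u.
Proof. by rewrite -scaleN1r PsiZ scaleN1r. Qed.
Lemma Phi0 : Phi 0 = 0.
Proof. by have := PhiL (-1) 0 0; rewrite scaler0 addr0 scaleN1r addNr. Qed.
Lemma PhiZ a Z : Phi (a *: Z) = a *: Phi Z.
Proof. by rewrite -[_ *: Z]addr0 PhiL Phi0 addr0. Qed.
Lemma PhiD Z U : Phi (Z + U) = Phi Z + Phi U.
Proof. by rewrite -[Z in LHS]scale1r PhiL scale1r. Qed.
Lemma PhiN Z : Phi (- Z) = - Phi Z.
Proof. by rewrite -scaleN1r PhiZ scaleN1r. Qed.
Lemma Psi_inj u v : Psi u = Psi v -> u = v.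
Proof. by move=> /(congr1 Phi); rewrite !PsiK. Qed.

Lemma brDr u v w : br u (v + w) = br u v + br u w.
Proof. by apply: Psi_inj; rewrite PsiD !PsiB PsiD /commx mulmxDl mulmxDr opprD addrACA. Qed.
Lemma brZr a u v : br u (a *: v) = a *: br u v.
Proof. by apply: Psi_inj; rewrite PsiZ !PsiB PsiZ /commx -scalemxAl -scalemxAr scalerBr. Qed.
Lemma brC u v : br u v = - br v u.
Proof. by apply: Psi_inj; rewrite PsiN !PsiB /commx opprB. Qed.
Lemma brZl a u v : br (a *: u) v = a *: br u v.
Proof. by rewrite brC brZr -scalerN -brC. Qed.

Lemma brNl u v : br (- u) v = - br u v.
Proof. by rewrite -scaleN1r brZl scaleN1r. Qed.
Lemma br0r u : br u 0 = 0.
Proof. by have := brZr 0 u 0; rewrite !scale0r. Qed.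

(** Moving [y t] back by [Ad] of the inverse exponential gives a curve with zero derivative. This
    uniqueness statement identifies [Ad] of exponentials with explicit formulas. *)
Lemma Ad_exp_ode u (y : R -> 'rV[R]_d) :
  (forall t : R, is_derive t (1 : R) y (br u (y t))) ->
  forall t, y t = Ad (expG (t *: u)) (y 0).
Proof.
move=> hy; pose w t : 'rV[R]_d := Ad (expG (t *: - u)) (y t).
have wE t : w t = \sum_(j < d) y t 0 j *: Ad (expG (t *: - u)) (delta_mx 0 j).
  rewrite /w {1}(row_deltaE (y t)) linear_sum; apply: eq_bigr => j _.
  exact: linearZ_LR.
have dw t : is_derive t (1 : R) w 0.
  apply/is_derive_diffE.
  have dy := is_derive_is_diff (hy t).
  have dA j := is_derive_is_diff (@Ad_exp_derive R d G (- u) (delta_mx 0 j) t).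
  have H := is_diff_sum (fun j => is_diff_scale (is_diff_rV_coord j dy) (dA j)).
  have E : (fun t : R^o => \sum_(j < d) y t 0 j *: Ad (expG (t *: - u)) (delta_mx 0 j)) = w.
    by apply/funext => s; rewrite wE.
  rewrite E in H; have [H1 H2] := is_diffE H; split=> //; rewrite H2.
  transitivity (Ad (expG (t *: - u)) (br u (y t)) + Ad (expG (t *: - u)) (br (- u) (y t))).
    rewrite big_split /=; congr (_ + _).
      rewrite {2}(row_deltaE (br u (y t))) linear_sum; apply: eq_bigr => j _.
      by rewrite scale1r; apply/esym/linearZ_LR.
    rewrite {2}(row_deltaE (y t)) (big_morph (br (- u)) (brDr (- u)) (id1 := 0)) ?linear_sum.
      by apply: eq_bigr => j _; rewrite scale1r brZr; apply/esym/linearZ_LR.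
    exact: br0r.
  by rewrite -(linearD (Ad (expG (t *: - u)))) brNl addrN; exact: linear0.
move=> t; have := rV_derive0_cst dw t 0.
by rewrite /w scale0r expG0 Ad1 => <-; rewrite scalerN expGN AdVK.
Qed.

Lemma cexp_wedge b Z t p q : Z *m Z *m Z = kap b *: Z -> oalg Z ->
  cexp b Z t *m wedge p q *m cexp b Z (- t) = wedge (cexp b Z t *m p) (cexp b Z t *m q).
Proof.
move=> Z3 oZ.
have E w : w^T *m sig_mx R 1 n *m cexp b Z (- t) = (cexp b Z t *m w)^T *m sig_mx R 1 n.
  by rewrite -mulmxA -(cexp_adj b t oZ) trmx_mul mulmxA.
by rewrite /wedge mulmxBr mulmxBl -!E -!mulmxA.
Qed.

(** The explicit conjugate solves the equation of [Ad_exp_ode] because the adjoint action of the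
    bivector satisfies a cubic equation. So [Ad] of this element is conjugation by an explicit
    matrix, whichever group [G] is. *)
Lemma Ad_cexp b x y t v : bf x y = 0 -> - (bf x x * bf y y) = kap b ->
  Psi (Ad (expG (t *: Phi (wedge x y))) v) =
  cexp b (wedge x y) t *m Psi v *m cexp b (wedge x y) (- t).
Proof.
move=> xy kxy; set Z := wedge x y; have oZ : oalg Z by exact: wedge_orth.
have Z3 : Z *m Z *m Z = kap b *: Z by exact: wedge_cube.
have ZVZ := wedge_sandwich x y (PsiO v).
set z := Phi Z.
have T3 : br z (br z (br z v)) = kap b *: br z v.
  by apply: Psi_inj; rewrite PsiZ !PsiB PhiK // (commx_sandwich3 Z3 ZVZ).
pose y' s : 'rV[R]_d := v + sfun b s *: br z v + (kap b * (cfun b s - 1)) *: br z (br z v).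
have dy s : is_derive s (1 : R) y' (br z (y' s)).
  apply/is_derive_diffE.
  have hs := is_diff_scale (is_diff_sfun b s) (is_diff_const (br z v) (s : R^o)).
  have hc := is_diff_scale (is_diff_scale (is_diff_const (kap b : R^o) (s : R^o))
    (is_diffB (is_diff_cfun b s) (is_diff_const (1 : R^o) (s : R^o))))
    (is_diff_const (br z (br z v)) (s : R^o)).
  have h := is_diffD (is_diffD (is_diff_const v (s : R^o)) hs) hc.
  have [h1 h2] := is_diffE h; split; first exact: h1.
  rewrite [LHS](congr1 (fun f => f 1) h2) !fctE /=.
  have -> : br z (y' s) = br z v + sfun b s *: br z (br z v) +
      (kap b * (cfun b s - 1)) *: (kap b *: br z v).
    by rewrite /y' (brDr z (v + _)) (brDr z v) (brZr (sfun b s) z) (brZr (kap b * _) z) T3.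
  have sc (a c : R) : a *: (c : R^o) = a * c by [].
  move: (br z v) (br z (br z v)) => p q; apply/matrixP => i j; rewrite !mxE !sc.
  by case: (b); rewrite /kap; ring.
have := Ad_exp_ode dy t; rewrite {2}/y' sfun0 cfun0 subrr mulr0 !scale0r !addr0 => <-.
by rewrite /y' !PsiD !PsiZ !PsiB PhiK // (cexp_conj t Z3 ZVZ).
Qed.

Lemma ip_bilinear : bilinear_form ip.
Proof.
have h a u v w : ip (a *: u + v) w = a * ip u w + ip v w.
  by rewrite /trace_form PsiL linearP mulmxDl -scalemxAl mxtraceD mxtraceZ.
by split=> a u v w; rewrite ?h // ipC h !(ipC _ _ w).
Qed.

Lemma ipDl u v w : ip (u + v) w = ip u w + ip v w.
Proof. by have := ip_bilinear.1 1 u v w; rewrite scale1r mul1r. Qed.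
Lemma ip0l w : ip 0 w = 0.
Proof. by have := ip_bilinear.1 (-1) 0 0 w; rewrite scaler0 addr0 => h; lra. Qed.
Lemma ipZl a v w : ip (a *: v) w = a * ip v w.
Proof. by have := ip_bilinear.1 a v 0 w; rewrite addr0 ip0l addr0. Qed.
Lemma ipNl v w : ip (- v) w = - ip v w.
Proof. by rewrite -scaleN1r ipZl mulN1r. Qed.
Lemma ipDr u v w : ip w (u + v) = ip w u + ip w v.
Proof. by rewrite ipC ipDl !(ipC _ w). Qed.
Lemma ipZr a v w : ip w (a *: v) = a * ip w v.
Proof. by rewrite ipC ipZl (ipC _ w). Qed.

Lemma ip_eq0 u : ip u u = 0 -> u = 0.
Proof.
move=> u0; apply: Psi_inj; rewrite Psi0; apply/matrixP => i j; rewrite mxE.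
by apply/eqP; rewrite -sqrf_eq0 eq_le sqr_ge0 andbT -u0; exact: ip_entry.
Qed.

(** A crude bound, by [1 + ip v v] in place of a square root, that suffices for boundedness. *)
Lemma norm_ip : exists2 B : R, 0 <= B & forall v, `|v| <= B * (1 + ip v v).
Proof.
exists (\sum_i \sum_j `|Phi (delta_mx i j)|).
  by apply: sumr_ge0 => i _; apply: sumr_ge0.
move=> v.
have E : v = \sum_i \sum_j Psi v i j *: Phi (delta_mx i j).
  rewrite -{1}[v]PsiK {1}(matrix_sum_delta (Psi v)).
  rewrite (big_morph _ PhiD Phi0); apply: eq_bigr => i _.
  rewrite (big_morph _ PhiD Phi0); apply: eq_bigr => j _.
  exact: PhiZ.
rewrite {1}E mulr_suml; apply: (le_trans (ler_norm_sum _ _ _)); apply: ler_sum => i _.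
rewrite mulr_suml; apply: (le_trans (ler_norm_sum _ _ _)); apply: ler_sum => j _.
rewrite normrZ mulrC; apply: ler_wpM2l => //.
have := ip_entry Psi v j i; rewrite -real_normK ?num_real //.
have := sqr_ge0 (`|Psi v i j| - 1); have := ip_ge0 Psi v; move: (`|Psi v i j|) (ip v v) => a b.
have -> : (a - 1) ^+ 2 = a ^+ 2 - a - a + 1 by ring.
by move: (a ^+ 2) => c h1 h2 h3; lra.
Qed.

Lemma ip_diff v w : is_diff v (fun u => ip u w : R^o) (fun u => ip u w).
Proof.
have := is_diff_bilinear ip_bilinear (is_diff_ident v) (is_diff_const w v).
by apply: is_diff_ext => u; rewrite (ipC _ v 0) ip0l addr0.
Qed.

Lemma ip_continuousl w : continuous (fun u => ip u w : R).
Proof. by move=> v; have [h _] := is_diffE (ip_diff v w); exact: differentiable_continuous h. Qed.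

Lemma ip_continuous : continuous (fun u => ip u u : R).
Proof. exact: bilinear_continuous ip_bilinear. Qed.

Lemma ip_compact (A : set 'rV[R]_d) c : closed A -> (forall v, A v -> ip v v <= c) -> compact A.
Proof.
move=> cA hA; apply: bounded_closed_compact => //.
have [B B0 hB] := norm_ip; exists (B * (1 + c)); split; first exact: num_real.
move=> M hM v Av; apply: le_trans (ltW hM); apply: le_trans (hB v) _.
by apply: ler_wpM2l => //; rewrite lerD2l; exact: hA.
Qed.

Lemma kkE u : kk u <-> forall i j, Psi u j i + Psi u i j = 0.
Proof.
split=> [h i j|h].
  by have := congr1 (fun M : 'M[R]_(1 + n) => M i j) h; rewrite !mxE => ->; rewrite addNr.
by apply/matrixP => i j; rewrite !mxE; apply/eqP; rewrite -addr_eq0 h.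
Qed.

Lemma ppE u : pp u <-> forall i j, Psi u j i - Psi u i j = 0.
Proof.
split=> [h i j|h].
  by have := congr1 (fun M : 'M[R]_(1 + n) => M i j) h; rewrite !mxE => ->; rewrite subrr.
by apply/matrixP => i j; rewrite !mxE; apply/eqP; rewrite -subr_eq0 h.
Qed.

Lemma kk_closed : closed kk.
Proof.
have -> : kk = \bigcap_(p in [set: 'I_(1 + n) * 'I_(1 + n)]) [set u | Psi u p.2 p.1 + Psi u p.1 p.2 = 0].
  apply/seteqP; split=> u; first by move=> /kkE h p _; exact: h.
  by move=> h; apply/kkE => i j; exact: (h (i, j) I).
apply: closed_bigI => p _; apply: closed_kernel => a u v; rewrite PsiL !mxE; ring.
Qed.

Lemma pp_closed : closed pp.
Proof.
have -> : pp = \bigcap_(p in [set: 'I_(1 + n) * 'I_(1 + n)]) [set u | Psi u p.2 p.1 - Psi u p.1 p.2 = 0].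
  apply/seteqP; split=> u; first by move=> /ppE h p _; exact: h.
  by move=> h; apply/ppE => i j; exact: (h (i, j) I).
apply: closed_bigI => p _; apply: closed_kernel => a u v; rewrite PsiL !mxE; ring.
Qed.

Lemma orth_alg_tr (Z : 'M[R]_(1 + n)) : oalg Z -> oalg Z^T.
Proof.
move=> /orth_entry h; apply/orth_entry => i j; rewrite !mxE.
transitivity (sgn i * Z j i * (sgn j * sgn j)); first by rewrite sgn_sq mulr1.
have -> : Z i j = sgn i * (sgn i * Z i j) by rewrite mulrA sgn_sq mul1r.
by rewrite h; ring.
Qed.

(** The Cartan involution: k and p are its eigenspaces for 1 and -1. *)
Definition theta v : 'rV[R]_d := Phi (- (Psi v)^T).

Lemma Psi_theta v : Psi (theta v) = - (Psi v)^T.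
Proof.
by rewrite PhiK // -scaleN1r -[_ *: _]addr0; apply: orthL; [exact: orth_alg_tr|exact: orth0].
Qed.

Lemma theta_linear : linear theta.
Proof. by move=> a u v; apply: Psi_inj; rewrite PsiL !Psi_theta PsiL linearP /= opprD scalerN. Qed.

Lemma kk_theta v : kk v <-> theta v = v.
Proof.
split=> [h|h]; first by apply: Psi_inj; rewrite Psi_theta h opprK.
by rewrite /skew_space /= -{2}h Psi_theta opprK.
Qed.

Lemma pp_theta v : pp v <-> theta v = - v.
Proof.
split=> [h|h]; first by apply: Psi_inj; rewrite Psi_theta h PsiN.
by have := Psi_theta v; rewrite h PsiN => /oppr_inj.
Qed.

Lemma theta_br u v : kk u -> theta (br u v) = br u (theta v).
Proof.
move=> hu; apply: Psi_inj; rewrite Psi_theta !PsiB Psi_theta /commx linearB /= !trmx_mul hu.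
by rewrite !(mulmxN, mulNmx, opprB, opprK) addrC.
Qed.

Lemma br_self u : br u u = 0.
Proof. by apply: Psi_inj; rewrite PsiB Psi0 /commx subrr. Qed.

Lemma Ad_exp_self (t : R) u : Ad (expG (t *: u)) u = u.
Proof. by apply: Ad_exp_fix; rewrite brZl br_self scaler0. Qed.

(** Both sides follow the equation of [Ad_exp_ode], because [theta] commutes with the adjoint action
    of k. *)
Lemma Ad_theta u v : kk u -> Ad (expG u) (theta v) = theta (Ad (expG u) v).
Proof.
move=> hu; pose y t : 'rV[R]_d := theta (Ad (expG (t *: u)) v).
have dy (t : R) : is_derive t (1 : R) y (br u (y t)).
  have := is_diff_curve (@Ad_exp_derive R d G u v t) (is_diff_linear_rV _ theta_linear).
  by rewrite Ad_bracket Ad_exp_self theta_br.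
by have := Ad_exp_ode dy 1; rewrite /y !scale1r scale0r expG0 Ad1.
Qed.

Lemma Ad_kk u v : kk u -> kk v -> kk (Ad (expG u) v).
Proof. by move=> hu /kk_theta hv; apply/kk_theta; rewrite -Ad_theta ?hv. Qed.

Lemma Ad_pp u v : kk u -> pp v -> pp (Ad (expG u) v).
Proof.
by move=> hu /pp_theta hv; apply/pp_theta; rewrite -Ad_theta ?hv //; exact: linearN.
Qed.

Lemma ip_br u v w : kk u -> ip (br u v) w = - ip v (br u w).
Proof.
move=> hu; rewrite /trace_form !PsiB /commx.
have -> : (Psi u *m Psi v - Psi v *m Psi u)^T = Psi u *m (Psi v)^T - (Psi v)^T *m Psi u.
  by rewrite linearB /= !trmx_mul hu mulmxN mulNmx opprK addrC.
rewrite mulmxBl mulmxBr !mulmxA ![\tr (_ - _)]raddfB /= opprB; congr (_ - _).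
by rewrite [RHS]mxtrace_mulC !mulmxA.
Qed.

Lemma Ad_isometry u v w : kk u -> ip (Ad (expG u) v) (Ad (expG u) w) = ip v w.
Proof.
move=> hu; pose f (t : R) : R := ip (Ad (expG (t *: u)) v) (Ad (expG (t *: u)) w).
have df (t : R) : is_derive t (1 : R) f 0.
  have dA z := is_derive_is_diff (@Ad_exp_derive R d G u z t).
  have [h1 h2] := is_diffE (is_diff_bilinear ip_bilinear (dA v) (dA w)).
  apply/is_derive_diffE; split; first exact: h1.
  rewrite [LHS](congr1 (fun f => f 1) h2) !scale1r !Ad_bracket Ad_exp_self.
  by rewrite ip_br // addNr.
have := @is_derive_0_is_cst R f 1 0 df.
by rewrite /f scale1r scale0r expG0 !Ad1.
Qed.

(** * Compactness of exp(k) *)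

Lemma cexp_2pi (Z : 'M[R]_(1 + n)) : cexp false Z (2 * pi) = 1%:M.
Proof.
rewrite /cexp (_ : 2 * pi = pi + pi); last by ring.
rewrite sfunD cfunD /sfun /cfun /kap sinpi cospi !mul0r addr0 scale0r addr0.
by rewrite (_ : -1 * _ = 0) ?scale0r ?addr0 //; ring.
Qed.

Lemma cexp_pi (Z : 'M[R]_(1 + n)) : cexp false Z pi = 1%:M + 2 *: (Z *m Z).
Proof.
rewrite /cexp /sfun /cfun sinpi cospi scale0r addr0 /kap; congr (_ + _ *: _); ring.
Qed.

(* exp(2 pi E) is central, and conjugating it by a half turn in a plane meeting that of E
   in a line turns it into its inverse. *)
Lemma exp_4pi x y : (3 <= n)%N -> bf x x = 1 -> bf y y = 1 -> bf x y = 0 ->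
  expG ((4 * pi) *: Phi (wedge x y)) = 1%g.
Proof.
move=> n3 xx yy xy.
have kxy : - (bf x x * bf y y) = kap false by rewrite xx yy mulr1.
set E := wedge x y; set z := expG ((2 * pi) *: Phi E).
have Az v : Ad z v = v.
  have N2 : cexp false E (- (2 * pi)) = 1%:M.
    have := cexpD (2 * pi) (- (2 * pi)) (wedge_cube xy kxy).
    by rewrite subrr cexp0 cexp_2pi mul1mx.
  by apply: Psi_inj; rewrite (Ad_cexp _ _ xy kxy) cexp_2pi N2 mul1mx mulmx1.
have [w wn0 [w0 xw yw]] := @orth3 R n e_time x y n3.
have {}w0 : w 0 0 = 0 by apply: oppr_inj; rewrite -bf_time oppr0.
have [a a0 ff] := space_normalize w0 wn0; set f := a *: w in ff.
have xf : bf x f = 0 by rewrite /f bfZr xw mulr0.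
have yf : bf y f = 0 by rewrite /f bfZr yw mulr0.
have kxf : - (bf x x * bf f f) = kap false by rewrite xx ff mulr1.
have AF : Ad (expG (pi *: Phi (wedge x f))) (Phi E) = - Phi E.
  apply: Psi_inj; rewrite (Ad_cexp _ _ xf kxf) PsiN PhiK; last exact: wedge_orth.
  rewrite (cexp_wedge pi x y (wedge_cube xf kxf) (wedge_orth x f)).
  have -> : cexp false (wedge x f) pi *m x = - x.
    rewrite cexp_pi mulmxDl mul1mx -scalemxAl -mulmxA (wedge_mul x f x) (bfC f) xf xx scale0r sub0r scale1r.
    rewrite mulmxN wedge_mul ff xf scale1r scale0r subr0 scalerN.
    by rewrite scaler_nat mulr2n opprD addrA subrr add0r.
  have -> : cexp false (wedge x f) pi *m y = y.
    rewrite cexp_pi mulmxDl mul1mx -scalemxAl -mulmxA (wedge_mul x f y) xy (bfC f) yf !scale0r subr0.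
    by rewrite mulmx0 scaler0 addr0.
  by rewrite wedgeNl.
have zV : z = (z^-1)%g.
  move: AF; set g := expG (pi *: Phi (wedge x f)) => AF.
  have c : (z * g * z^-1)%g = g by rewrite expG_conj Az.
  have c' : (g * z)%g = (z * g)%g by rewrite -{1}c -!mulgA mulVg mulg1.
  have AE : Ad g ((2 * pi) *: Phi E) = - ((2 * pi) *: Phi E).
    by rewrite -scalerN -AF; exact: linearZ_LR.
  by rewrite -{1}[z]mulg1 -(mulgV g) mulgA -c' expG_conj AE expGN.
have zz : (z * z)%g = 1%g by rewrite {1}zV mulVg.
by rewrite -zz /z -expGD; congr (expG (_ *: _)); ring.
Qed.

Lemma ip_wedge v x y : kk v -> ip v (Phi (wedge x y)) = - 2 * bf y (Psi v *m x).
Proof.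
move=> hv; rewrite /trace_form hv PhiK; last exact: wedge_orth.
have tr p q : \tr (Psi v *m (p *m (q^T *m sig_mx R 1 n))) = bf q (Psi v *m p).
  by rewrite mulmxA mxtrace_mulC trace_mx11.
rewrite mulNmx raddfN /= /wedge mulmxBr raddfB /= !tr (bfC x) orth_bf // (bfC y); ring.
Qed.

Lemma ip_wedge2 x y : x 0 0 = 0 -> y 0 0 = 0 -> bf x x = 1 -> bf y y = 1 -> bf x y = 0 ->
  ip (Phi (wedge x y)) (Phi (wedge x y)) = 2.
Proof.
move=> x0 y0 xx yy xy; have ow := wedge_orth x y.
rewrite ip_wedge; last by rewrite /skew_space /= PhiK //; exact: wedge_skew.
by rewrite PhiK // wedge_mul !bflin xx yy (bfC y) xy; ring.
Qed.

Lemma ip_le_max v (L : R) : kk v ->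
  (forall x, x 0 0 = 0 -> bf (Psi v *m x) (Psi v *m x) <= L * bf x x) -> 0 <= L ->
  ip v v <= (1 + n)%:R * L.
Proof.
move=> hv hL L0; rewrite ipE.
have E i : \sum_j Psi v j i * Psi v j i <= L.
  have -> : \sum_j Psi v j i * Psi v j i = bf (Psi v *m delta_mx i 0) (Psi v *m delta_mx i 0).
    rewrite bfE; apply: eq_bigr => j _; rewrite -colE !mxE /sgn; case: eqP => [j0|]; last by rewrite mul1r.
    have -> : j = 0 by exact: val_inj.
    have := skew_mul0 (delta_mx i 0) (PsiO v) hv; rewrite -colE mxE => ->; by rewrite !mulr0.
  have [->|i0] := eqVneq i 0.
    have -> : Psi v *m (delta_mx 0 0 : 'cV[R]_(1 + n)) = 0.
      by apply/matrixP => j k; rewrite -colE !mxE (skew_time (PsiO v) hv).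
    by rewrite bf0l.
  have d0 : (delta_mx i 0 : 'cV[R]_(1 + n)) 0 0 = 0 by rewrite mxE eq_sym (negbTE i0).
  apply: le_trans (hL _ d0) _; rewrite -[leRHS]mulr1 ler_wpM2l //.
  rewrite bfE (bigD1 i) //= big1 => [|j ji]; last by rewrite !mxE (negbTE ji) mul0r mulr0.
  by rewrite !mxE eqxx addr0 !mulr1 /sgn; case: ifP => _; lra.
apply: le_trans (ler_sum _ (fun i _ => E i)) _.
by rewrite sumr_const card_ord mulr_natl.
Qed.

Lemma kkL a u v : kk u -> kk v -> kk (a *: u + v).
Proof. by move=> hu hv; rewrite /skew_space /= PsiL linearP /= hu hv scalerN opprD. Qed.

Lemma kkZ a u : kk u -> kk (a *: u).
Proof. by move=> hu; rewrite /skew_space /= PsiZ linearZ /= hu scalerN. Qed.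

Lemma kk_compact_rep u c : kk u ->
  compact [set v | [/\ kk v, expG v = expG u & ip v v <= c]].
Proof.
move=> hu; apply: (ip_compact (c := c)) => [|v []//].
have -> : [set v | [/\ kk v, expG v = expG u & ip v v <= c]] =
    kk `&` [set v | expG v = expG u] `&` [set v | ip v v <= c].
  by apply/seteqP; split=> v => [[]|[[]]].
apply: closedI; first (apply: closedI; first exact: kk_closed).
  apply: (@preimage_closed _ _ expG [set expG u]) => [v _|]; first exact: expG_cvg.
  apply: accessible_closed_set1; exact: hausdorff_accessible manifold_hausdorff.
apply: (@preimage_closed _ _ (fun v => ip v v) [set x | x <= c]) => [v _|]; last exact: closed_le.
exact: ip_continuous.
Qed.

(** A shortest logarithm v of exp(u) is not shortened by subtracting [4 * pi] times the generator e
    of its fastest plane, which commutes with v and does not change the exponential. Since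
    [ip v e = 2 * l] and [ip e e = 2], this bounds the speed l by [2 * pi], and the fastest speed
    bounds v. *)
Lemma kk_reduce u : (3 <= n)%N -> kk u ->
  exists v, [/\ kk v, expG v = expG u & ip v v <= (1 + n)%:R * (2 * pi) ^+ 2].
Proof.
move=> n3 hu.
have ne : [set v | [/\ kk v, expG v = expG u & ip v v <= ip u u]] !=set0 by exists u.
have [v /set_mem [hv ve vu] vmin] := compact_EVT_min ne (kk_compact_rep (c := ip u u) hu)
  (continuous_subspaceT ip_continuous).
exists v; split=> //; set Z := Psi v.
have n0 : (0 < n)%N by apply: leq_trans n3.
have [w [w0 ww Zw hmax]] := skew_max_plane n0 (PsiO v) hv.
set L := bf _ _ in Zw hmax.
have L0 : 0 <= L by apply: bf_space; exact: skew_mul0 hv.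
apply: le_trans (ip_le_max hv hmax L0) _; apply: ler_wpM2l => //.
have [/eqP L00|Ln0] := eqVneq L 0; first by rewrite (eqP L00) sqr_ge0.
pose l := Num.sqrt L; have l0 : 0 < l by rewrite sqrtr_gt0 lt_def Ln0.
have ll : l ^+ 2 = L by rewrite sqr_sqrtr.
have ln0 : l != 0 by rewrite lt0r_neq0.
pose w' := l^-1 *: (Z *m w).
have w'0 : w' 0 0 = 0 by rewrite mxE (skew_mul0 w (PsiO v) hv) mulr0.
have w'w' : bf w' w' = 1.
  by rewrite /w' !bflin -/L -ll; field.
have w'w : bf w' w = 0.
  rewrite /w' bfZl; have := orth_bf w w (PsiO v); rewrite (bfC w) => h.
  have -> : bf (Z *m w) w = 0 by lra.
  by rewrite mulr0.
have Zw' : Z *m w' = - l *: w.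
  rewrite /w' -scalemxAr Zw scalerA -ll; congr (_ *: _); by field.
have cE : commx Z (wedge w' w) = 0.
  rewrite (commx_wedge _ _ (PsiO v)) Zw' -/Z.
  have -> : Z *m w = l *: w' by rewrite /w' scalerA mulfV // scale1r.
  by rewrite !wlin !scaler0 addr0.
set e := Phi (wedge w' w).
have ke : kk e by rewrite /skew_space /= PhiK; [exact: wedge_skew|exact: wedge_orth].
pose v' := v + (- (4 * pi)) *: e.
have hv' : kk v' by rewrite /v' addrC; exact: kkL.
have br0 : br v e = 0 by apply: Psi_inj; rewrite PsiB PhiK ?cE ?Psi0 //; exact: wedge_orth.
have ev' : expG v' = expG u.
  rewrite -expG_add => [|s t]; last by rewrite brZl !brZr br0 !scaler0.
  by rewrite scaleNr expGN (exp_4pi n3 w'w' ww w'w) invg1 mulg1.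
have iv : ip v e = 2 * l.
  rewrite ip_wedge // -/Z Zw' bfZr ww; ring.
have ie : ip e e = 2 by exact: ip_wedge2.
have le1 : ip v v <= ip v' v'.
  have [h|h] := lerP (ip v' v') (ip u u); first by apply: vmin; apply/mem_set.
  exact: le_trans vu (ltW h).
have : l <= 2 * pi.
  move: le1; rewrite /v' !ipDl !ipDr !ipZl !ipZr (ipC _ e v) iv ie => h.
  have p0 : 0 < 16 * pi :> R by rewrite mulr_gt0 // pi_gt0.
  rewrite -(ler_pM2l p0) -subr_ge0; rewrite -subr_ge0 in h; apply: le_trans h _.
  by rewrite le_eqVlt; apply/orP; left; apply/eqP; ring.
by move=> h; rewrite -ll lerXn2r ?nnegrE ?(ltW l0) // mulr_ge0 // pi_ge0.
Qed.

Lemma kk_br u v : kk u -> kk v -> kk (br u v).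
Proof.
move=> hu hv; rewrite /skew_space /= PsiB /commx linearB /= !trmx_mul hu hv !mulmxN !mulNmx !opprK.
by rewrite opprB.
Qed.

Lemma expG_fixed_commute g u (t : R) : Ad g u = u ->
  (g * expG (t *: u))%g = (expG (t *: u) * g)%g.
Proof.
move=> gu; have E : Ad g (t *: u) = t *: u by rewrite -{2}gu; exact: linearZ_LR.
by rewrite -{2}E -expG_conj -mulgA mulVg mulg1.
Qed.

(* Among the logarithms of a given element, the one closest to the direction X commutes with X. *)
Lemma commuting_log u X : kk u -> kk X -> Ad (expG u) X = X ->
  exists v, [/\ kk v, expG v = expG u & br v X = 0].
Proof.
move=> hu hX fX.
have ne : [set v | [/\ kk v, expG v = expG u & ip v v <= ip u u]] !=set0 by exists u.
have [v /set_mem [hv ve vu] vmax] := compact_EVT_max ne (kk_compact_rep (c := ip u u) hu)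
  (continuous_subspaceT (ip_continuousl (w := X))).
exists v; split=> //; set z := br v X.
have hz : kk z by exact: kk_br.
have fz : Ad (expG u) z = z.
  by rewrite /z Ad_bracket fX -ve -[X in Ad (expG X)]scale1r Ad_exp_self.
have nz (t : R) : kk (t *: z) by exact: kkZ.
(* [Ad (expG (t *: z)) v] is again a logarithm of [expG u], of the same length, because [expG u]
   fixes [z]. Its product with [X] has derivative [ip z z] at 0, so maximality forces [z = 0]. *)
have mx (t : R) : ip (Ad (expG (t *: z)) v) X <= ip v X.
  apply: vmax; apply/mem_set; split; first exact: Ad_kk.
    rewrite -expG_conj ve -expG_fixed_commute //.
    by rewrite -mulgA mulgV mulg1.
  by rewrite Ad_isometry.
have zz : ip (br z v) X = ip z z by rewrite brC ipNl ip_br // opprK.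
apply: ip_eq0; apply: oppr_inj; rewrite oppr0.
apply: (local_min_derive0 (f := fun t : R => - ip (Ad (expG (t *: z)) v) X)).
  have dA := is_derive_is_diff (@Ad_exp_derive R d G z v 0).
  have h := is_diffN (is_diff_bilinear ip_bilinear dA (is_diff_const X (0 : R^o))).
  have Ev : Ad (expG ((0 : R) *: z)) (br z v) = br z v by rewrite scale0r expG0 Ad1.
  rewrite Ev in h; apply: is_diff_ext h => s.
  by rewrite !fctE ipZl zz [ip _ 0](ipC) ip0l addr0 mulrN.
near=> t; rewrite lerN2 scale0r expG0 Ad1; exact: mx.
Unshelve. all: by end_near.
Qed.

(** The representing vector is explicit: the skew part of the coefficient matrix of [xi], with time
    row and column set to 0, where elements of k vanish anyway. *)
Lemma kk_riesz (xi : 'rV[R]_d -> R) : (forall a u v, xi (a *: u + v) = a * xi u + xi v) ->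
  exists2 z, kk z & forall u, kk u -> xi u = ip z u.
Proof.
move=> xiL.
have xi0 : xi 0 = 0 by have := xiL (-1) 0 0; rewrite scaler0 addr0 => h; lra.
have xiD u v : xi (u + v) = xi u + xi v by rewrite -[u in LHS]scale1r xiL mul1r.
have xiZ a u : xi (a *: u) = a * xi u by rewrite -[_ *: _]addr0 xiL xi0 addr0.
pose A : 'M[R]_(1 + n) := \matrix_(i, j) xi (Phi (delta_mx i j)).
have xiE u : xi u = \sum_i \sum_j A i j * Psi u i j.
  rewrite -{1}[u]PsiK {1}(matrix_sum_delta (Psi u)).
  rewrite (big_morph _ PhiD Phi0) (big_morph _ xiD xi0); apply: eq_bigr => i _.
  rewrite (big_morph _ PhiD Phi0) (big_morph _ xiD xi0); apply: eq_bigr => j _.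
  by rewrite PhiZ xiZ mulrC mxE.
pose P : 'M[R]_(1 + n) := \matrix_(i, j)
  if (i == 0) || (j == 0) then 0 else (A i j - A j i) / 2.
have oP : oalg P.
  apply/orth_entry => i j; rewrite !mxE orbC; case: ifP => [_|]; first by rewrite !mulr0 oppr0.
  move=> /negbT; rewrite negb_or /sgn => /andP[j0 i0].
  have h (k : 'I_(1 + n)) : k != 0 -> (k == 0 :> nat) = false.
    by move=> k0; apply: contraNF k0 => /eqP e; apply/eqP/val_inj.
  by rewrite !h //; field.
have kP : P^T = - P.
  by apply/matrixP => i j; rewrite !mxE orbC; case: ifP => _; [rewrite oppr0|field].
exists (Phi P); first by rewrite /skew_space /= PhiK.
move=> u hu; rewrite ipE PhiK // xiE.
have E i j : P i j * Psi u i j = (A i j * Psi u i j + A j i * Psi u j i) / 2.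
  have := congr1 (fun M : 'M[R]_(1 + n) => M i j) hu; rewrite !mxE => s.
  have c := skew_time (PsiO u) hu.
  have [i0|i0] := eqVneq i 0.
    by move: s; rewrite i0 c => /esym/eqP; rewrite oppr_eq0 => /eqP ->; rewrite /= !mulr0 addr0 !mul0r.
  have [j0|j0] := eqVneq j 0.
    by move: s; rewrite j0 c oppr0 => ->; rewrite /= !mulr0 addr0 !mul0r.
  by rewrite /= s; field.
have -> : \sum_i \sum_j P j i * Psi u j i = \sum_i \sum_j P i j * Psi u i j by rewrite exchange_big.
pose S := \sum_i \sum_j A i j * Psi u i j; rewrite -/S.
have S' : \sum_i \sum_j A j i * Psi u j i = S by rewrite exchange_big.
transitivity ((S + \sum_i \sum_j A j i * Psi u j i) / 2); first by rewrite S'; field.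
rewrite -big_split mulr_suml; apply: eq_bigr => i _ /=.
by rewrite -big_split mulr_suml; apply: eq_bigr => j _; rewrite E.
Qed.

Lemma pp_ext Z Z' : oalg Z -> oalg Z' -> Z^T = Z -> Z'^T = Z' ->
  Z *m e_time = Z' *m e_time -> Z = Z'.
Proof.
move=> /orth_entry oZ /orth_entry oZ' sZ sZ' E.
have c i : Z i 0 = Z' i 0.
  by have := congr1 (fun M : 'cV[R]_(1 + n) => M i 0) E; rewrite /e_time -!colE !mxE.
have sE (M : 'M[R]_(1 + n)) i j : M^T = M -> M i j = M j i by move=> sM; rewrite -{1}sM mxE.
apply/matrixP => i j.
have [->|j0] := eqVneq j 0; first exact: c.
have [->|i0] := eqVneq i 0; first by rewrite (sE Z) // (sE Z') // c.
have s1 (k : 'I_(1 + n)) : k != 0 -> sgn k = 1 :> R.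
  move=> k0; rewrite /sgn; case: eqP => // e; case/eqP: k0; exact: val_inj.
have := oZ i j; have := oZ' i j; rewrite !s1 // !mul1r (sE Z j i) // (sE Z' j i) //; lra.
Qed.

Lemma wedge_time_mul x : x 0 0 = 0 -> wedge x e_time *m e_time = - x.
Proof.
move=> x0; rewrite wedge_mul bf_time bfC bf_time x0 oppr0 scale0r subr0 /e_time mxE /=.
by rewrite scaleN1r.
Qed.

Lemma wedge_time_mulx x : x 0 0 = 0 -> bf x x = 1 -> wedge x e_time *m x = - e_time.
Proof. by move=> x0 xx; rewrite wedge_mul bf_time x0 oppr0 scale0r sub0r xx scale1r. Qed.

(** By [pp_ext] an element of p is determined by the image of the time vector, which has time
    coordinate 0. For [X = 0] any unit direction serves, with [r = 0]. *)
Lemma pp_boost X : (0 < n)%N -> pp X -> exists x (r : R),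
  [/\ x 0 0 = 0, bf x x = 1, 0 <= r & X = r *: Phi (wedge x e_time)].
Proof.
move=> n0 hX; set y := - (Psi X *m e_time).
have y0 : y 0 0 = 0.
  have /orth_entry := PsiO X => /(_ 0 0).
  by rewrite /y /e_time -colE !mxE /sgn /=; lra.
have XE : X = Phi (wedge y e_time).
  apply: Psi_inj; rewrite PhiK; last exact: wedge_orth.
  apply: pp_ext => //; [exact: wedge_orth|exact: wedge_time_sym|].
  by rewrite wedge_time_mul // /y opprK.
have [yz|yn0] := eqVneq y 0.
  pose i1 : 'I_(1 + n) := rshift 1 (Ordinal n0).
  exists (delta_mx i1 0), 0; split => //; first by rewrite mxE.
    rewrite bfE (bigD1 i1) //= big1 => [|i ii]; last by rewrite !mxE (negbTE ii) mul0r mulr0.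
    by rewrite !mxE eqxx /sgn /= !mulr1 addr0.
  by rewrite XE yz wedge0l Phi0 scale0r.
have [a a0 aa] := space_normalize y0 yn0; exists (a *: y), a^-1; split=> //.
- by move: (y) y0 => y' y'0; rewrite mxE y'0 mulr0.
- by rewrite invr_ge0 ltW.
- by rewrite wedgeZl PhiZ scalerA mulVf ?scale1r // lt0r_neq0.
Qed.

Lemma boost_kap x : bf x x = 1 -> - (bf x x * bf (e_time : 'cV[R]_(1 + n)) e_time) = kap true.
Proof. by move=> xx; rewrite xx bf_time /e_time mxE /=; ring. Qed.

Lemma boost_orth x : x 0 0 = 0 -> bf x e_time = 0.
Proof. by move=> x0; rewrite bfC bf_time x0 oppr0. Qed.

Lemma ip_boost x : x 0 0 = 0 -> bf x x = 1 ->
  ip (Phi (wedge x e_time)) (Phi (wedge x e_time)) = 2.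
Proof.
move=> x0 xx; set W := wedge x e_time; have oW : oalg W by exact: wedge_orth.
rewrite /trace_form PhiK // wedge_time_sym //.
have tr p q : \tr (W *m (p *m (q^T *m sig_mx R 1 n))) = bf q (W *m p).
  by rewrite mulmxA mxtrace_mulC trace_mx11.
transitivity (\tr (W *m (x *m (e_time^T *m sig_mx R 1 n) - e_time *m (x^T *m sig_mx R 1 n)))) => //.
rewrite mulmxBr raddfB /= !tr wedge_time_mul // wedge_time_mulx // !bflin xx.
by rewrite bf_time /e_time mxE /=; ring.
Qed.

Lemma cexp_eigen (mu : R) Z (w : 'cV[R]_(1 + n)) t : mu * mu = 1 -> Z *m w = mu *: w ->
  cexp true Z t *m w = expR (mu * t) *: w.
Proof.
move=> mm Zw; rewrite /cexp !mulmxDl mul1mx -!scalemxAl -mulmxA Zw -scalemxAr Zw !scalerA -[_ * mu * mu]mulrA mm mulr1.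
rewrite -{1}(scale1r w) -!scalerDl; congr (_ *: _); rewrite /kap /sfun /cfun.
have : (mu - 1) * (mu + 1) = 0.
  by transitivity (mu * mu - 1); [ring|rewrite mm subrr].
by move/eqP; rewrite mulf_eq0 subr_eq0 addr_eq0 => /orP[]/eqP ->; rewrite ?mul1r ?mulN1r; field.
Qed.

Lemma cexp_ker b Z (w : 'cV[R]_(1 + n)) t : Z *m w = 0 -> cexp b Z t *m w = w.
Proof.
by move=> Zw; rewrite /cexp !mulmxDl mul1mx -!scalemxAl -mulmxA Zw mulmx0 !scaler0 !addr0.
Qed.

Section Boost.
Variable (x : 'cV[R]_(1 + n)).
Hypotheses (x0 : x 0 0 = 0) (xx : bf x x = 1).
Local Notation W := (wedge x e_time).

(** The generator sends [e_time] to [- x] and [x] to [- e_time]. Hence [e_time - x] is expanded for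
    positive [t], and [e_time + x] is contracted in [boost_plus]: they become l' and l. *)
Lemma boost_minus t : cexp true W t *m (e_time - x) = expR t *: (e_time - x).
Proof.
rewrite -[X in expR X]mul1r; apply: cexp_eigen; first by rewrite mulr1.
by rewrite mulmxBr wedge_time_mul // wedge_time_mulx // opprK scale1r addrC.
Qed.

Lemma boost_plus t : cexp true W t *m (e_time + x) = expR (- t) *: (e_time + x).
Proof.
rewrite -[X in expR X]mulN1r; apply: cexp_eigen; first by rewrite mulrNN mulr1.
by rewrite mulmxDr wedge_time_mul // wedge_time_mulx // scaleN1r opprD addrC.
Qed.

Lemma boost_perp (w : 'cV[R]_(1 + n)) t : w 0 0 = 0 -> bf x w = 0 -> cexp true W t *m w = w.
Proof.
move=> w0 xw; apply: cexp_ker.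
by rewrite wedge_mul xw bf_time w0 oppr0 !scale0r subr0.
Qed.

Lemma Ad_boost t p q :
  Ad (expG (t *: Phi W)) (Phi (wedge p q)) = Phi (wedge (cexp true W t *m p) (cexp true W t *m q)).
Proof.
apply: Psi_inj; rewrite (Ad_cexp _ _ (boost_orth x0) (boost_kap xx)).
rewrite PhiK ?PhiK; try exact: wedge_orth.
by apply: cexp_wedge; [exact: wedge_cube (boost_orth x0) (boost_kap xx)|exact: wedge_orth].
Qed.

End Boost.

(** * Closedness of exp(k) exp(p) *)

Hypothesis n3 : (3 <= n)%N.

Let n0 : (0 < n)%N. Proof. by apply: leq_trans n3. Qed.

Definition polar : set G :=
  [set g | exists u X, [/\ kk u, pp X & g = (expG u * expG X)%g]].

Definition polar_ball (c : R) : set G :=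
  [set g | exists u X, [/\ kk u /\ ip u u <= (1 + n)%:R * (2 * pi) ^+ 2,
     pp X /\ ip X X <= c & g = (expG u * expG X)%g]].

Lemma polar_ball_compact c : compact (polar_ball c).
Proof.
pose f (p : 'rV[R]_d * 'rV[R]_d) : G := (expG p.1 * expG p.2)%g.
pose K1 := kk `&` [set u | ip u u <= (1 + n)%:R * (2 * pi) ^+ 2].
pose K2 := pp `&` [set u | ip u u <= c].
have cl a : closed [set u | ip u u <= a].
  apply: (@preimage_closed _ _ (fun v => ip v v) [set x | x <= a]) => [v _|]; last exact: closed_le.
  exact: ip_continuous.
have c1 : compact K1.
  apply: (ip_compact (c := (1 + n)%:R * (2 * pi) ^+ 2)) => [|v []//].
  by apply: closedI => //; exact: kk_closed.
have c2 : compact K2.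
  apply: (ip_compact (c := c)) => [|v []//].
  by apply: closedI => //; exact: pp_closed.
have -> : polar_ball c = f @` (K1 `*` K2).
  apply/seteqP; split=> g; first by move=> [u [X [[h1 h2] [h3 h4] ->]]]; exists (u, X).
  by move=> [[u X] [[h1 h2] [h3 h4]] <-]; exists u, X.
apply: continuous_compact; last exact: compact_setX.
apply: continuous_subspaceT => p.
have h1 : expG q.1 @[q --> p] --> expG p.1.
  by apply: (@cvg_comp _ _ _ fst expG _ (nbhs p.1)); [exact: cvg_fst|exact: expG_cvg].
have h2 : expG q.2 @[q --> p] --> expG p.2.
  by apply: (@cvg_comp _ _ _ snd expG _ (nbhs p.2)); [exact: cvg_snd|exact: expG_cvg].
by have := mulg_cvg h1 h2; exact.
Qed.

Lemma polar_in_ball u X c : kk u -> pp X -> ip X X <= c -> polar_ball c (expG u * expG X)%g.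
Proof.
by move=> hu hX hc; have [v [hv <- vc]] := kk_reduce n3 hu; exists v, X.
Qed.

(** Bounds the operator norm of [Ad g] and is continuous in [g]; it controls the factor in
    exp(p). *)
Definition Ad_size (g : G) : R := \sum_(j < d) `|Ad g (delta_mx 0 j)|.

Lemma Ad_size_ge0 g : 0 <= Ad_size g.
Proof. exact: sumr_ge0. Qed.

Lemma Ad_sizeP g v : `|Ad g v| <= Ad_size g * `|v|.
Proof.
have -> : Ad g v = \sum_j v 0 j *: Ad g (delta_mx 0 j).
  by rewrite {1}(row_deltaE v) linear_sum; apply: eq_bigr => j _; exact: linearZ_LR.
rewrite /Ad_size mulr_suml; apply: (le_trans (ler_norm_sum _ _ _)); apply: ler_sum => j _.
by rewrite normrZ mulrC; apply: ler_wpM2l => //; exact: rV_coord_norm.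
Qed.

Lemma Ad_size_cvg g : Ad_size h @[h --> g] --> Ad_size g.
Proof.
apply: (cvg_big_sum (W := R^o)) => j.
by apply: (@cvg_norm _ _ _ (nbhs g)); exact: Ad_cvg.
Qed.

(** The boost of size r multiplies the bivector of [e_time - x] and w by exp(r), and exp(u) acts by
    isometries. So [Ad_size] is at least a constant times exp(r), which exceeds r. *)
Lemma polar_bound : exists2 K : R, 0 <= K & forall u X, kk u -> pp X ->
  ip X X <= K * Ad_size (expG u * expG X)%g ^+ 2.
Proof.
have [B B0 hB] := norm_ip.
have [C C0 hC] := bilinear_bound ip_bilinear.
exists (2 * C * (2 * B) ^+ 2); first by rewrite !mulr_ge0 // sqr_ge0.
move=> u X hu hX; have [x [r [x0 xx r0 ->]]] := pp_boost n0 hX.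
rewrite !ipZl !ipZr (ip_boost x0 xx).
have [w wn0 [w0 xw _]] := @orth3 R n e_time x x n3.
have {}w0 : w 0 0 = 0 by apply: oppr_inj; rewrite -bf_time oppr0.
pose v0 := Phi (wedge (e_time - x) w).
have Av0 : Ad (expG (r *: Phi (wedge x e_time))) v0 = expR r *: v0.
  by rewrite Ad_boost // boost_minus // boost_perp // wedgeZl PhiZ.
have v0n0 : v0 != 0.
  apply: contraNN wn0 => /eqP /(congr1 Psi); rewrite PhiK; last exact: wedge_orth.
  move=> /(congr1 (fun M => M *m e_time)); rewrite Psi0 mul0mx wedge_mul.
  rewrite !bflin bf_time (bfC x) bf_time (bfC w) bf_time w0 x0 /e_time mxE /= !oppr0 scale0r.
  by rewrite addr0 scaleN1r opprK add0r => ->.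
have ip0 : 0 < ip v0 v0.
  by rewrite lt_def ip_ge0 andbT; apply: contraNN v0n0 => /eqP /ip_eq0 ->.
pose v := (Num.sqrt (ip v0 v0))^-1 *: v0.
have iv : ip v v = 1.
  rewrite !ipZl !ipZr mulrA -expr2 exprVn sqr_sqrtr ?ltW // mulVf //.
  exact: lt0r_neq0.
set g := (_ * _)%g.
have ig : ip (Ad g v) (Ad g v) = expR r ^+ 2.
  have -> : Ad g v = Ad (expG u) (expR r *: v).
    rewrite /g AdM; congr (Ad _ _).
    have -> : expR r *: v = (Num.sqrt (ip v0 v0))^-1 *: (expR r *: v0) by rewrite !scalerA mulrC.
    by rewrite -Av0; exact: linearZ_LR.
  by rewrite Ad_isometry // ipZl ipZr iv mulr1 expr2.
have nv : `|v| <= 2 * B by rewrite mulrC; apply: le_trans (hB v) _; rewrite iv.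
have h1 : expR r ^+ 2 <= C * (Ad_size g * (2 * B)) ^+ 2.
  rewrite -ig -[leLHS]ger0_norm ?ip_ge0 //; apply: le_trans (hC _ _) _.
  rewrite -expr2; apply: ler_wpM2l => //; rewrite lerXn2r ?nnegrE ?mulr_ge0 ?Ad_size_ge0 //.
  by apply: le_trans (Ad_sizeP _ _) _; apply: ler_wpM2l => //; exact: Ad_size_ge0.
have h2 : r ^+ 2 <= expR r ^+ 2.
  rewrite lerXn2r ?nnegrE ?expR_ge0 //; have := expR_ge1Dx r; lra.
rewrite (_ : r * (r * 2) = 2 * r ^+ 2); last by ring.
apply: le_trans (_ : 2 * (C * (Ad_size g * (2 * B)) ^+ 2) <= _); first by rewrite ler_pM2l //; exact: le_trans h2 h1.
by rewrite le_eqVlt; apply/orP; left; apply/eqP; ring.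
Qed.

(** Near g, [Ad_size] stays below [Ad_size g + 1], so by [polar_bound] and [kk_reduce] the points of
    [polar] near g lie in one compact, hence closed, [polar_ball]. *)
Lemma polar_closed : closed polar.
Proof.
have [K K0 hK] := polar_bound.
move=> g cg; pose c := K * (Ad_size g + 1) ^+ 2.
suff : polar_ball c g by move=> [u [X [[hu _] [hX _] E]]]; exists u, X.
have cb : closed (polar_ball c).
  by apply: compact_closed; [exact: manifold_hausdorff|exact: polar_ball_compact].
apply: cb => B nB.
have nA : nbhs g [set h | Ad_size h < Ad_size g + 1].
  have := @cvgr_lt R _ (nbhs g) _ (fun h => Ad_size h) (Ad_size g) (@Ad_size_cvg g).
  by move=> /(_ _ (Ad_size g + 1)); apply; rewrite ltrDl.
have [h [[u [X [hu hX E]]] [Bh Ah]]] := cg _ (filterI nB nA).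
exists h; split=> //; rewrite E; apply: polar_in_ball => //.
apply: le_trans (hK _ _ hu hX) _; rewrite /c -E; apply: ler_wpM2l => //.
by rewrite lerXn2r ?nnegrE ?addr_ge0 ?Ad_size_ge0 // ltW.
Qed.

Lemma ppZ a u : pp u -> pp (a *: u).
Proof. by move=> hu; rewrite /sym_space /= PsiZ linearZ /= hu. Qed.

Lemma kk0 : kk 0. Proof. by rewrite /skew_space /= Psi0 trmx0 oppr0. Qed.
Lemma pp0 : pp 0. Proof. by rewrite /sym_space /= Psi0 trmx0. Qed.

Lemma kk_pp_ind (P : 'rV[R]_d -> Prop) : (forall u v, P u -> P v -> P (u + v)) ->
  (forall u, kk u -> P u) -> (forall u, pp u -> P u) -> forall u, P u.
Proof.
move=> PD Pk Ppp u.
have t2 : theta (theta u) = u.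
  by apply: Psi_inj; rewrite !Psi_theta linearN /= trmxK opprK.
have -> : u = 2^-1 *: (u + theta u) + 2^-1 *: (u - theta u).
  by move: (theta u) => w; apply/matrixP => i j; rewrite !mxE; field.
have tl := theta_linear.
have tD (v v' : 'rV[R]_d) : theta (v + v') = theta v + theta v'.
  by have := tl 1 v v'; rewrite !scale1r.
have tN v : theta (- v) = - theta v.
  by apply: Psi_inj; rewrite PsiN !Psi_theta PsiN linearN.
apply: PD; [apply: Pk; apply: kkZ|apply: Ppp; apply: ppZ].
  by apply/kk_theta; rewrite tD t2 addrC.
by apply/pp_theta; rewrite tD tN t2 opprB addrC.
Qed.

(** * Available velocities at a point of exp(k) exp(p) *)

Section Spanning.
Variables (u X : 'rV[R]_d) (zeta : 'rV[R]_d -> R).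
Hypotheses (hu : kk u) (hX : pp X)
  (zL : forall a u v, zeta (a *: u + v) = a * zeta u + zeta v).
Local Notation k := (expG u).
Local Notation a := (expG X).
Hypothesis hz : forall u1 u2,
  (forall t : R, polar (k * a * expG (t *: u1) * expG (t *: u2))%g) -> zeta (u1 + u2) = 0.

Let z0 : zeta 0 = 0.
Proof. by have := zL (-1) 0 0; rewrite scaler0 addr0 => h; lra. Qed.
Let zZ c v : zeta (c *: v) = c * zeta v.
Proof. by rewrite -[_ *: _]addr0 zL z0 addr0. Qed.
Let zD v v' : zeta (v + v') = zeta v + zeta v'.
Proof. by rewrite -[v in LHS]scale1r zL mul1r. Qed.
Let zN v : zeta (- v) = - zeta v.
Proof. by rewrite -scaleN1r zZ mulN1r. Qed.

Let AdZ g (t : R) v : expG (t *: Ad g v) = (g * expG (t *: v) * g^-1)%g.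
Proof. by rewrite expG_conj; congr expG; apply/esym/linearZ_LR. Qed.

Lemma zeta_X : zeta X = 0.
Proof.
rewrite -[X in LHS]addr0; apply: hz => t; exists u, ((1 + t) *: X); split => //; first exact: ppZ.
by rewrite expGD scale1r scaler0 expG0 mulg1 mulgA.
Qed.

(** Replacing [X] by [Ad (expG (t *: v)) X] conjugates [a] by [expG (t *: v)]; the velocity is
    [Ad (a^-1) v - v]. *)
Lemma zeta_Ad v : kk v -> zeta (Ad (a^-1)%g v) = zeta v.
Proof.
move=> hv; apply/eqP; rewrite -subr_eq0 -zN -zD; apply/eqP; apply: hz => t.
exists u, (Ad (expG (t *: v)) X); split=> //; first by apply: Ad_pp => //; exact: kkZ.
rewrite AdZ invgK -expG_conj scalerN expGN -!mulgA; congr (_ * _)%g.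
by rewrite !mulgA mulgV mul1g.
Qed.

(** Here [k] is conjugated instead, with velocity [Ad (a^-1) (Ad (k^-1) v) - Ad (a^-1) v]. *)
Lemma zeta_conj v : kk v -> zeta (Ad (a^-1)%g (Ad (k^-1)%g v)) = zeta (Ad (a^-1)%g v).
Proof.
move=> hv; apply/eqP; rewrite -subr_eq0 -zN -zD; apply/eqP; apply: hz => t.
exists (Ad (expG (t *: v)) u), X; split=> //; first by apply: Ad_kk => //; exact: kkZ.
rewrite -(expG_conj (expG (t *: v)) u) scalerN expGN (AdZ (a^-1)%g t v).
rewrite (AdZ (a^-1)%g t (Ad (k^-1)%g v)) (AdZ (k^-1)%g t v) !invgK.
by rewrite !invgM !invgK !mulgA !mulgK mulgV mul1g.
Qed.

(** For a logarithm [w] of [k] commuting with [v], replacing [w] by [w + t *: v] multiplies [k] by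
    [expG (t *: v)]; [commuting_log] supplies such a [w]. *)
Lemma zeta_fixed v : kk v -> Ad k v = v -> zeta (Ad (a^-1)%g v) = 0.
Proof.
move=> hv fv; have [w [hw we wv]] := commuting_log hu hv fv.
rewrite -[X in zeta X]addr0; apply: hz => t; exists (w + t *: v), X; split=> //.
  by rewrite addrC; exact: kkL.
rewrite -expG_add => [|s' t']; last by rewrite brZl !brZr wv !scaler0.
by rewrite scaler0 expG0 mulg1 (AdZ (a^-1)%g t v) invgK we !mulgA mulgK.
Qed.

(** The form sending [v] to [zeta (Ad (a^-1) v)] is represented on k by some [w]. By [zeta_conj] and
    invariance of the trace form, [Ad k] fixes [w], so [zeta_fixed] applies to [w] itself and gives
    [ip w w = 0]. *)
Lemma zeta_Ad_kk v : kk v -> zeta (Ad (a^-1)%g v) = 0.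
Proof.
have xL c v1 v2 : zeta (Ad (a^-1)%g (c *: v1 + v2)) = c * zeta (Ad (a^-1)%g v1) + zeta (Ad (a^-1)%g v2).
  by rewrite -zL; congr zeta; exact: linearP.
have [w hw wE] := kk_riesz xL.
have kV : (k^-1)%g = expG (- u) by rewrite expGN.
have hNu : kk (- u) by rewrite -scaleN1r; exact: kkZ.
have fw : Ad k w = w.
  apply/eqP; rewrite -subr_eq0; apply/eqP; apply: ip_eq0; set y := _ - _.
  have hy : kk y.
    by rewrite /y addrC -scaleN1r; apply: kkL => //; exact: Ad_kk.
  rewrite {1}/y ipDl ipNl -[in X in ip (Ad k w) X](AdVK k y) Ad_isometry //.
  have hAy : kk (Ad (k^-1)%g y) by rewrite kV; exact: Ad_kk.
  by rewrite -!wE // zeta_conj // subrr.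
have w0 : w = 0 by apply: ip_eq0; rewrite -wE // zeta_fixed.
by move=> hv; rewrite wE // w0 ip0l.
Qed.

Lemma zeta_kk v : kk v -> zeta v = 0.
Proof. by move=> hv; rewrite -zeta_Ad // zeta_Ad_kk. Qed.

(** For w orthogonal to x, [Ad (a^-1)] sends x ^ w to cosh(r) x ^ w - sinh(r) w ^ e_time. As [zeta]
    kills the image and x ^ w, it kills w ^ e_time when r is nonzero; the direction of x is
    [zeta_X]. When r = 0 the factor [a] is 1 and can be moved freely in exp(p). *)
Lemma zeta_pp v : pp v -> zeta v = 0.
Proof.
have [x [r [x0 xx r0 XE]]] := pp_boost n0 hX.
have [r00|rn0] := eqVneq r 0.
  move=> hv; have X0 : X = 0 by rewrite XE r00 scale0r.
  rewrite -[v in LHS]addr0; apply: hz => t; exists u, (t *: v); split=> //; first exact: ppZ.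
  by rewrite X0 scaler0 expG0 !mulg1.
have zx : zeta (Phi (wedge x e_time)) = 0.
  have := zeta_X; rewrite XE zZ => /eqP; rewrite mulf_eq0 (negbTE rn0) => /eqP //.
have zw (w : 'cV[R]_(1 + n)) : w 0 0 = 0 -> bf x w = 0 -> zeta (Phi (wedge w e_time)) = 0.
  move=> w0 xw.
  have kxw : kk (Phi (wedge x w)) by rewrite /skew_space /= PhiK; [exact: wedge_skew|exact: wedge_orth].
  have := zeta_Ad_kk kxw.
  have -> : (a^-1)%g = expG ((- r) *: Phi (wedge x e_time)) by rewrite scaleNr expGN -XE.
  rewrite Ad_boost // (boost_perp _ w0 xw).
  have -> : cexp true (wedge x e_time) (- r) *m x = cfun true r *: x + sfun true r *: e_time.
    move: (wedge x e_time) (wedge_time_mulx x0 xx) (wedge_time_mul x0) => Z Zx Ze.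
    rewrite /cexp sfunN cfunN !mulmxDl mul1mx -!scalemxAl -mulmxA Zx mulmxN Ze opprK /kap mul1r.
    by move: (cfun _ _) (sfun _ _) => c s; apply/matrixP => i j; rewrite !mxE; ring.
  rewrite !wlin (wedgeC e_time) scalerN PhiD PhiN !PhiZ zD zN !zZ.
  rewrite (zeta_kk kxw) mulr0 add0r => /eqP; rewrite oppr_eq0 mulf_eq0 => /orP[|/eqP//].
  rewrite /sfun mulf_eq0 invr_eq0 pnatr_eq0 orbF subr_eq0 => /eqP /expR_inj h.
  by move: rn0; rewrite (_ : r = 0) ?eqxx //; lra.
move=> /(pp_boost n0)[y [r' [y0 yy _ ->]]].
have -> : y = bf x y *: x + (y - bf x y *: x) by rewrite addrC subrK.
have w0 : (y - bf x y *: x) 0 0 = 0 by move: (bf x y) => c; rewrite !mxE x0 y0 mulr0 subrr.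
have xw : bf x (y - bf x y *: x) = 0 by rewrite !bflin xx mulr1 subrr.
by rewrite zZ wedgeDl wedgeZl PhiD PhiZ zD zZ zx (zw _ w0 xw) mulr0 addr0 mulr0.
Qed.

Lemma zeta_eq0 v : zeta v = 0.
Proof.
move: v; apply: kk_pp_ind => [v v' h1 h2||]; [by rewrite zD h1 h2 addr0|exact: zeta_kk|exact: zeta_pp].
Qed.

End Spanning.

Lemma polar_setT : connected [set: G] -> polar = setT.
Proof.
move=> cG; apply: exp_spanning_setT => //.
- exact: polar_closed.
- exists 1%g, 0, 0; split; [exact: kk0|exact: pp0|by rewrite expG0 mulg1].
- move=> s [u [X [hu hX ->]]] zeta zL hz w; exact: (zeta_eq0 hu hX zL hz).
Qed.

Lemma cvg_wedge (T : Type) (F : set_system T) {FF : Filter F} (f g : T -> 'rV[R]_(1 + n)) a b :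
  f t @[t --> F] --> a -> g t @[t --> F] --> b ->
  Phi (wedge (f t)^T (g t)^T) @[t --> F] --> Phi (wedge a^T b^T).
Proof.
move=> fa gb.
have E (p q : 'rV[R]_(1 + n)) : Phi (wedge p^T q^T) =
    \sum_i p 0 i *: \sum_j q 0 j *: Phi (wedge (delta_mx 0 i)^T (delta_mx 0 j)^T).
  rewrite {1}(row_deltaE p) linear_sum /= (big_morph (wedge^~ _) (fun x x' => wedgeDl x x' _) (wedge0l _)).
  rewrite (big_morph _ PhiD Phi0); apply: eq_bigr => i _.
  rewrite linearZ /= wedgeZl PhiZ; congr (_ *: _).
  rewrite {1}(row_deltaE q) linear_sum /= (big_morph (wedge _) (fun x x' => wedgeDr x x' _) (wedge0r _)).
  rewrite (big_morph _ PhiD Phi0); apply: eq_bigr => j _.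
  by rewrite linearZ /= wedgeZr PhiZ.
have co (h : T -> 'rV[R]_(1 + n)) (c : 'rV[R]_(1 + n)) i : h t @[t --> F] --> c -> (h t 0 i : R) @[t --> F] --> (c 0 i : R).
  move=> hc; apply: (@cvg_comp _ _ _ h (fun w : 'rV[R]_(1 + n) => w 0 i) _ (nbhs c)) => //.
  exact: coord_continuous.
rewrite E; under eq_fun do rewrite E.
apply: cvg_big_sum => i.
have h : \sum_j g t 0 j *: Phi (wedge (delta_mx 0 i)^T (delta_mx 0 j)^T) @[t --> F] -->
    \sum_j b 0 j *: Phi (wedge (delta_mx 0 i)^T (delta_mx 0 j)^T).
  by apply: cvg_big_sum => j; exact: (cvgZr_tmp (co _ _ j gb)).
by exact: (cvgZ (co _ _ i fa) h).
Qed.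

(** * Noncompact closed subgroups *)

Section Asymptotics.
Variables (H : set G) (q : 'rV[R]_d -> 'rV[R]_d -> R).
Hypotheses (cG : connected [set: G]) (cH : closed H) (ncH : ~ compact H)
  (bq : bilinear_form q) (qH : forall h u v, H h -> q (Ad h u) (Ad h v) = q u v).

(** Otherwise the closed set [H] would lie in a compact [polar_ball]. Its radius [2 * c ^+ 2] is the
    trace form on a boost of size [c], by [ip_boost]. *)
Lemma unbounded_boost (c : R) : exists p : 'rV[R]_d * 'rV[R]_(1 + n) * R,
  [/\ kk p.1.1, space_sphere p.1.2, 0 <= p.2 /\ c <= p.2 &
      H (expG p.1.1 * expG (p.2 *: Phi (wedge p.1.2^T e_time)))%g].
Proof.
apply: contrapT => no; apply: ncH.
apply: (subclosed_compact cH (@polar_ball_compact (2 * c ^+ 2))) => h Hh.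
have : [set: G] h by [].
rewrite -(polar_setT cG) => -[u [X [hu hX hE]]]; rewrite hE.
apply: polar_in_ball => //.
have [x [r [x0 xx r0 XE]]] := pp_boost n0 hX.
have [cr|rc] := lerP c r.
  exfalso; apply: no; exists (u, x^T, r); split=> //=.
    by split; rewrite ?trmxK // mxE.
  by rewrite trmxK -XE -hE.
rewrite XE !ipZl !ipZr (ip_boost x0 xx).
rewrite (_ : r * (r * 2) = 2 * r ^+ 2); last by ring.
by rewrite ler_pM2l // lerXn2r ?nnegrE ?(ltW rc) //; exact: le_trans r0 (ltW rc).
Qed.

(* q (vs i) (ws i) is unchanged by the i-th element of H, which multiplies it by cs i * ds i
   up to a bounded factor. *)
Lemma contracted_orthogonal (F : set_system nat) (FF : ProperFilter F) (us Xs vs ws : nat -> 'rV[R]_d)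
    (cs ds : nat -> R) (v w : 'rV[R]_d) : \oo `<=` F ->
  (forall i, kk (us i)) -> (forall i, H (expG (us i) * expG (Xs i))%g) ->
  (forall i, Ad (expG (Xs i)) (vs i) = cs i *: vs i) ->
  (forall i, Ad (expG (Xs i)) (ws i) = ds i *: ws i) ->
  (forall i, `|cs i * ds i| <= harmonic i) ->
  vs i @[i --> F] --> v -> ws i @[i --> F] --> w -> q v w = 0.
Proof.
move=> iF hu hH hv hw hcd vsv wsw.
have [C C0 hC] := bilinear_bound bq; have [B B0 hB] := norm_ip.
pose m i : R := C * (B * (1 + ip (vs i) (vs i)) * (B * (1 + ip (ws i) (ws i)))).
have qm i : `|q (vs i) (ws i)| <= harmonic i * m i.
  have AdE k X u c : kk k -> Ad (expG X) u = c *: u ->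
      Ad (expG k * expG X)%g u = c *: Ad (expG k) u.
    by move=> hk hX; rewrite AdM hX; exact: linearZ_LR.
  have [ql qr] := bq.
  have q0l u : q 0 u = 0 by have := ql (-1) 0 0 u; rewrite scaler0 addr0 => h; lra.
  have q0r u : q u 0 = 0 by have := qr (-1) 0 0 u; rewrite scaler0 addr0 => h; lra.
  have qZl c u v' : q (c *: u) v' = c * q u v' by have := ql c u 0 v'; rewrite addr0 q0l addr0.
  have qZr c u v' : q v' (c *: u) = c * q v' u by have := qr c u 0 v'; rewrite addr0 q0r addr0.
  rewrite -(qH _ _ (hH i)) (AdE _ _ _ _ (hu i) (hv i)) (AdE _ _ _ _ (hu i) (hw i)) qZl qZr mulrA normrM.
  apply: ler_pM => //; apply: le_trans (hC _ _) _; apply: ler_wpM2l => //.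
  have nb u : `|Ad (expG (us i)) u| <= B * (1 + ip u u).
    by rewrite -(Ad_isometry u u (hu i)); exact: hB.
  by apply: ler_pM.
have icvg (ys : nat -> 'rV[R]_d) (y : 'rV[R]_d) : ys i @[i --> F] --> y -> (ip (ys i) (ys i) : R) @[i --> F] --> (ip y y : R).
  by move=> h; exact: (cvg_bilinear ip_bilinear h h).
have mcvg : m i @[i --> F] --> C * (B * (1 + ip v v) * (B * (1 + ip w w))).
  have f1 (ys : nat -> 'rV[R]_d) (y : 'rV[R]_d) : ys i @[i --> F] --> y ->
      (B * (1 + ip (ys i) (ys i)) : R) @[i --> F] --> (B * (1 + ip y y) : R).
    move=> h; have h1 : (1 + ip (ys i) (ys i) : R) @[i --> F] --> (1 + ip y y : R).
      by apply: (@cvgD _ R^o); [exact: cvg_cst|exact: icvg h].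
    by apply: cvgM; [exact: cvg_cst|exact: h1].
  by apply: cvgM; [exact: cvg_cst|apply: cvgM; [exact: f1 vsv|exact: f1 wsw]].
have hcvg : (harmonic i : R) @[i --> F] --> (0 : R).
  by apply: cvg_trans (@cvg_harmonic R); exact: cvg_fmap2.
have z : (harmonic i * m i : R) @[i --> F] --> (0 : R).
  by have := cvgM hcvg mcvg; rewrite mul0r; exact.
have qc : (`|q (vs i) (ws i)| : R) @[i --> F] --> (`|q v w| : R).
  by apply: (@cvg_norm _ _ _ F); exact: (cvg_bilinear bq vsv wsw).
have : `|q v w| <= 0 by apply: (ler_cvg_to qc z); near=> i; exact: qm.
by rewrite normr_le0 => /eqP.
Unshelve. all: by end_near.
Qed.

Theorem null_direction : exists x : 'cV[R]_(1 + n), [/\ x 0 0 = 0, bf x x = 1,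
  forall w w' : 'cV[R]_(1 + n), w 0 0 = 0 -> bf x w = 0 -> w' 0 0 = 0 -> bf x w' = 0 ->
    q (Phi (wedge (e_time + x) w)) (Phi (wedge (e_time + x) w')) = 0 &
  forall w : 'cV[R]_(1 + n), w 0 0 = 0 -> bf x w = 0 ->
    q (Phi (wedge (e_time + x) w)) (Phi (wedge (e_time - x) (e_time + x))) = 0].
Proof.
have /choice[f hf] : forall i : nat, exists p : 'rV[R]_d * 'rV[R]_(1 + n) * R,
    [/\ kk p.1.1, space_sphere p.1.2, 0 <= p.2 /\ i%:R <= p.2 &
      H (expG p.1.1 * expG (p.2 *: Phi (wedge p.1.2^T e_time)))%g].
  by move=> i; exact: unbounded_boost.
have [F [UF iF]] := @ultraFilterLemma _ (\oo : set_system nat) _.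
pose s i := (f i).1.2; pose r i := (f i).2.
have cS := @space_sphere_compact R n; rewrite compact_ultra in cS.
have [t [St cv]] : space_sphere `&` [set p | s i @[i --> F] --> p] !=set0.
  apply: (cS (s i @[i --> F])); first exact: ultra_fmap.
  by apply: (@filterS _ F _ setT) => [i _|]; [have [] := hf i|exact: filterT].
have [tt t0] := St.
have x0 : t^T 0 0 = 0 by rewrite mxE.
have PF : ProperFilter F by exact: ultra_proper.
(* [r i >= i] gives exp(- r i) <= 1 / (i + 1). *)
have rh i : `|expR (- r i)| <= harmonic i.
  have [_ _ [r0 ri] _] := hf i; rewrite ger0_norm ?expR_ge0 // expRN /harmonic /=.
  rewrite lef_pV2 ?qualifE /= ?expR_gt0 ?ltr0n //.
  by apply: le_trans (expR_ge1Dx _); rewrite -natr1 addrC lerD2l.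
have rh2 i : `|expR (- r i) * expR (- r i)| <= harmonic i.
  rewrite normrM -[leRHS]mul1r; apply: ler_pM => //.
  have [_ _ [r0 ri] _] := hf i.
  by rewrite ger0_norm ?expR_ge0 // -expR0 ler_expR oppr_le0.
(* A fixed w need not be orthogonal to the varying direction [s i]. Its projection is, and it tends
   to w when w is orthogonal to the limit direction. *)
pose wi (w : 'cV[R]_(1 + n)) (i : nat) : 'rV[R]_(1 + n) := w^T - bf w (s i)^T *: s i.
have s0 i : (s i)^T 0 0 = 0 by have [_ [_ h] _ _] := hf i; rewrite mxE.
have ss i : bf (s i)^T (s i)^T = 1 by have [_ [h _] _ _] := hf i.
have wi0 (w : 'cV[R]_(1 + n)) i : w 0 0 = 0 -> (wi w i)^T 0 0 = 0.
  move=> w0; have := s0 i; rewrite /wi; move: (s i) (bf w _) => p c; rewrite !mxE w0 => ->.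
  by rewrite mulr0 subrr.
have wip (w : 'cV[R]_(1 + n)) i : bf (s i)^T (wi w i)^T = 0.
  by rewrite /wi linearB linearZ /= trmxK !bflin ss mulr1 (bfC w) subrr.
pose lp i : 'rV[R]_(1 + n) := e_time^T + s i.
pose lm i : 'rV[R]_(1 + n) := e_time^T - s i.
have lpc : lp i @[i --> F] --> e_time^T + t by apply: (cvgD (cvg_cst _)).
have lmc : lm i @[i --> F] --> e_time^T - t by apply: (cvgB (cvg_cst _)).
have wic (w : 'cV[R]_(1 + n)) : bf t^T w = 0 -> wi w i @[i --> F] --> w^T.
  move=> tw; have h : (bf w (s i)^T : R) @[i --> F] --> (0 : R).
    have -> : 0 = bf w t^T by rewrite bfC tw.
    apply: (@cvg_comp _ _ _ s (fun p : 'rV[R]_(1 + n) => bf w p^T) _ (nbhs t)) => //.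
    by apply: linear_continuous_rV => a u v; rewrite linearP /= !bflin.
  have -> : w^T = w^T - 0 *: t by rewrite scale0r subr0.
  by apply: cvgB; [exact: cvg_cst|exact: cvgZ].
have lpT i : (lp i)^T = e_time + (s i)^T by rewrite linearD /= trmxK.
have lmT i : (lm i)^T = e_time - (s i)^T by rewrite linearB /= trmxK.
have lpE i (w : 'cV[R]_(1 + n)) : w 0 0 = 0 -> Ad (expG (r i *: Phi (wedge (s i)^T e_time)))
    (Phi (wedge (lp i)^T (wi w i)^T)) = expR (- r i) *: Phi (wedge (lp i)^T (wi w i)^T).
  move=> w0; rewrite (Ad_boost (s0 i) (ss i)) (boost_perp _ (wi0 _ _ w0) (wip _ _)).
  by rewrite lpT (boost_plus (s0 i) (ss i)) wedgeZl PhiZ.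
(* The factors exp(r) and exp(- r) cancel, so this bivector is fixed, and its pairing with a
   contracted one still decays at the rate exp(- r). *)
have lmE i : Ad (expG (r i *: Phi (wedge (s i)^T e_time)))
    (Phi (wedge (lm i)^T (lp i)^T)) = (1 : R) *: Phi (wedge (lm i)^T (lp i)^T).
  rewrite (Ad_boost (s0 i) (ss i)) lpT lmT.
  rewrite (boost_plus (s0 i) (ss i)) (boost_minus (s0 i) (ss i)) wedgeZl wedgeZr scalerA.
  by rewrite -expRD subrr expR0 PhiZ.
have kf i : kk (f i).1.1 by have [] := hf i.
have Hf i : H (expG (f i).1.1 * expG (r i *: Phi (wedge (s i)^T e_time)))%g by have [] := hf i.
have tE : (e_time^T + t)^T = e_time + t^T by rewrite linearD /= trmxK.
have tE' : (e_time^T - t)^T = e_time - t^T by rewrite linearB /= trmxK.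
have wc (w : 'cV[R]_(1 + n)) (tw : bf t^T w = 0) : Phi (wedge (lp i)^T (wi w i)^T) @[i --> F] -->
    Phi (wedge (e_time + t^T) w).
  by rewrite -tE -{2}[w]trmxK; exact: cvg_wedge lpc (wic _ tw).
have mc : Phi (wedge (lm i)^T (lp i)^T) @[i --> F] --> Phi (wedge (e_time - t^T) (e_time + t^T)).
  by rewrite -tE -tE'; exact: cvg_wedge.
have rh1 i : `|expR (- r i) * 1| <= harmonic i by rewrite mulr1.
exists t^T; split=> // [w w' w0 xw w0' xw'|w w0 xw].
  exact: (contracted_orthogonal PF iF kf Hf (fun i => lpE i w w0) (fun i => lpE i w' w0') rh2
    (wc _ xw) (wc _ xw')).
exact: (contracted_orthogonal PF iF kf Hf (fun i => lpE i w w0) lmE rh1 (wc _ xw) mc).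
Qed.

End Asymptotics.

End CartanDecomposition.

(** * The theorem *)

(** The local isomorphism lands in velocities of one-parameter groups, which [lie_orth_groupE]
    identifies with o(1,n). The projection [P] of all matrices onto o(1,n), Z to (Z - eta Z^T eta) /
    2, makes the inverse map linear everywhere. *)
Lemma lorentz_coordinates_exist {R : realType} {n d : nat} {G : lieGroupType R d} :
  locally_isomorphic_mxgroup G (orth_group R 1 n) ->
  exists Psi Phi, lorentz_coordinates (n := n) (G := G) Psi Phi.
Proof.
move=> [_ sO [Psi [[PsiO Pinj Psurj] PsiL PsiB]]].
rewrite (lie_orth_groupE sO) in PsiO Psurj.
pose P (Z : 'M[R]_(1 + n)) : 'M[R]_(1 + n) := \matrix_(i, j) ((Z i j - sgn i * sgn j * Z j i) / 2).
have Po Z : orth_alg R 1 n (P Z).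
  apply/orth_entry => i j; rewrite !mxE.
  have := @sgn_sq R n i; have := @sgn_sq R n j; move: (sgn i) (sgn j) => a b bb aa.
  transitivity ((a * Z i j - (a * a) * (b * Z j i)) / 2); first by ring.
  transitivity (- ((b * Z j i - (b * b) * (a * Z i j)) / 2)); last by ring.
  by rewrite aa bb; ring.
have Pid Z : orth_alg R 1 n Z -> P Z = Z.
  move=> /orth_entry oZ; apply/matrixP => i j; rewrite !mxE -mulrA -[sgn j * _]opprK -oZ.
  by rewrite mulrN mulrA sgn_sq mul1r; field.
have /choice[Phi PhiP] : forall Z, exists u, Psi u = P Z.
  by move=> Z; have [u _ uE] := Psurj _ (Po Z); exists u.
have inj u v : Psi u = Psi v -> u = v by apply: Pinj; rewrite inE.
exists Psi, Phi; split.
- by move=> a u v; exact: (PsiL _ _ _ I I).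
- by move=> a Z U; apply: inj; rewrite PsiL // !PhiP; apply/matrixP => i j; rewrite !mxE; field.
- by move=> u; exact: (PsiO _ I).
- by move=> u v; exact: (PsiB _ _ I I).
- by move=> u; apply: inj; rewrite PhiP Pid //; exact: (PsiO _ I).
- by move=> Z oZ; rewrite PhiP Pid.
Qed.

Lemma lie_isomorphic_coordinates {R : realType} {n d : nat} {G : lieGroupType R d}
    (Psi : 'rV[R]_d -> 'M[R]_(1 + n)) Phi (h : set 'rV[R]_d) (A : set 'M[R]_(1 + n)) :
  lorentz_coordinates (G := G) Psi Phi ->
  lie_subalgebra (@lie_bracket R d G) h -> lie_subalgebra (@commx R (1 + n)) A ->
  (forall Z, A Z -> orth_alg R 1 n Z) ->
  (forall Z, orth_alg R 1 n Z -> (h (Phi Z) <-> A Z)) ->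
  lie_isomorphic (@lie_bracket R d G) h (@commx R (1 + n)) A.
Proof.
move=> iso sh sA Ao hA; split=> //; exists Psi; split.
- split.
  + by move=> u hu; apply/hA; [exact: coord_orth iso u|rewrite (coordK iso)].
  + by move=> u v _ _; exact: (Psi_inj iso).
  + move=> Z AZ; exists (Phi Z); last exact: (icoordK iso (Ao _ AZ)).
    by apply/hA => //; exact: Ao.
- by move=> a u v _ _; exact: (coordL iso).
- by move=> u v _ _; exact: (coord_br iso).
Qed.

Lemma stab_spacelike {R : realType} {n : nat} (s : 'cV[R]_(1 + n)) : (0 < n)%N -> bf s s = 1 ->
  lie_isomorphic (@commx R (1 + n)) (stab_alg s) (@commx R (1 + n.-1)) (orth_alg R 1 n.-1).
Proof.
case: n s => // k s _ ss; apply: lie_isomorphic_trans (stab_spacelike_std k).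
by apply: spacelike_normal => //; exact: bf_e_last.
Qed.

Lemma stab_null {R : realType} {n : nat} (l : 'cV[R]_(1 + n)) : (0 < n)%N -> bf l l = 0 ->
  l 0 0 != 0 ->
  lie_isomorphic (@commx R (1 + n)) (stab_alg l) (@euc_bracket R n.-1) (euc_alg R n.-1).
Proof.
case: n l => // k l _ ll l0; apply: lie_isomorphic_trans (stab_null_std k).
apply: null_normal => //; first exact: bf_e_null.
have -> : e_null k = delta_mx 0 0 + delta_mx (last_ix k) 0 :> 'cV[R]_(1 + k.+1).
  by congr (delta_mx _ _ + _); apply: val_inj.
by rewrite !mxE /= addr0 oner_eq0.
Qed.

Theorem theorem1p3 (R : realType) (n d m : nat)
    (G : lieGroupType R d) (M : manifoldType R m)
    (act : G -> M -> M) (g : M -> 'M[R]_m) :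
  (3 <= n)%N ->
  connected [set: G] ->
  locally_isomorphic_mxgroup G (orth_group R 1 n) ->
  connected [set: M] ->
  smooth_action act ->
  lorentz_metric g ->
  (forall a : G, preserves_metric g (act a)) ->
  forall x : M, ~ compact (stabilizer act x) ->
    let h := lie_subgroup (stabilizer act x) in
    [\/ lie_isomorphic (@lie_bracket R d G) h
          (@commx R (1 + n)) (orth_alg R 1 n),
        lie_isomorphic (@lie_bracket R d G) h
          (@commx R (1 + n.-1)) (orth_alg R 1 n.-1) |
        lie_isomorphic (@lie_bracket R d G) h
          (@euc_bracket R n.-1) (euc_alg R n.-1)].
Proof.
move=> n3 cG locG _ sact Lg Pg x ncH h.
have [Psi [Phi iso]] := lorentz_coordinates_exist locG.
have PhiK := icoordK iso.
pose q := orbit_form act g x.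
have bq : bilinear_form q by exact: orbit_form_bilinear.
have qh u v : h u -> q u v = 0.
  move=> /(lie_stabilizer sact) hu; rewrite /q /orbit_form hu.
  by rewrite /Defs.form mul0mx mul0mx mxE.
have sh : lie_subalgebra (@lie_bracket R d G) h by exact: lie_stabilizer_subalgebra.
have [h0 hL hB] := sh.
have [y [y0 yy qll qlA]] := null_direction iso n3 cG (stabilizer_closed sact (x := x)) ncH bq
  (fun a u v Ha => orbit_form_Ad sact Pg u v Ha).
have ee : bf (e_time : 'cV[R]_(1 + n)) e_time = -1 by rewrite bf_time /e_time mxE.
(* Below, [l] is the contracted null vector of [null_direction] and [l'] the expanded one; a vector
   orthogonal to both is a space vector orthogonal to [y]. *)
have ey : bf e_time y = 0 by rewrite bf_time y0 oppr0.
pose l : 'cV[R]_(1 + n) := e_time + y; pose l' : 'cV[R]_(1 + n) := e_time - y.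
have l0 : l 0 0 != 0 by rewrite /l /e_time !mxE y0 /= addr0 oner_eq0.
have ll : bf l l = 0 by rewrite /l !bflin ee yy (bfC y) ey; ring.
have l'l' : bf l' l' = 0 by rewrite /l' !bflin ee yy (bfC y) ey; ring.
have ll' : bf l l' != 0.
  by rewrite /l /l' !bflin ee yy (bfC y) ey; apply/eqP; lra.
have perp w : wperp l l' w -> w 0 0 = 0 /\ bf y w = 0.
  by rewrite /wperp /l /l' !bflin bf_time => -[h1 h2]; split; lra.
(* [Phi] is defined on all matrices, so membership in o(1,n) is recorded along with the transported
   condition. *)
pose hm (Z : 'M[R]_(1 + n)) := orth_alg R 1 n Z /\ h (Phi Z).
have PhiB U V : orth_alg R 1 n U -> orth_alg R 1 n V ->
    Phi (commx U V) = @lie_bracket R d G (Phi U) (Phi V).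
  move=> oU oV; apply: (Psi_inj iso); rewrite (coord_br iso) !PhiK //; exact: orth_commx.
have hmL a U V : hm U -> hm V -> hm (a *: U + V).
  by move=> [oU hU] [oV hV]; split; [exact: orthL|rewrite (icoordL iso); exact: hL].
have hmB U V : hm U -> hm V -> hm (commx U V).
  by move=> [oU hU] [oV hV]; split; [exact: orth_commx|rewrite PhiB //; exact: hB].
have hm0 : hm 0 by split; [exact: orth0|rewrite (Phi0 iso)].
have qC u v : q u v = q v u by exact: orbit_form_sym.
have qmL a U V W : q (Phi (a *: U + V)) (Phi W) = a * q (Phi U) (Phi W) + q (Phi V) (Phi W).
  by rewrite (icoordL iso); have [ql _] := bq; exact: ql.
have qmI U V W : hm U -> orth_alg R 1 n V -> orth_alg R 1 n W ->
    q (Phi (commx U V)) (Phi W) + q (Phi V) (Phi (commx U W)) = 0.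
  by move=> [oU hU] oV oW; rewrite !PhiB //; exact: orbit_form_ad.
have qmN U V : orth_alg R 1 n U -> orth_alg R 1 n V -> q (Phi U) (Phi U) = 0 ->
    q (Phi U) (Phi V) = 0 -> q (Phi V) (Phi V) = 0 ->
    exists a b, (a != 0) || (b != 0) /\ hm (a *: U + b *: V).
  move=> oU oV UU UV VV; have [a [b [ab hab]]] := orbit_form_isotropic sact Lg UU UV VV.
  exists a, b; split=> //; split; last by rewrite (PhiD iso) !(PhiZ iso).
  by apply: orthL => //; rewrite -[_ *: V]addr0; apply: orthL => //; exact: orth0.
have [all|[s ss sE]|lE] := classification n3 hm0 hmL hmB qmL (fun U V => qC (Phi U) (Phi V))
  (fun U V hU => qh _ (Phi V) hU.2) qmI qmN l0 ll ll' l'l'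
  (fun w w' pw pw' => qll w w' (perp w pw).1 (perp w pw).2 (perp w' pw').1 (perp w' pw').2)
  (fun w pw => qlA w (perp w pw).1 (perp w pw).2).
- apply: Or31; apply: (lie_isomorphic_coordinates iso) => //.
    exact: orth_alg_subalgebra.
  by move=> Z oZ; split=> // _; have [] := all Z oZ.
- apply: Or32.
  have E : lie_isomorphic (@lie_bracket R d G) h (@commx R (1 + n)) (stab_alg s).
    apply: (lie_isomorphic_coordinates iso) => //; [exact: stab_alg_subalgebra|by move=> Z []|].
    move=> Z oZ; have [h1 h2] := sE Z oZ; split=> [hZ|[_ Zs]]; first by split=> //; apply: h1.
    by have [] := h2 Zs.
  by apply: (lie_isomorphic_trans E); apply: stab_spacelike => //; exact: leq_trans n3.
- apply: Or33.
  have E : lie_isomorphic (@lie_bracket R d G) h (@commx R (1 + n)) (stab_alg l).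
    apply: (lie_isomorphic_coordinates iso) => //; [exact: stab_alg_subalgebra|by move=> Z []|].
    move=> Z oZ; have [h1 h2] := lE Z oZ; split=> [hZ|[_ Zl]]; first by split=> //; apply: h1.
    by have [] := h2 Zl.
  by apply: (lie_isomorphic_trans E); apply: stab_null => //; exact: leq_trans n3.
Qed.
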